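(* Let $\mathcal{S},\mathcal{T}$ be operator systems that are $\Delta$-equivalent, and let $\mathcal{F}:\mathrm{Rep}_{\mathrm{C}^*}(\mathcal{S})\to\mathrm{Rep}_{\mathrm{C}^*}(\mathcal{T})$ and $\mathcal{G}:\mathrm{Rep}_{\mathrm{C}^*}(\mathcal{T})\to\mathrm{Rep}_{\mathrm{C}^*}(\mathcal{S})$ be the functors induced by a TRO $\mathcal{M}$ implementing the equivalence and by its adjoint $\mathcal{M}^*$, respectively, as defined in the context. Then, up to natural equivalence, $\mathcal{G}\circ\mathcal{F}\cong\mathrm{Id}_{\mathrm{Rep}_{\mathrm{C}^*}(\mathcal{S})}$ and $\mathcal{F}\circ\mathcal{G}\cong\mathrm{Id}_{\mathrm{Rep}_{\mathrm{C}^*}(\mathcal{T})}$. In particular, the categories $\mathrm{Rep}_{\mathrm{C}^*}(\mathcal{S})$ and $\mathrm{Rep}_{\mathrm{C}^*}(\mathcal{T})$ are equivalent via completely contractive functors.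
   Context: An operator system is a (not necessarily closed) selfadjoint subspace of some $\mathcal{B}(H)$ containing $I_H$. $[\,\cdot\,]$ is norm-closed linear span. A TRO is a linear subspace $\mathcal{M}\subseteq\mathcal{B}(H,K)$ with $\mathcal{M}\mathcal{M}^*\mathcal{M}\subseteq\mathcal{M}$; it is non-degenerate if $I_H\in[\mathcal{M}^*\mathcal{M}]$ and $I_K\in[\mathcal{M}\mathcal{M}^*]$. Concrete operator systems $\mathcal{S}\subseteq\mathcal{B}(H)$, $\mathcal{T}\subseteq\mathcal{B}(K)$ are TRO-equivalent via $\mathcal{M}$ if $\mathcal{M}\subseteq\mathcal{B}(H,K)$ is a non-degenerate TRO with $\mathcal{M}^*\mathcal{T}\mathcal{M}\subseteq\overline{\mathcal{S}}$, $\mathcal{M}\mathcal{S}\mathcal{M}^*\subseteq\overline{\mathcal{T}}$ (norm closures). Operator systems are $\Delta$-equivalent if they have unital complete order embeddings with TRO-equivalent images. $\mathcal{I}(\mathcal{S})$ is the injective envelope of $\mathcal{S}$ with its C*-algebra structure, $\mathcal{S}\subseteq\mathrm{C}^*_{\rm env}(\mathcal{S})\subseteq\mathcal{I}(\mathcal{S})$ with $\mathrm{C}^*_{\rm env}(\mathcal{S})$ the C*-envelope, and the multiplier C*-algebra of $\mathcal{S}$ is $\mathcal{A}_{\mathcal{S}}=\{a\in\mathcal{I}(\mathcal{S}):a\mathcal{S}\subseteq\mathcal{S},\ a^*\mathcal{S}\subseteq\mathcal{S}\}$, considered as contained in $\mathcal{S}$; $\mathcal{S}$ is an $\mathcal{A}_{\mathcal{S}}$-bimodule.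 The category $\mathrm{Rep}_{\mathrm{C}^*}(\mathcal{S})$. A C*-representation of $\mathcal{S}$ is a pair $(H,\phi)$ with $\phi:\mathcal{S}\to\mathcal{B}(H)$ a unital completely positive map whose restriction $\pi=\phi|_{\mathcal{A}_{\mathcal{S}}}$ is a *-homomorphism; one also writes $(H,\phi,\pi)$. (Then $\phi(a\cdot s)=\pi(a)\phi(s)$.) Objects are unitary equivalence classes of C*-representations, identified with representatives ($(H_1,\phi_1)$ and $(H_2,\phi_2)$ are unitarily equivalent if $U\phi_1(s)=\phi_2(s)U$ for all $s\in\mathcal{S}$, for some unitary $U:H_1\to H_2$). Morphisms from $(H_1,\phi_1,\pi_1)$ to $(H_2,\phi_2,\pi_2)$ are the completely bounded maps $\Phi:\phi_1(\mathcal{S})\to\phi_2(\mathcal{S})$ with $\Phi(\phi_1(a\cdot s\cdot b))=\Phi(\pi_1(a)\phi_1(s)\pi_1(b))=\pi_2(a)\Phi(\phi_1(s))\pi_2(b)$ for all $a,b\in\mathcal{A}_{\mathcal{S}}$, $s\in\mathcal{S}$. A functor $\mathcal{F}$ between such categories is completely contractive if $\|\mathcal{F}(\Phi)\|_{\rm cb}\le\|\Phi\|_{\rm cb}$ for every morphism $\Phi$. The functors. Given $\Delta$-equivalent $\mathcal{S},\mathcal{T}$, take complete order embeddings of $\mathcal{S}$ and $\mathcal{T}$, with images generating copies of their C*-envelopes, and a non-degenerate TRO $\mathcal{M}$ such that (identifying $\mathcal{S},\mathcal{T}$ with their images) $\mathcal{S}$ and $\mathcal{T}$ are TRO-equivalent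 via $\mathcal{M}$, $\mathcal{A}_{\mathcal{S}}=[\mathcal{M}^*\mathcal{M}]$ and $\mathcal{A}_{\mathcal{T}}=[\mathcal{M}\mathcal{M}^*]$; fix such data. For an object $(H,\phi,\pi)$ of $\mathrm{Rep}_{\mathrm{C}^*}(\mathcal{S})$ let $K$ be the Hilbert space completion (after quotienting by null vectors) of $\mathcal{M}\otimes_{\mathcal{A}_{\mathcal{S}}}H$ with respect to $\langle a\otimes\xi,b\otimes\eta\rangle=\langle\phi(b^*a)\xi,\eta\rangle$, let $\psi:\mathcal{T}\to\mathcal{B}(K)$ be determined by $\langle\psi(t)(a\otimes\xi),b\otimes\eta\rangle=\langle\phi(b^*\cdot t\cdot a)\xi,\eta\rangle$, and $\mathcal{F}((H,\phi,\pi))=(K,\psi,\psi|_{\mathcal{A}_{\mathcal{T}}})$. Put $\nu:\mathcal{M}\to\mathcal{B}(H,K)$, $\nu(m)\xi=m\otimes\xi$; then $\psi(m\cdot s\cdot n^* )=\nu(m)\phi(s)\nu(n)^*$. For a morphism $\Phi$ from $(H_1,\phi_1,\pi_1)$ to $(H_2,\phi_2,\pi_2)$, with $\nu_i,\psi_i$ the corresponding maps, $\mathcal{F}(\Phi):\psi_1(\mathcal{T})\to\psi_2(\mathcal{T})$ is the completely bounded linear map determined by $\nu_1(n)\phi_1(s)\nu_1(m)^*\mapsto\nu_2(n)\Phi(\phi_1(s))\nu_2(m)^*$, $n,m\in\mathcal{M}$, $s\in\mathcal{S}$. The functor $\mathcal{G}$ is defined in the same way with $\mathcal{M}^*$ in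 place of $\mathcal{M}$ and the roles of $\mathcal{S},\mathcal{T}$ exchanged.
   Formalization: Existence of F and G is proved only when M*TM ⊆ S and MSM* ⊆ T hold without closures (automatic for norm-closed S, T), since otherwise F(Φ) need not map ψ1(T) into ψ2(T); whenever functors given by the recipe exist, the equivalence is proved for all S, T. *)

(* Defs.v *)
From HB Require Import structures.
From mathcomp Require Import all_boot all_order all_algebra.
From mathcomp Require Import sesquilinear complex.
From mathcomp Require Import all_classical all_reals all_analysis.

Set Implicit Arguments.
Unset Strict Implicit.
Unset Printing Implicit Defensive.

Import Order.TTheory GRing.Theory Num.Theory.
Import numFieldNormedType.Exports.

Local Open Scope classical_set_scope.
Local Open Scope ring_scope.
Local Open Scope complex_scope.

HB.mixin Record CompleteNormedModule_isHilbert (R : realType) H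
    of CompleteNormedModule R[i] H := {
  hdot : {dot H for Num.conj} ;
  hdotE : forall x : H, hdot x x = `|x| ^+ 2
}.

#[short(type="hilbertType")]
HB.structure Definition Hilbert (R : realType) :=
  {H of CompleteNormedModule_isHilbert R H & CompleteNormedModule R[i] H}.

Notation "''[' x , y ]" := (hdot x y) : ring_scope.

Section hilbert_norm.
Context {R : realType}.

Definition hnorm (V : normedModType R[i]) (x : V) : R := complex.Re `|x|.

Context {V : normedModType R[i]}.
Implicit Types (x y : V) (a : R[i]).

Lemma hnormE x : (hnorm x)%:C = `|x|.
Proof. by rewrite /hnorm RRe_real // normr_real. Qed.

Lemma hnorm_ge0 x : 0 <= hnorm x.
Proof. by rewrite -lecR hnormE normr_ge0. Qed.

Lemma hnorm0 : hnorm (0 : V) = 0.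
Proof. by rewrite /hnorm normr0. Qed.

Lemma hnorm0_eq0 x : hnorm x = 0 -> x = 0.
Proof. by move=> x0; apply/normr0_eq0; rewrite -hnormE x0. Qed.

Lemma hnormD x y : hnorm (x + y) <= hnorm x + hnorm y.
Proof. by rewrite -lecR rmorphD /= !hnormE ler_normD. Qed.

Lemma hnormZ a x : hnorm (a *: x) = complex.Re `|a| * hnorm x.
Proof.
apply/(@complexI R); rewrite rmorphM /= !hnormE.
exact: normrZ.
Qed.

End hilbert_norm.

Section bounded_operators.
Context {R : realType} (H K : hilbertType R).

Definition bounded_operator : {pred H -> K} :=
  [pred f | `[< linear f /\ continuous f >]].

Lemma bounded_operator_submod : submod_closed bounded_operator.
Proof.
split.
  apply/asboolP; split; last exact: cst_continuous.
  by move=> a x y; rewrite /= scaler0 addr0.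
move=> a f g /asboolP[lf cf] /asboolP[lg cg]; apply/asboolP; split.
  move=> b x y.
  rewrite -[(a *: f + g) _]/(a *: f _ + g _) lf lg.
  rewrite -[(a *: f + g) x]/(a *: f x + g x) -[(a *: f + g) y]/(a *: f y + g y).
  by rewrite !scalerDr !scalerA (mulrC a b) addrACA.
move=> x.
apply: (@continuousD _ _ _ (fun z => a *: f z) g x _ (cg x)).
by apply: continuousZl_tmp; exact: cf.
Qed.

HB.instance Definition _ :=
  GRing.isSubmodClosed.Build _ _ bounded_operator bounded_operator_submod.

Record bop := Bop { bop_fun :> H -> K ; _ : bop_fun \in bounded_operator }.

HB.instance Definition _ := [isSub for bop_fun].
HB.instance Definition _ := [Choice of bop by <:].
HB.instance Definition _ := [SubChoice_isSubLmodule of bop by <:].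
Lemma bop_linear (T : bop) : linear T.
Proof. by case: T => f /= /asboolP[]. Qed.

HB.instance Definition _ (T : bop) := GRing.isLinear.Build R[i] H K _ T (bop_linear T).

Lemma bop_continuous (T : bop) : continuous T.
Proof. by case: T => f /= /asboolP[]. Qed.

Definition opnorm (T : bop) : R :=
  sup [set hnorm (T x) | x in [set x : H | hnorm x <= 1]].

Lemma bop_bounded (T : bop) :
  exists2 c : R, 0 <= c & forall x, hnorm (T x) <= c * hnorm x.
Proof.
have /linear_bounded_continuous/linear_boundedP/pinfty_ex_gt0[r r0 Tr] :=
  @bop_continuous T.
have rr : (complex.Re r)%:C = r by rewrite RRe_real // gtr0_real.
exists (complex.Re r) => [|x]; first by rewrite -lecR rr ltW.
rewrite -lecR rmorphM /= !hnormE rr; exact: Tr.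
Qed.

Lemma opnorm_has_sup (T : bop) :
  has_sup [set hnorm (T x) | x in [set x : H | hnorm x <= 1]].
Proof.
split; first by exists (hnorm (T 0)), 0 => //=; rewrite hnorm0.
have [c c0 Tc] := bop_bounded T; exists c => _ [x /= x1 <-].
by rewrite (le_trans (Tc x)) // ler_piMr.
Qed.

Lemma opnorm_ge0 T : 0 <= opnorm T.
Proof.
apply: (le_trans (hnorm_ge0 (T 0))); apply: ub_le_sup.
  by have [] := opnorm_has_sup T.
by exists 0 => /=; rewrite ?hnorm0.
Qed.

Lemma opnorm_le (T : bop) (c : R) :
  (forall x, hnorm x <= 1 -> hnorm (T x) <= c) -> opnorm T <= c.
Proof.
move=> Tc; apply: ge_sup; first by have [] := opnorm_has_sup T.
by move=> _ [x x1 <-]; exact: Tc.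
Qed.

Lemma le_opnorm (T : bop) x : hnorm (T x) <= opnorm T * hnorm x.
Proof.
have [x0|x0] := eqVneq (hnorm x) 0.
  by rewrite x0 mulr0 (hnorm0_eq0 x0) linear0 hnorm0.
have x_gt0 : 0 < hnorm x by rewrite lt_neqAle eq_sym x0 hnorm_ge0.
rewrite -ler_pdivrMr // mulrC.
have -> : (hnorm x)^-1 * hnorm (T x) = hnorm (T ((hnorm x)^-1%:C *: x)).
  rewrite linearZ /= hnormZ ger0_norm /= ?lecR ?invr_ge0 ?hnorm_ge0 //.
apply: ub_le_sup; first by have [] := opnorm_has_sup T.
exists ((hnorm x)^-1%:C *: x) => //=.
by rewrite hnormZ ger0_norm /= ?lecR ?invr_ge0 ?hnorm_ge0 // mulVf.
Qed.

Definition bop_norm (T : bop) : R[i] := (opnorm T)%:C.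

Lemma bop_normD (S T : bop) : bop_norm (S + T) <= bop_norm S + bop_norm T.
Proof.
rewrite -rmorphD lecR; apply: opnorm_le => x x1.
apply: (le_trans (hnormD (S x) (T x))); apply: lerD.
  by rewrite (le_trans (le_opnorm S x)) // ler_piMr // opnorm_ge0.
by rewrite (le_trans (le_opnorm T x)) // ler_piMr // opnorm_ge0.
Qed.

Lemma bop_normZ (a : R[i]) (T : bop) : bop_norm (a *: T) = `|a| * bop_norm T.
Proof.
have h (b : R[i]) (S : bop) : opnorm (b *: S) <= complex.Re `|b| * opnorm S.
  apply: opnorm_le => x x1; rewrite -[(b *: S) x]/(b *: S x) hnormZ.
  rewrite ler_wpM2l ?hnorm_ge0 ?(hnorm_ge0 (b : R[i]^o)) //.
  by rewrite (le_trans (le_opnorm S x)) // ler_piMr // opnorm_ge0.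
have [->|a0] := eqVneq a 0.
  rewrite scale0r normr0 mul0r; apply/eqP; rewrite eq_le lecR.
  rewrite (_ : 0 <= _ = true) ?andbT; last by rewrite lecR opnorm_ge0.
  by apply: opnorm_le => x _; rewrite hnorm0.
have ar : (complex.Re `|a|)%:C = `|a| by rewrite RRe_real // normr_real.
have a_gt0 : 0 < complex.Re `|a| by rewrite -ltcR ar normr_gt0.
rewrite -ar -rmorphM; congr _%:C; apply/eqP; rewrite eq_le h /=.
have := h a^-1 (a *: T); rewrite scalerA mulVf // scale1r.
rewrite -(ler_pM2l a_gt0) mulrA => /le_trans; apply.
have ar' : (complex.Re `|a^-1|)%:C = `|a^-1|.
  by rewrite RRe_real // normr_real.
rewrite -[leRHS]mul1r ler_wpM2r ?opnorm_ge0 // -lecR rmorphM.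
by rewrite [X in X * _]ar [X in _ * X]ar' -normrM divff // normr1.
Qed.

Lemma bop_norm0_eq0 (T : bop) : bop_norm T = 0 -> T = 0.
Proof.
move=> /(@complexI R) T0; apply/val_inj/funext => x /=.
apply: hnorm0_eq0; apply/eqP; rewrite eq_le hnorm_ge0 andbT.
by rewrite (le_trans (le_opnorm T x)) // T0 mul0r.
Qed.

HB.instance Definition _ :=
  Lmodule_isNormed.Build R[i] bop bop_normD bop_normZ bop_norm0_eq0.

End bounded_operators.

Notation "''B' ( H , K )" := (bop H K) (format "''B' ( H ,  K )") : type_scope.
Notation "''B' ( H )" := (bop H H) (format "''B' ( H )") : type_scope.

Section operator_algebra.
Context {R : realType}.
Implicit Types H K L : hilbertType R.

Lemma bid_subproof H : (id : H -> H) \in @bounded_operator R H H.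
Proof. by apply/asboolP; split => // x; exact: cvg_id. Qed.

Definition bid H : 'B(H) := Bop (bid_subproof H).

Lemma bcomp_subproof H K L (S : 'B(K, L)) (T : 'B(H, K)) :
  (fun x => S (T x)) \in @bounded_operator R H L.
Proof.
apply/asboolP; split; first by move=> a x y; rewrite !linearP.
move=> x; apply: (@continuous_comp _ _ _ T S); exact: bop_continuous.
Qed.

Definition bcomp H K L (S : 'B(K, L)) (T : 'B(H, K)) : 'B(H, L) :=
  Bop (bcomp_subproof S T).

(* The Hilbert space adjoint exists and is unique by the Riesz representation
   theorem, so the default value 0 of [xget] is never reached. *)
Definition adj H K (T : 'B(H, K)) : 'B(K, H) :=
  xget 0 [set X : 'B(K, H) | forall x y, '[T x, y] = '[x, X y]].

End operator_algebra.

Notation "S ** T" := (bcomp S T) (at level 40, left associativity) : ring_scope.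

Section subspaces.
Context {R : realType}.

Definition linear_subspace (V : lmodType R[i]) (A : set V) : Prop :=
  A 0 /\ forall (a : R[i]) x y, A x -> A y -> A (a *: x + y).

Definition lspan (V : lmodType R[i]) (A : set V) : set V :=
  smallest (@linear_subspace V) A.

Definition cspan (V : normedModType R[i]) (A : set V) : set V :=
  closure (lspan A : set V).

(* Maps defined on a subset [A] of a vector space are functions on the subtype
   [set_type A]; the algebraic conditions compare the underlying vectors. *)
Definition linear_on (V W : lmodType R[i]) (A : set V) (f : A -> W) : Prop :=
  forall (a : R[i]) (x y z : A),
    val z = a *: val x + val y -> f z = a *: f x + f y.

End subspaces.

Section matrix_norms.
Context {R : realType}.
Implicit Types H K : hilbertType R.

(* Matrices over B(H, K) act on tuples of vectors, i.e. M_n(B(H, K)) is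
   identified with B(H^n, K^n), where H^n is the Hilbert space direct sum. *)
Definition vnorm H n (xi : 'I_n -> H) : R :=
  Num.sqrt (\sum_(i < n) hnorm (xi i) ^+ 2).

Definition mxact H K n (X : 'M['B(H, K)]_n) (xi : 'I_n -> H) : 'I_n -> K :=
  fun i => \sum_(j < n) X i j (xi j).

Definition mxnorm H K n (X : 'M['B(H, K)]_n) : R :=
  sup [set vnorm (mxact X xi) | xi in [set xi : 'I_n -> H | vnorm xi <= 1]].

(* In the order of R[i], 0 <= z means that z is a nonnegative real number. *)
Definition mxpos H n (X : 'M['B(H)]_n) : Prop :=
  forall xi : 'I_n -> H, 0 <= \sum_(i < n) '[mxact X xi i, xi i].

Definition cb_norm H K (A : set 'B(H)) (f : A -> 'B(K)) : \bar R :=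
  ereal_sup [set r | exists n (X : 'M[A]_n),
    mxnorm (map_mx val X) <= 1 /\ r = (mxnorm (map_mx f X))%:E].

Definition completely_bounded H K (A : set 'B(H)) (f : A -> 'B(K)) : Prop :=
  (cb_norm f < +oo)%E.

End matrix_norms.

Section matrix_norm_theory.
Context {R : realType}.
Implicit Types H K L : hilbertType R.

Lemma vnorm_ge0 H n (xi : 'I_n -> H) : 0 <= vnorm xi.
Proof. exact: sqrtr_ge0. Qed.

Lemma vnormZ H n (a : R) (xi : 'I_n -> H) : 0 <= a ->
  vnorm (fun i => a%:C *: xi i) = a * vnorm xi.
Proof.
move=> a0; rewrite /vnorm -[X in X * _](ger0_norm a0) -sqrtr_sqr.
rewrite -sqrtrM ?sqr_ge0 // mulr_sumr; congr Num.sqrt; apply: eq_bigr => i _.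
by rewrite hnormZ ger0_norm ?lecR // exprMn.
Qed.

Lemma hnorm_le_vnorm H n (xi : 'I_n -> H) i : hnorm (xi i) <= vnorm xi.
Proof.
rewrite -[leLHS]ger0_norm ?hnorm_ge0 // -sqrtr_sqr ler_wsqrtr //.
by rewrite (bigD1 i) //= lerDl sumr_ge0 // => j _; exact: sqr_ge0.
Qed.

Lemma mxnorm_has_sup H K n (X : 'M['B(H, K)]_n) :
  has_sup [set vnorm (mxact X xi) | xi in [set xi : 'I_n -> H | vnorm xi <= 1]].
Proof.
split.
  exists (vnorm (mxact X (fun=> 0))), (fun=> 0) => //=.
  by rewrite /vnorm big1 ?sqrtr0 // => i _; rewrite hnorm0 expr0n.
exists (Num.sqrt (\sum_(i < n) (\sum_(j < n) opnorm (X i j)) ^+ 2)).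
move=> _ [xi /= xi1 <-]; rewrite ler_wsqrtr // ler_sum // => i _.
rewrite ler_sqr ?nnegrE ?hnorm_ge0 ?sumr_ge0 // => [|j _]; last exact: opnorm_ge0.
rewrite /mxact; elim/big_ind2 : _ => [|x a y b xa yb|j _].
- by rewrite hnorm0.
- by rewrite (le_trans (hnormD _ _)) // lerD.
- rewrite (le_trans (le_opnorm _ _)) // ler_piMr ?opnorm_ge0 //.
  exact: le_trans (hnorm_le_vnorm _ _) xi1.
Qed.

Lemma mxnorm_ge H K n (X : 'M['B(H, K)]_n) xi :
  vnorm xi <= 1 -> vnorm (mxact X xi) <= mxnorm X.
Proof.
by move=> xi1; apply: ub_le_sup; [case: (mxnorm_has_sup X)|exists xi].
Qed.

Lemma mxnorm_le H K n (X : 'M['B(H, K)]_n) c :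
  (forall xi, vnorm xi <= 1 -> vnorm (mxact X xi) <= c) -> mxnorm X <= c.
Proof.
move=> Xc; apply: ge_sup; first by case: (mxnorm_has_sup X).
by move=> _ [xi xi1 <-]; exact: Xc.
Qed.

Lemma mxnormZ_le H K n (X Y : 'M['B(H, K)]_n) (a : R) : 0 <= a ->
  (forall i j, Y i j = a%:C *: X i j) -> mxnorm Y <= a * mxnorm X.
Proof.
move=> a0 YX; apply: mxnorm_le => xi xi1.
have -> : mxact Y xi = fun i => a%:C *: mxact X xi i.
  apply/funext => i; rewrite /mxact scaler_sumr; apply: eq_bigr => j _.
  by rewrite YX.
by rewrite vnormZ // ler_wpM2l // mxnorm_ge.
Qed.

Lemma cb_norm_bound H K (A : set 'B(H)) (f : A -> 'B(K)) (c t : R) n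
    (X : 'M[A]_n) :
  linear_subspace A -> linear_on f -> (cb_norm f <= c%:E)%E -> 0 < t ->
  mxnorm (map_mx val X) <= t -> mxnorm (map_mx f X) <= t * c.
Proof.
move=> [A0 AD] lf fc t0 Xt.
have AZ (a : R[i]) (x : A) : (a *: val x) \in A.
  by apply/mem_set; rewrite -[a *: _]addr0; apply: AD => //; exact/set_mem/valP.
have fZ a x : f (SigSub (AZ a x)) = a *: f x.
  pose z : A := SigSub (mem_set A0).
  have f0 : f z = 0.
    have := lf 1 z z z; rewrite /= scaler0 addr0 scale1r => /(_ erefl) /eqP.
    by rewrite -subr_eq0 opprD addNKr oppr_eq0 => /eqP.
  by rewrite (lf a x z) /= ?addr0 // f0 addr0.
pose Y := map_mx (fun x => SigSub (AZ t^-1%:C x) : A) X.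
have Y1 : mxnorm (map_mx val Y) <= 1.
  apply: (@le_trans _ _ (t^-1 * mxnorm (map_mx val X))).
    apply: mxnormZ_le => [|i j]; first by rewrite invr_ge0 ltW.
    by rewrite !mxE.
  by rewrite mulrC ler_pdivrMr // mul1r.
have fY : mxnorm (map_mx f Y) <= c.
  by rewrite -lee_fin (le_trans _ fc) //; apply: ereal_sup_ubound; exists n, Y.
apply: (@le_trans _ _ (t * mxnorm (map_mx f Y))).
  apply: mxnormZ_le => [|i j]; first exact: ltW.
  rewrite !mxE fZ scalerA -rmorphM divff ?gt_eqF // rmorph1 scale1r //.
by rewrite ler_wpM2l // ltW.
Qed.

Lemma completely_boundedP H K (A : set 'B(H)) (f : A -> 'B(K)) :
  completely_bounded f -> exists2 c : R, 0 < c & (cb_norm f <= c%:E)%E.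
Proof.
rewrite /completely_bounded; case: (cb_norm f) => [r _|//|_].
  by exists (Num.max r 1); rewrite ?lt_max ?ltr01 ?orbT // lee_fin le_max lexx.
by exists 1 => //; rewrite leNye.
Qed.

End matrix_norm_theory.

Section operator_systems.
Context {R : realType}.
Implicit Types H K L : hilbertType R.

Definition is_opsys H (S : set 'B(H)) : Prop :=
  [/\ linear_subspace S, forall x, S x -> S (adj x) & S (bid H)].

Record opsys := OpSys {
  os_space : hilbertType R ;
  os_set :> set 'B(os_space) ;
  os_is_opsys : is_opsys os_set }.

Definition unital H K (A : set 'B(H)) (f : A -> 'B(K)) : Prop :=
  forall x : A, val x = bid H -> f x = bid K.

Definition ucp H K (A : set 'B(H)) (f : A -> 'B(K)) : Prop :=
  [/\ linear_on f, unital f &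
      forall n (X : 'M[A]_n), mxpos (map_mx val X) -> mxpos (map_mx f X)].

Definition complete_order_embedding H K (A : set 'B(H)) (f : A -> 'B(K)) : Prop :=
  [/\ linear_on f, unital f &
      forall n (X : 'M[A]_n), mxpos (map_mx val X) <-> mxpos (map_mx f X)].

Definition is_cstar H (A : set 'B(H)) : Prop :=
  [/\ is_opsys A, forall x y, A x -> A y -> A (x ** y) & closed A].

Definition cstar_gen H (A : set 'B(H)) : set 'B(H) :=
  smallest (@is_cstar H) A.

Definition star_hom H K (A : set 'B(H)) (f : A -> 'B(K)) : Prop :=
  [/\ linear_on f,
      forall x y z : A, val z = val x ** val y -> f z = f x ** f y &
      forall x y : A, val y = adj (val x) -> f y = adj (f x)].

(* Injectivity in the category of operator systems and unital completely
   positive maps. *)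
Definition injective_opsys L (I : set 'B(L)) : Prop :=
  is_opsys I /\
  forall H (V W : set 'B(H)), is_opsys V -> is_opsys W -> V `<=` W ->
  forall f : V -> 'B(L), ucp f -> (forall v, I (f v)) ->
  exists g : W -> 'B(L), [/\ ucp g, forall w, I (g w) &
    forall (v : V) (w : W), val v = val w -> g w = f v].

(* An injective envelope of [S]: a minimal injective operator system containing
   a copy of [S].  By Choi and Effros an injective operator system is completely
   order isomorphic to a C*-algebra, in a unique way, so it is realized here as
   a C*-algebra of operators and its product is the composition. *)
Record injective_envelope (S : opsys) := InjectiveEnvelope {
  ie_space : hilbertType R ;
  ie_alg : set 'B(ie_space) ;
  ie_emb : S -> 'B(ie_space) ;
  ie_cstar : is_cstar ie_alg ;
  ie_injective : injective_opsys ie_alg ;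
  ie_embP : complete_order_embedding ie_emb ;
  ie_emb_in : range ie_emb `<=` ie_alg ;
  ie_minimal : forall J : set 'B(ie_space), injective_opsys J ->
    range ie_emb `<=` J -> J `<=` ie_alg -> J = ie_alg }.

Arguments ie_emb {S} E s : rename.
Arguments ie_alg {S} E _ : rename.

Definition cstar_envelope (S : opsys) (E : injective_envelope S) :
    set 'B(ie_space E) :=
  cstar_gen (range (ie_emb E)).
Arguments cstar_envelope {S} E _.

(* The multiplier C*-algebra, inside the injective envelope and, since it lies
   in the image of [S], as a subset of [S]. *)
Definition env_multipliers (S : opsys) (E : injective_envelope S) :
    set 'B(ie_space E) :=
  [set a | ie_alg E a /\ forall s : S,
    range (ie_emb E) (a ** ie_emb E s) /\
    range (ie_emb E) (adj a ** ie_emb E s)].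
Arguments env_multipliers {S} E _.

Definition multipliers (S : opsys) (E : injective_envelope S) : set S :=
  ie_emb E @^-1` env_multipliers E.
Arguments multipliers {S} E _.

End operator_systems.

Arguments opsys : clear implicits.
Arguments ie_emb {R S} E s : rename.
Arguments ie_alg {R S} E _ : rename.
Arguments cstar_envelope {R S} E _.
Arguments env_multipliers {R S} E _.
Arguments multipliers {R S} E _.

Section tro.
Context {R : realType}.
Implicit Types H K : hilbertType R.

Definition adj_set H K (M : set 'B(H, K)) : set 'B(K, H) := [set adj m | m in M].

Definition prod_set H K L (M : set 'B(K, L)) (N : set 'B(H, K)) : set 'B(H, L) :=
  [set m ** n | m in M & n in N].

Definition is_tro H K (M : set 'B(H, K)) : Prop :=
  linear_subspace M /\
  forall a b c, M a -> M b -> M c -> M (a ** adj b ** c).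

Definition nondegenerate H K (M : set 'B(H, K)) : Prop :=
  cspan (prod_set (adj_set M) M) (bid H) /\
  cspan (prod_set M (adj_set M)) (bid K).

Definition tro_equivalent_via H K (S : set 'B(H)) (T : set 'B(K))
    (M : set 'B(H, K)) : Prop :=
  [/\ is_tro M, nondegenerate M,
      prod_set (prod_set (adj_set M) T) M `<=` closure S &
      prod_set (prod_set M S) (adj_set M) `<=` closure T].

Definition delta_equivalent (S T : opsys R) : Prop :=
  exists H K (alpha : S -> 'B(H)) (beta : T -> 'B(K)) (M : set 'B(H, K)),
    [/\ complete_order_embedding alpha, complete_order_embedding beta &
        tro_equivalent_via (range alpha) (range beta) M].

(* The C*-algebra generated by the image of [alpha] is a copy of the
   C*-envelope. *)
Definition generates_envelope (S : opsys R) (E : injective_envelope S) H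
    (alpha : S -> 'B(H)) : Prop :=
  exists rho : cstar_envelope E -> 'B(H),
    [/\ star_hom rho, injective rho, range rho = cstar_gen (range alpha) &
        forall (s : S) (x : cstar_envelope E), val x = ie_emb E s ->
          rho x = alpha s].

Definition adapted (S T : opsys R)
    (ES : injective_envelope S) (ET : injective_envelope T) H K
    (alpha : S -> 'B(H)) (beta : T -> 'B(K)) (M : set 'B(H, K)) : Prop :=
  [/\ complete_order_embedding alpha /\ complete_order_embedding beta,
      generates_envelope ES alpha /\ generates_envelope ET beta,
      tro_equivalent_via (range alpha) (range beta) M,
      alpha @` multipliers ES = cspan (prod_set (adj_set M) M) &
      beta @` multipliers ET = cspan (prod_set M (adj_set M))].

End tro.

Record category := Category {
  ob :> Type ;
  hom : ob -> ob -> Type ;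
  idm : forall x, hom x x ;
  compm : forall x y z, hom y z -> hom x y -> hom x z ;
  compmA : forall x y z w (h : hom z w) (g : hom y z) (f : hom x y),
    compm h (compm g f) = compm (compm h g) f ;
  comp1m : forall x y (f : hom x y), compm (idm y) f = f ;
  compm1 : forall x y (f : hom x y), compm f (idm x) = f }.

Record functor (C D : category) := Functor {
  fob :> C -> D ;
  fmap : forall x y, hom x y -> hom (fob x) (fob y) ;
  fmap1 : forall x, fmap (idm x) = idm (fob x) ;
  fmapM : forall x y z (g : hom y z) (f : hom x y),
    fmap (compm g f) = compm (fmap g) (fmap f) }.

Definition id_functor (C : category) : functor C C :=
  @Functor C C id (fun _ _ f => f) (fun _ => erefl) (fun _ _ _ _ _ => erefl).

Section comp_functor.
Variables (C D E : category) (G : functor D E) (F : functor C D).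

Lemma comp_fmap1 x : fmap G (fmap F (idm x)) = idm (G (F x)).
Proof. by rewrite !fmap1. Qed.

Lemma comp_fmapM x y z (g : hom y z) (f : hom x y) :
  fmap G (fmap F (compm g f)) = compm (fmap G (fmap F g)) (fmap G (fmap F f)).
Proof. by rewrite !fmapM. Qed.

Definition comp_functor : functor C E :=
  @Functor C E (G \o F) (fun x y f => fmap G (fmap F f)) comp_fmap1 comp_fmapM.

End comp_functor.

Definition isomorphism (C : category) (x y : C) (f : hom x y) : Prop :=
  exists g : hom y x, compm g f = idm x /\ compm f g = idm y.

Definition naturally_equivalent (C D : category) (F G : functor C D) : Prop :=
  exists eta : forall x, hom (F x) (G x),
    (forall x, isomorphism (eta x)) /\
    forall x y (f : hom x y), compm (eta y) (fmap F f) = compm (fmap G f) (eta x).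

Section representations.
Context {R : realType} {S : opsys R} (E : injective_envelope S).

(* The restriction of [rep_map] to the multiplier algebra is a *-homomorphism:
   linearity is part of [ucp], products and adjoints are taken in the injective
   envelope. *)
Record crep := CRep {
  rep_space : hilbertType R ;
  rep_map :> S -> 'B(rep_space) ;
  rep_ucp : ucp rep_map ;
  rep_mult : forall a b c : S, multipliers E a -> multipliers E b ->
    ie_emb E c = ie_emb E a ** ie_emb E b -> rep_map c = rep_map a ** rep_map b ;
  rep_star : forall a b : S, multipliers E a ->
    ie_emb E b = adj (ie_emb E a) -> rep_map b = adj (rep_map a) }.

Arguments rep_map : clear implicits.

Definition rep_img (X : crep) : set 'B(rep_space X) := range (rep_map X).

Arguments rep_img : clear implicits.

Definition to_img (X : crep) (s : S) : rep_img X :=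
  SigSub (mem_set (imageT (rep_map X) s)).

(* [val y] is the operator phi(a.s.b) = pi(a) phi(s) pi(b), where [val x] is
   phi(s). *)
Record rep_hom (X Y : crep) := RepHom {
  rh_fun :> rep_img X -> rep_img Y ;
  rh_linear : linear_on (fun x => val (rh_fun x)) ;
  rh_cb : completely_bounded (fun x => val (rh_fun x)) ;
  rh_bimod : forall (a b : S) (x y : rep_img X),
    multipliers E a -> multipliers E b ->
    val y = rep_map X a ** val x ** rep_map X b ->
    val (rh_fun y) = rep_map Y a ** val (rh_fun x) ** rep_map Y b }.

Definition rep_cb_norm (X Y : crep) (Phi : rep_hom X Y) : \bar R :=
  cb_norm (fun x => val (Phi x)).

Lemma rep_hom_eq (X Y : crep) (f g : rep_hom X Y) :
  (forall x, val (f x) = val (g x)) -> f = g.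
Proof.
case: f g => f f1 f2 f3 [g g1 g2 g3] /= fg.
have e : f = g by apply/funext => x; apply/val_inj/fg.
by subst g; congr RepHom; exact: Prop_irrelevance.
Qed.

Lemma rep_img_subspace (X : crep) : linear_subspace (rep_img X).
Proof.
have [[S0 SD] _ _] := os_is_opsys S; have [lX _ _] := rep_ucp X.
pose z : S := SigSub (mem_set S0).
split.
  exists z => //; have := lX 1 z z z; rewrite /= scaler0 addr0 scale1r.
  by move=> /(_ erefl) /eqP; rewrite -subr_eq0 opprD addNKr oppr_eq0 => /eqP.
move=> a _ _ [s _ <-] [t _ <-].
have st : (a *: val s + val t) \in (S : set _).
  by apply/mem_set/SD; exact/set_mem/valP.
by exists (SigSub st) => //; exact: lX.
Qed.

Lemma rep_id_cb (X : crep) : completely_bounded (fun x : rep_img X => val x).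
Proof.
apply: (@le_lt_trans _ _ 1%:E); last exact: ltry.
by apply: ge_ereal_sup => _ [n [Y [Y1 ->]]]; rewrite lee_fin.
Qed.

Definition rep_id (X : crep) : rep_hom X X :=
  @RepHom X X id (fun _ _ _ _ => id) (@rep_id_cb X) (fun _ _ _ _ _ _ => id).

Section comp.
Context {X Y Z : crep} (g : rep_hom Y Z) (f : rep_hom X Y).

Lemma rep_comp_linear : linear_on (fun x => val (g (f x))).
Proof. by move=> a x y z /(rh_linear f) /(rh_linear g). Qed.

Lemma rep_comp_cb : completely_bounded (fun x => val (g (f x))).
Proof.
have [c c0 fc] := completely_boundedP (rh_cb f).
have [d d0 gd] := completely_boundedP (rh_cb g).
apply: (@le_lt_trans _ _ (c * d)%:E); last exact: ltry.
apply: ge_ereal_sup => _ [n [A [A1 ->]]]; rewrite lee_fin.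
have -> : map_mx (fun x => val (g (f x))) A =
    map_mx (fun y => val (g y)) (map_mx f A) by apply/matrixP => i j; rewrite !mxE.
apply: (cb_norm_bound (rep_img_subspace Y) (rh_linear g) gd c0).
have -> : map_mx val (map_mx f A) = map_mx (fun x => val (f x)) A.
  by apply/matrixP => i j; rewrite !mxE.
rewrite -[leRHS]mul1r.
exact: (cb_norm_bound (rep_img_subspace X) (rh_linear f) fc ltr01 A1).
Qed.

Definition rep_comp : rep_hom X Z :=
  @RepHom X Z (g \o f) rep_comp_linear rep_comp_cb
    (fun a b x y ha hb e => rh_bimod g ha hb (rh_bimod f ha hb e)).

End comp.

Lemma rep_compA (X Y Z W : crep) (h : rep_hom Z W) (g : rep_hom Y Z)
  (f : rep_hom X Y) : rep_comp h (rep_comp g f) = rep_comp (rep_comp h g) f.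
Proof. exact: rep_hom_eq. Qed.

Lemma rep_comp1m (X Y : crep) (f : rep_hom X Y) : rep_comp (rep_id Y) f = f.
Proof. exact: rep_hom_eq. Qed.

Lemma rep_compm1 (X Y : crep) (f : rep_hom X Y) : rep_comp f (rep_id X) = f.
Proof. exact: rep_hom_eq. Qed.

(* A unitary equivalence class of C*-representations is given by any of its
   members, so the objects are the C*-representations themselves. *)
Definition Rep : category :=
  @Category crep rep_hom rep_id (@rep_comp) rep_compA rep_comp1m rep_compm1.

End representations.

Arguments crep {R S} E.
Arguments rep_map {R S E} X s : rename.
Arguments rep_img {R S E} X _ : rename.
Arguments to_img {R S E} X s : rename.
Arguments Rep {R S} E.

Section induced_functor.
Context {R : realType} {S T : opsys R}.
Context (ES : injective_envelope S) (ET : injective_envelope T).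
Context {H K : hilbertType R} (alpha : S -> 'B(H)) (beta : T -> 'B(K)).
Context (M : set 'B(H, K)).

(* For [x] in the closure of the image of [S] under [alpha], [extends X x y]
   says that [y] is the value at [x] of the extension by continuity of the
   representation [X]. *)
Definition extends (X : crep ES) (x : 'B(H)) (y : 'B(rep_space X)) : Prop :=
  closure [set (alpha s, rep_map X s) | s in [set: S]] (x, y).

(* [Y] is the representation of [T] on the completion of M (x) H_X, where
   [nu m xi] is the class of the elementary tensor of [m] and [xi]: a Hilbert
   space with a balanced bilinear map from M x H_X which realizes the inner
   product and has total range is this completion. *)
Definition induced_object (X : crep ES) (Y : crep ET)
    (nu : M -> 'B(rep_space X, rep_space Y)) : Prop :=
  [/\ linear_on nu,
      forall (m n : M) (a : S), multipliers ES a -> val n = val m ** alpha a ->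
        nu n = nu m ** rep_map X a,
      forall (a b : M) (s : S) xi eta, alpha s = adj (val b) ** val a ->
        '[nu a xi, nu b eta] = '[rep_map X s xi, eta],
      cspan [set nu m xi | m in [set: M] & xi in [set: rep_space X]] = setT &
      forall (a b : M) (t : T) xi eta (y : 'B(rep_space X)),
        extends (adj (val b) ** beta t ** val a) y ->
        '[rep_map Y t (nu a xi), nu b eta] = '[y xi, eta]].

(* The operator nu1(n) phi1(s) nu1(m)^* is the value at n s m^* of the extension
   of psi1 to the closure of [T]; accordingly [F Phi] is prescribed on it through
   the closure of the graph of [F Phi]. *)
Definition induced_functor (F : functor (Rep ES) (Rep ET)) : Prop :=
  exists nu : forall X : crep ES, M -> 'B(rep_space X, rep_space (F X)),
    (forall X : crep ES, induced_object (nu X)) /\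
    forall (X1 X2 : crep ES) (Phi : rep_hom X1 X2) (m n : M) (s : S),
      closure [set (val y, val ((fmap F Phi : rep_hom (F X1) (F X2)) y))
                 | y in [set: rep_img (F X1)]]
        (nu X1 n ** rep_map X1 s ** adj (nu X1 m),
         nu X2 n ** val (Phi (to_img X1 s)) ** adj (nu X2 m)).

Definition completely_contractive (F : functor (Rep ES) (Rep ET)) : Prop :=
  forall (X Y : crep ES) (Phi : rep_hom X Y),
    (rep_cb_norm (fmap F Phi) <= rep_cb_norm Phi)%E.

End induced_functor.

Arguments induced_functor {R S T ES ET H K} alpha beta M F.

Definition cc_equivalence (R : realType) (S T : opsys R)
    (ES : injective_envelope S) (ET : injective_envelope T)
    (F : functor (Rep ES) (Rep ET)) (G : functor (Rep ET) (Rep ES)) : Prop :=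
  [/\ naturally_equivalent (comp_functor G F) (id_functor (Rep ES)),
      naturally_equivalent (comp_functor F G) (id_functor (Rep ET)),
      completely_contractive F & completely_contractive G].

(* Main.v *)
(* The proof trades completions for finite sums.  Newton's iteration for the polar
   decomposition, r -> (3 r - r r^* r) / 2, converges inside the closure of a
   nondegenerate TRO M to a finite row r with r r^* = 1; in the same way one gets a
   finite column c with c^* c = 1.  A ucp map which is multiplicative on the
   multiplier algebra is a bimodule map over it, so, after all maps have been
   extended by continuity to the closures, an induced object (K, psi, nu) satisfies
   nu(m)^* nu(n) = phi(m^* n), nu(m)^* psi(t) nu(n) = phi(m^* t n),
   psi(m s n^* ) = nu(m) phi(s) nu(n)^* and sum nu(r_i) nu(r_i)^* = 1.  Hence F is
   given on morphisms by
     F(Phi)(y) = sum_ij nu2(r_i) Phi(nu1(r_i)^* y nu1(r_j)) nu2(r_j)^*,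
   an amplification of Phi compressed by isometries, which is completely
   contractive; and sum_j mu(c_j^* ) nu(c_j) is a unitary from H onto the space of
   G(F(H, phi)), intertwining the two representations and natural in (H, phi).
   For the existence, K is the range of the projection [phi(r_i^* r_j)] on H^p. *)

From HB Require Import structures.
From mathcomp Require Import all_boot all_order all_algebra.
From mathcomp Require Import sesquilinear complex ring lra.
From mathcomp Require Import all_classical all_reals all_analysis.
Require Import Defs.

Set Implicit Arguments.
Unset Strict Implicit.
Unset Printing Implicit Defensive.

Import Order.TTheory GRing.Theory Num.Theory.
Import numFieldNormedType.Exports.

Local Open Scope classical_set_scope.
Local Open Scope ring_scope.
Local Open Scope complex_scope.

(** * Hilbert spaces and bounded operators *)

(** Two obstacles shape the argument. TRO-equivalence places M^* T M and M S M^* only in the norm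
    closures, while representations and morphisms live on the operator systems and their images
    themselves; hence the systematic extension by continuity, through closures of graphs. Moreover
    multipliers are multiplied in the injective envelope, whereas M composes in B(H,K): the
    *-homomorphism supplied by [generates_envelope] reconciles the two products. As S is not an
    algebra, the bimodule property is read off from the positivity of a 3 x 3 matrix over S.

    Exact rows and columns replace approximate units so that every formula is a finite sum and no
    strong limits occur. The prescription in [induced_functor] fixes a morphism on the elements
    nu(m) phi(s) nu(n)^*; a row writes every y as a finite sum of such elements, so the morphism is
    forced. In the existence part closures cost more: F(Phi) must map psi1(T) into psi2(T) itself,
    although the row lies only in the closure of M. Pairs with d b^* = 1, where d is in M and b in
    its closure, reduce conjugation by the closure to conjugation by M. *)

Section norm.
Context {R : realType} {V : normedModType R[i]}.
Implicit Types x y z : V.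

Lemma hnormN x : hnorm (- x) = hnorm x.
Proof. by rewrite /hnorm normrN. Qed.

Lemma hnormBC x y : hnorm (x - y) = hnorm (y - x).
Proof. by rewrite -hnormN opprB. Qed.

Lemma hnormZr (r : R) x : hnorm (r%:C *: x) = `|r| * hnorm x.
Proof. by rewrite hnormZ normc_def /= expr0n addr0 sqrtr_sqr. Qed.

End norm.

Section inner_product.
Context {R : realType} {H : hilbertType R}.
Implicit Types (x y z : H) (a : R[i]).

Lemma dotDl x y z : '[x + y, z] = '[x, z] + '[y, z].
Proof. exact: linearDl. Qed.

Lemma dotZl a x z : '[a *: x, z] = a * '[x, z].
Proof. exact: linearZl_LR. Qed.

Lemma dotDr x y z : '[x, y + z] = '[x, y] + '[x, z].
Proof. exact: linearDr. Qed.

Lemma dotZr a x z : '[x, a *: z] = Num.conj a * '[x, z].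
Proof. exact: linearZr_LR. Qed.

Lemma dotC x y : '[x, y] = Num.conj '[y, x].
Proof. by rewrite hermC expr0 mul1r. Qed.

Lemma dotBl x y z : '[x - y, z] = '[x, z] - '[y, z].
Proof. exact: linearBl. Qed.

Lemma dotBr x y z : '[x, y - z] = '[x, y] - '[x, z].
Proof. exact: linearBr. Qed.

Lemma dotNl x y : '[- x, y] = - '[x, y].
Proof. exact: linearNl. Qed.

Lemma dotNr x y : '[x, - y] = - '[x, y].
Proof. exact: linearNr. Qed.

Lemma dot0l x : '[0, x] = 0.
Proof. exact: linear0l. Qed.

Lemma dot_suml I (r : seq I) (P : pred I) (f : I -> H) y :
  '[\sum_(i <- r | P i) f i, y] = \sum_(i <- r | P i) '[f i, y].
Proof. exact: linear_sumlz. Qed.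

Lemma dot_sumr I (r : seq I) (P : pred I) (f : I -> H) y :
  '[y, \sum_(i <- r | P i) f i] = \sum_(i <- r | P i) '[y, f i].
Proof. exact: linear_sumr. Qed.

Lemma dotxx x : '[x, x] = (hnorm x ^+ 2)%:C.
Proof. by rewrite hdotE -hnormE rmorphXn. Qed.

Lemma sqr_hnorm x : hnorm x ^+ 2 = complex.Re '[x, x].
Proof. by rewrite dotxx. Qed.

Lemma Re_dotC x y : complex.Re '[y, x] = complex.Re '[x, y].
Proof. by rewrite dotC; case: '[x, y]. Qed.

Lemma sqr_hnormD x y :
  hnorm (x + y) ^+ 2 = hnorm x ^+ 2 + hnorm y ^+ 2 + 2 * complex.Re '[x, y].
Proof.
by rewrite !sqr_hnorm dotDl !dotDr !raddfD /= (Re_dotC y x); lra.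
Qed.

Lemma ReM_real (r : R) a : complex.Re (r%:C * a) = r * complex.Re a.
Proof. by case: a => u v /=; rewrite mul0r subr0. Qed.

Lemma conjC_real (r : R) : Num.conj (r%:C) = r%:C.
Proof. by rewrite conj_Creal //; apply/complex_realP; exists r. Qed.

Lemma Re_cauchy_schwarz x y : complex.Re '[x, y] <= hnorm x * hnorm y.
Proof.
have [x0|x0] := eqVneq (hnorm x) 0.
  by rewrite x0 mul0r (hnorm0_eq0 x0) dot0l.
have [y0|y0] := eqVneq (hnorm y) 0.
  by rewrite y0 mulr0 (hnorm0_eq0 y0) Re_dotC dot0l.
have xy : 0 < hnorm x * hnorm y by rewrite mulr_gt0 // lt_neqAle eq_sym ?x0 ?y0 hnorm_ge0.
(* With u = |x| and v = |y|, the vector v x - u y has squared norm 2uv (uv - Re <x, y>). *)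
have := sqr_ge0 (hnorm ((hnorm y)%:C *: x + (- hnorm x)%:C *: y)).
rewrite sqr_hnormD !hnormZr normrN !ger0_norm ?hnorm_ge0 // dotZl dotZr.
rewrite conjC_real mulrA -rmorphM ReM_real => h.
rewrite -(ler_pM2l xy); move: h; set u := hnorm x; set v := hnorm y; set w := complex.Re _; nra.
Qed.

Lemma dot_eq0 x : (forall y, '[x, y] = 0) -> x = 0.
Proof.
by move=> /(_ x); rewrite dotxx => /(@complexI R)/eqP; rewrite sqrf_eq0 => /eqP /hnorm0_eq0.
Qed.

Lemma dot_inj x y : (forall z, '[x, z] = '[y, z]) -> x = y.
Proof.
move=> xy; apply/eqP; rewrite -subr_eq0; apply/eqP/dot_eq0 => z.
by rewrite dotBl xy subrr.
Qed.

Lemma parallelogram x y :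
  hnorm (x - y) ^+ 2 + hnorm (x + y) ^+ 2 = 2 * hnorm x ^+ 2 + 2 * hnorm y ^+ 2.
Proof.
rewrite !sqr_hnormD hnormN -scaleN1r dotZr rmorphN1 mulN1r raddfN /=; lra.
Qed.

End inner_product.

Section cauchy_sequences.
Context {R : realType}.

(** The norm takes values in R[i], so the radii of its topology are complex numbers; this criterion
    makes all later estimates real. *)
Lemma hnorm_cvgP (V : normedModType R[i]) (u : nat -> V) (l : V) :
  (u @ \oo --> l) <->
  forall e : R, 0 < e -> exists N, forall n, (N <= n)%N -> hnorm (l - u n) <= e.
Proof.
split=> [ul e e0|ul].
  have e0' : 0 < e%:C by rewrite ltcR.
  have /cvgrPdist_le/(_ _ e0')[N _ uN] := ul.
  exists N => n Nn; rewrite -lecR hnormE; exact: uN.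
apply/cvgrPdist_le => e e0.
have er : (complex.Re e)%:C = e by rewrite RRe_real // gtr0_real.
have [|N uN] := ul (complex.Re e); first by rewrite -ltcR er.
by exists N => // n /= Nn; rewrite -hnormE -er lecR uN.
Qed.

Definition cauchy_sequence (V : normedModType R[i]) (u : nat -> V) :=
  forall e : R, 0 < e -> exists N, forall m n, (N <= m)%N -> (N <= n)%N ->
    hnorm (u m - u n) <= e.

Lemma complete_cauchy (V : completeNormedModType R[i]) (u : nat -> V) :
  cauchy_sequence u -> exists l : V, u @ \oo --> l.
Proof.
move=> uc; suff : cvg (u @ \oo) by move=> uV; exists (lim (u @ \oo)).
apply/cauchy_cvgP/cauchy_exP => e e0.
have er : (complex.Re e)%:C = e by rewrite RRe_real // gtr0_real.
have re0 : 0 < complex.Re e by rewrite -ltcR er.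
have [|N uN] := uc (complex.Re e / 2); first by rewrite divr_gt0.
exists (u N); exists N => // n /= Nn; rewrite -ball_normE /ball_ /= -hnormE -er ltcR.
rewrite (le_lt_trans (uN _ _ (leqnn N) Nn)) // ltr_pdivrMr // ltr_pMr ?ltr1n //.
Qed.

End cauchy_sequences.

(** * The Riesz representation theorem *)

Section riesz.
Context {R : realType}.

Lemma invS_lt (e : R) : 0 < e -> exists N, forall n, (N <= n)%N -> n.+1%:R^-1 < e.
Proof.
move=> e0; exists (Num.trunc e^-1) => n; rewrite truncn_le_nat => h.
by rewrite invf_plt ?posrE.
Qed.

(* The representing vector minimizes |x|^2 - 2 Re (f x). *)
Lemma riesz_representation (H : hilbertType R) (f : H -> R[i]) (c : R) :
  0 <= c ->
  (forall (a : R[i]) x y, f (a *: x + y) = a * f x + f y) ->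
  (forall x, complex.Re (f x) <= c * hnorm x) ->
  exists z, forall x, f x = '[x, z].
Proof.
move=> c0 lf fc; pose g x := complex.Re (f x).
have f0 : f 0 = 0.
  by have /eqP := lf 1 0 0; rewrite scaler0 addr0 mul1r -subr_eq0 opprD addNKr oppr_eq0 => /eqP.
have fZ a x : f (a *: x) = a * f x by rewrite -[a *: x]addr0 lf f0 addr0.
have fD x y : f (x + y) = f x + f y by rewrite -[x in f (x + _)]scale1r lf mul1r.
have gD x y : g (x + y) = g x + g y by rewrite /g fD raddfD.
have gZ r x : g (r%:C *: x) = r * g x by rewrite /g fZ ReM_real.
pose J x := hnorm x ^+ 2 - 2 * g x.
have J_lb : lbound (range J) (- c ^+ 2).
  move=> _ [x _ <-]; rewrite /J; have := fc x; rewrite -/(g x).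
  by have := sqr_ge0 (hnorm x - c); nra.
have J_inf : has_inf (range J) by split; [exists (J 0), 0 | exists (- c ^+ 2)].
pose d := inf (range J).
have Jd x : d <= J x by apply: ge_inf; [exists (- c ^+ 2) | exists x].
have /choice[u uJ] : forall n : nat, exists x, J x < d + n.+1%:R^-1.
  move=> n; have n0 : 0 < n.+1%:R^-1 :> R by rewrite invr_gt0.
  by have [_ [x _ <-]] := inf_adherent n0 J_inf; exists x.
(* The parallelogram law for J: the linear terms cancel at the midpoint. As d is a lower bound at
   the midpoint, a minimizing sequence is Cauchy. *)
have mid x y : hnorm (x - y) ^+ 2 = 2 * (J x + J y - 2 * J (2^-1%:C *: (x + y))).
  rewrite /J hnormZr gZ gD exprMn; have := parallelogram x y.
  rewrite ger0_norm ?invr_ge0 // exprVn; lra.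
have uc : cauchy_sequence u.
  (* By [mid], |u_m - u_n|^2 <= 2 (1/(m+1) + 1/(n+1)), hence the threshold e^2/4. *)
  move=> e e0; have e2 : 0 < e ^+ 2 / 4 by rewrite divr_gt0 // exprn_gt0.
  have [N uN] := invS_lt e2; exists N => m n Nm Nn.
  rewrite -ler_sqr ?nnegrE ?hnorm_ge0 ?ltW // mid.
  have := uN _ Nm; have := uN _ Nn; have := uJ m; have := uJ n.
  move: (Jd (2^-1%:C *: (u m + u n))); set q := m.+1%:R^-1; set q' := n.+1%:R^-1.
  by set e' := e ^+ 2; set Jm := J (_ *: _); lra.
have [z /hnorm_cvgP uz] := complete_cauchy uc.
have gz x : g x = complex.Re '[x, z].
  pose b := g x - complex.Re '[x, z].
  (* First-order condition at the minimizer, computed at u_n + t x for large n so that continuity of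
     J is never invoked. Half of e absorbs J(u_n) - d, the other half 2t Re <u_n - z, x>. *)
  have h (t e : R) : 0 < e -> 0 <= t ^+ 2 * hnorm x ^+ 2 - 2 * t * b + e.
    move=> e0; pose k := 1 + `|t| * hnorm x.
    have k0 : 0 < k by rewrite ltr_pwDl // mulr_ge0 // hnorm_ge0.
    have e2 : 0 < e / 2 by rewrite divr_gt0.
    have [N1 uN1] := invS_lt e2.
    have e4 : 0 < e / (4 * k) by rewrite divr_gt0 // mulr_gt0.
    have [N2 uN2] := uz _ e4.
    set n := maxn N1 N2.
    have := uN1 n (leq_maxl _ _); have := uN2 n (leq_maxr _ _).
    rewrite ler_pdivlMr ?mulr_gt0 // => zn n1.
    have := Jd (u n + t%:C *: x); have := uJ n.
    rewrite /J sqr_hnormD gD gZ hnormZr exprMn real_normK ?num_real //.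
    rewrite dotZr conjC_real ReM_real.
    (* The estimate is one-sided; inserting the sign of t turns it into a bound for t (v - w). *)
    have := Re_cauchy_schwarz (u n - z) ((Num.sg t)%:C *: x).
    rewrite hnormBC hnormZr dotZr conjC_real ReM_real dotBl raddfB /=.
    set v := complex.Re '[u n, x]; set w := complex.Re '[z, x] => h1.
    have sg1 : `|Num.sg t| <= 1 by rewrite normr_sg; case: (t != 0).
    have h2 : Num.sg t * (v - w) <= hnorm (z - u n) * hnorm x.
      apply: le_trans h1 _; apply: ler_wpM2l; first exact: hnorm_ge0.
      by rewrite ler_piMl // hnorm_ge0.
    have h3 : t * (v - w) <= `|t| * (hnorm (z - u n) * hnorm x).
      by rewrite {1}[t]numEsg [_ * `|t|]mulrC -mulrA ler_wpM2l.
    have h4 : `|t| * (hnorm (z - u n) * hnorm x) <= e / 4.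
      rewrite mulrCA; have : `|t| * hnorm x <= k by rewrite /k lerDr.
      move=> /(ler_wpM2l (hnorm_ge0 (z - u n))) /le_trans; apply.
      by rewrite ler_pdivlMr // mulrAC -mulrA.
    rewrite /b (Re_dotC z x) -/w; have {h3 h4} := le_trans h3 h4; move: n1.
    clearbody n d v w g.
    move: (n.+1%:R^-1) (hnorm (u n) ^+ 2) (t ^+ 2 * _) (g (u n)) (g x) => q q1 q2 q3 q4.
    lra.
  have h0 (t : R) : 0 <= t ^+ 2 * hnorm x ^+ 2 - 2 * t * b.
    by apply/ler_addgt0Pr => e e0; exact: h.
  suff : b = 0 by move=> /eqP; rewrite subr_eq0 => /eqP.
  pose X := hnorm x ^+ 2; have X0 : 0 < X + 1 by rewrite ltr_pwDr // sqr_ge0.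
  (* At t = b/(X+1) the quadratic equals b^2 (X - 2(X+1)) / (X+1)^2, which is negative unless b = 0.
     The summand 1 covers the case x = 0. *)
  have := h0 (b / (X + 1)); rewrite -/X => hb.
  have : 0 <= b ^+ 2 * (X - 2 * (X + 1)).
    rewrite -(pmulr_lge0 _ (exprn_gt0 2 X0)) in hb.
    suff -> : b ^+ 2 * (X - 2 * (X + 1)) =
      ((b / (X + 1)) ^+ 2 * X - 2 * (b / (X + 1)) * b) * (X + 1) ^+ 2 by [].
    by field; lra.
  have : 0 <= X by exact: sqr_ge0.
  by move=> ? ?; apply/eqP; rewrite -sqrf_eq0; apply/eqP; have := sqr_ge0 b; nra.
exists z => x; apply/eqP; rewrite eq_complex; apply/andP; split; apply/eqP.
  exact: gz.
(* The imaginary parts are compared by evaluating the real parts at i x. *)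
have := gz ((0 +i* 1) *: x); rewrite /g fZ dotZl.
by case: (f x) => p q; case: '[x, z] => p' q' /=; lra.
Qed.

End riesz.

Section bounded_maps.
Context {R : realType}.
Implicit Types H K L : hilbertType R.

Lemma bop_ext H K (S T : 'B(H, K)) : (forall x, S x = T x) -> S = T.
Proof. by move=> ST; apply/val_inj/funext. Qed.

Lemma bopD H K (S T : 'B(H, K)) x : (S + T) x = S x + T x.
Proof. by []. Qed.

Lemma bopB H K (S T : 'B(H, K)) x : (S - T) x = S x - T x.
Proof. by []. Qed.

Lemma bopZ H K (a : R[i]) (T : 'B(H, K)) x : (a *: T) x = a *: T x.
Proof. by []. Qed.

Lemma bop0 H K x : (0 : 'B(H, K)) x = 0.
Proof. by []. Qed.

Lemma bop_sum H K I (r : seq I) (P : pred I) (f : I -> 'B(H, K)) x :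
  (\sum_(i <- r | P i) f i) x = \sum_(i <- r | P i) f i x.
Proof. by apply: (big_morph (fun T : 'B(H, K) => T x)). Qed.

Lemma bounded_operatorP H K (f : H -> K) (c : R) :
  0 <= c -> linear f -> (forall x, hnorm (f x) <= c * hnorm x) ->
  f \in @bounded_operator R H K.
Proof.
move=> c0 lf fc; apply/asboolP; split=> // x; apply/cvgrPdist_le => e e0.
have er : (complex.Re e)%:C = e by rewrite RRe_real // gtr0_real.
have re0 : 0 < complex.Re e by rewrite -ltcR er.
have c1 : 0 < c + 1 by rewrite ltr_wpDl.
pose d := complex.Re e / (c + 1).
have d0 : 0 < d%:C by rewrite ltcR divr_gt0.
near=> y; rewrite -hnormE -er lecR.
have -> : f x - f y = f (x - y) by rewrite -scaleN1r addrC -lf scaleN1r addrC.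
have : hnorm (x - y) <= d.
  by rewrite -lecR hnormE; near: y; apply: cvgr_dist_le => //; exact: cvg_id.
move=> xy; apply: le_trans (fc _) _; apply: (@le_trans _ _ ((c + 1) * d)).
  apply: ler_pM => //; first exact: hnorm_ge0.
  by rewrite lerDl.
by rewrite /d mulrC divfK // gt_eqF.
Unshelve. all: by end_near. Qed.

Lemma bop_exists H K (f : H -> K) (c : R) :
  0 <= c -> linear f -> (forall x, hnorm (f x) <= c * hnorm x) ->
  exists T : 'B(H, K), forall x, T x = f x.
Proof. by move=> c0 lf fc; exists (Bop (bounded_operatorP c0 lf fc)). Qed.

(** Riesz gives the value X y for each y; linearity comes from uniqueness of the representing
    vector, and boundedness from |X y|^2 = Re <T (X y), y> <= |T| |X y| |y|. *)
Lemma adj_exists H K (T : 'B(H, K)) :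
  exists X : 'B(K, H), forall x y, '[T x, y] = '[x, X y].
Proof.
have /choice[X XP] : forall y, exists z, forall x, '[T x, y] = '[x, z].
  move=> y; apply: (@riesz_representation _ _ _ (opnorm T * hnorm y)).
  - by rewrite mulr_ge0 ?opnorm_ge0 // hnorm_ge0.
  - by move=> a u v; rewrite linearP dotDl dotZl.
  - move=> x; rewrite (le_trans (Re_cauchy_schwarz _ _)) // mulrAC.
    by rewrite ler_wpM2r ?hnorm_ge0 // le_opnorm.
have [||Y YP] := @bop_exists _ _ X (opnorm T) (opnorm_ge0 T); last first.
- by exists Y => x y; rewrite XP YP.
- move=> y; have [->|y0] := eqVneq (X y) 0.
    by rewrite hnorm0 mulr_ge0 ?opnorm_ge0 // hnorm_ge0.
  have yp : 0 < hnorm (X y).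
    rewrite lt_neqAle hnorm_ge0 andbT eq_sym.
    by apply: contra y0 => /eqP /hnorm0_eq0 ->.
  rewrite -(ler_pM2l yp) -expr2 sqr_hnorm -XP.
  rewrite (le_trans (Re_cauchy_schwarz _ _)) // mulrA.
  by rewrite ler_wpM2r ?hnorm_ge0 // mulrC le_opnorm.
- move=> a y z; apply: dot_inj => x.
  have XP' w : '[X w, x] = '[w, T x] by rewrite dotC -XP -dotC.
  by rewrite dotDl dotZl !XP' dotDl dotZl.
Qed.

Lemma dot_adj H K (T : 'B(H, K)) x y : '[T x, y] = '[x, adj T y].
Proof.
rewrite /adj; case: xgetP => [X _ /= -> //|noX].
by have [X XP] := adj_exists T; case: (noX X).
Qed.

Lemma adj_dot H K (T : 'B(H, K)) x y : '[adj T x, y] = '[x, T y].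
Proof. by rewrite dotC -dot_adj -dotC. Qed.

Lemma adj_eq H K (T : 'B(H, K)) (X : 'B(K, H)) :
  (forall x y, '[T x, y] = '[x, X y]) -> adj T = X.
Proof.
move=> TX; apply: bop_ext => y; apply: dot_inj => x.
by rewrite adj_dot dotC TX -dotC.
Qed.

Lemma adjK H K (T : 'B(H, K)) : adj (adj T) = T.
Proof. by apply: adj_eq => x y; rewrite adj_dot. Qed.

Lemma adjD H K (S T : 'B(H, K)) : adj (S + T) = adj S + adj T.
Proof. by apply: adj_eq => x y; rewrite !bopD dotDl dotDr !dot_adj. Qed.

Lemma adjZ H K a (T : 'B(H, K)) : adj (a *: T) = Num.conj a *: adj T.
Proof. by apply: adj_eq => x y; rewrite !bopZ dotZl dotZr conjCK dot_adj. Qed.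

Lemma adjZr H K (r : R) (T : 'B(H, K)) : adj (r%:C *: T) = r%:C *: adj T.
Proof. by rewrite adjZ conjC_real. Qed.

Lemma adjN H K (T : 'B(H, K)) : adj (- T) = - adj T.
Proof. by rewrite -scaleN1r adjZ rmorphN1 scaleN1r. Qed.

Lemma adjB H K (S T : 'B(H, K)) : adj (S - T) = adj S - adj T.
Proof. by rewrite adjD adjN. Qed.

Lemma adj0 H K : adj (0 : 'B(H, K)) = 0.
Proof. by rewrite -(scale0r 0) adjZ rmorph0 scale0r. Qed.

Lemma adj_sum H K I (r : seq I) (P : pred I) (f : I -> 'B(H, K)) :
  adj (\sum_(i <- r | P i) f i) = \sum_(i <- r | P i) adj (f i).
Proof. by apply: big_morph; [exact: adjD | exact: adj0]. Qed.

Lemma adj_bid H : adj (bid H) = bid H.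
Proof. exact: adj_eq. Qed.

Lemma adj_comp H K L (S : 'B(K, L)) (T : 'B(H, K)) : adj (S ** T) = adj T ** adj S.
Proof. by apply: adj_eq => x y; rewrite [in LHS]/= !dot_adj. Qed.

End bounded_maps.

Section composition.
Context {R : realType}.
Implicit Types H K L : hilbertType R.

Lemma bcompA H K L L' (S : 'B(L, L')) (T : 'B(K, L)) (U : 'B(H, K)) :
  S ** (T ** U) = S ** T ** U.
Proof. exact: bop_ext. Qed.

Lemma bcomp1l H K (T : 'B(H, K)) : bid K ** T = T.
Proof. exact: bop_ext. Qed.

Lemma bcomp1r H K (T : 'B(H, K)) : T ** bid H = T.
Proof. exact: bop_ext. Qed.

Lemma bcompDl H K L (S S' : 'B(K, L)) (T : 'B(H, K)) :
  (S + S') ** T = S ** T + S' ** T.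
Proof. exact: bop_ext. Qed.

Lemma bcompBl H K L (S S' : 'B(K, L)) (T : 'B(H, K)) :
  (S - S') ** T = S ** T - S' ** T.
Proof. exact: bop_ext. Qed.

Lemma bcompZl H K L a (S : 'B(K, L)) (T : 'B(H, K)) :
  (a *: S) ** T = a *: (S ** T).
Proof. exact: bop_ext. Qed.

Lemma bcompDr H K L (S : 'B(K, L)) (T T' : 'B(H, K)) :
  S ** (T + T') = S ** T + S ** T'.
Proof. by apply: bop_ext => x; exact: (linearD S). Qed.

Lemma bcompBr H K L (S : 'B(K, L)) (T T' : 'B(H, K)) :
  S ** (T - T') = S ** T - S ** T'.
Proof. by apply: bop_ext => x; exact: (linearB S). Qed.

Lemma bcompZr H K L a (S : 'B(K, L)) (T : 'B(H, K)) :
  S ** (a *: T) = a *: (S ** T).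
Proof. by apply: bop_ext => x; exact: (linearZ_LR S). Qed.

Lemma bcomp0l H K L (T : 'B(H, K)) : (0 : 'B(K, L)) ** T = 0.
Proof. exact: bop_ext. Qed.

Lemma bcomp0r H K L (S : 'B(K, L)) : S ** (0 : 'B(H, K)) = 0.
Proof. by apply: bop_ext => x; exact: (linear0 S). Qed.

Lemma bcomp_suml H K L I (r : seq I) (P : pred I) (f : I -> 'B(K, L)) (T : 'B(H, K)) :
  (\sum_(i <- r | P i) f i) ** T = \sum_(i <- r | P i) f i ** T.
Proof.
by apply: (big_morph (fun S => S ** T)) => [S S'|]; rewrite ?bcompDl ?bcomp0l.
Qed.

Lemma bcomp_sumr H K L I (r : seq I) (P : pred I) (f : I -> 'B(H, K)) (S : 'B(K, L)) :
  S ** (\sum_(i <- r | P i) f i) = \sum_(i <- r | P i) S ** f i.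
Proof.
by apply: (big_morph (fun T => S ** T)) => [T T'|]; rewrite ?bcompDr ?bcomp0r.
Qed.

End composition.

Section operator_norm.
Context {R : realType}.
Implicit Types H K L : hilbertType R.

Lemma hnorm_bop H K (T : 'B(H, K)) : hnorm T = opnorm T.
Proof. by []. Qed.

Lemma hnorm_le0 (V : normedModType R[i]) (x : V) : hnorm x <= 0 -> x = 0.
Proof. by move=> x0; apply: hnorm0_eq0; apply/eqP; rewrite eq_le x0 hnorm_ge0. Qed.

Lemma hnorm_triangle (V : normedModType R[i]) (y x z : V) :
  hnorm (x - z) <= hnorm (x - y) + hnorm (y - z).
Proof. by rewrite -[x - z](@subrKA _ y) hnormD. Qed.

Lemma hnorm_sum (V : normedModType R[i]) I (r : seq I) (P : pred I) (f : I -> V) :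
  hnorm (\sum_(i <- r | P i) f i) <= \sum_(i <- r | P i) hnorm (f i).
Proof.
elim/big_ind2 : _ => [|x a y b xa yb|//]; first by rewrite hnorm0.
by rewrite (le_trans (hnormD _ _)) // lerD.
Qed.

Lemma opnorm_bound H K (T : 'B(H, K)) (c : R) : 0 <= c ->
  (forall x, hnorm (T x) <= c * hnorm x) -> opnorm T <= c.
Proof. by move=> c0 Tc; apply: opnorm_le => x x1; rewrite (le_trans (Tc x)) // ler_piMr. Qed.

Lemma opnorm_comp H K L (S : 'B(K, L)) (T : 'B(H, K)) :
  opnorm (S ** T) <= opnorm S * opnorm T.
Proof.
apply: opnorm_bound => [|x]; first by rewrite mulr_ge0 ?opnorm_ge0.
by rewrite (le_trans (le_opnorm S (T x))) // -mulrA ler_wpM2l ?opnorm_ge0 // le_opnorm.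
Qed.

Lemma sqr_hnorm_op H K (T : 'B(H, K)) x :
  hnorm (T x) ^+ 2 = complex.Re '[(adj T ** T) x, x].
Proof. by rewrite sqr_hnorm adj_dot. Qed.

Lemma sqr_opnorm_le H K (T : 'B(H, K)) : opnorm T ^+ 2 <= opnorm (adj T ** T).
Proof.
have c0 := opnorm_ge0 (adj T ** T).
rewrite -(sqr_sqrtr c0) ler_sqr ?nnegrE ?sqrtr_ge0 ?opnorm_ge0 //.
apply: opnorm_bound => [|x]; first exact: sqrtr_ge0.
rewrite -ler_sqr ?nnegrE ?mulr_ge0 ?hnorm_ge0 ?sqrtr_ge0 // exprMn sqr_sqrtr //.
rewrite sqr_hnorm_op (le_trans (Re_cauchy_schwarz _ _)) // expr2 mulrA.
by rewrite ler_wpM2r ?hnorm_ge0 // le_opnorm.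
Qed.

(** One inequality is |T^*|^2 <= |T T^*| <= |T| |T^*|; the other is the same for the adjoint. *)
Lemma opnorm_adj H K (T : 'B(H, K)) : opnorm (adj T) = opnorm T.
Proof.
suff h L L' (S : 'B(L, L')) : opnorm (adj S) <= opnorm S.
  by apply/eqP; rewrite eq_le h /= -[X in opnorm X <= _]adjK h.
have [->|S0] := eqVneq (opnorm (adj S)) 0; first exact: opnorm_ge0.
have Sp : 0 < opnorm (adj S) by rewrite lt_neqAle eq_sym S0 opnorm_ge0.
rewrite -(ler_pM2r Sp) -expr2 (le_trans (sqr_opnorm_le _)) // adjK.
exact: opnorm_comp.
Qed.

End operator_norm.

(** * Limits and extension by continuity *)

Lemma cvg_bigsum (R : realType) (V : normedModType R[i]) U (F : set_system U)
  (FF : Filter F) I (r : seq I) (u : I -> U -> V) (l : I -> V) :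
  (forall i, u i @ F --> l i) ->
  (fun k => \sum_(i <- r) u i k) @ F --> \sum_(i <- r) l i.
Proof.
move=> ul; elim: r => [|i r IH].
  rewrite big_nil; rewrite (_ : (fun k => _) = fun=> 0); first exact: cvg_cst.
  by apply/funext => k; rewrite big_nil.
rewrite big_cons; rewrite (_ : (fun k => _) = fun k => u i k + \sum_(j <- r) u j k).
  by apply: cvgD => //; exact: ul.
by apply/funext => k; rewrite big_cons.
Qed.

Lemma range_val (T : Type) (A : set T) : range (val : A -> T) = A.
Proof.
apply/seteqP; split=> [_ [x _ <-]|x Ax]; first exact: set_mem (valP x).
by exists (SigSub (mem_set Ax)).
Qed.

Section limits.
Context {R : realType}.
Implicit Types H K L : hilbertType R.
Implicit Types V W : normedModType R[i].

Lemma hnorm_cvg_bound V (u : nat -> V) (l : V) (b : nat -> R) :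
  (forall e, 0 < e -> exists N, forall n, (N <= n)%N -> b n <= e) ->
  (forall n, hnorm (l - u n) <= b n) -> u @ \oo --> l.
Proof.
move=> b0 ub; apply/hnorm_cvgP => e /b0[N bN]; exists N => n /bN.
exact: le_trans (ub n).
Qed.

Lemma cvg_unique_norm V (u : nat -> V) (l l' : V) :
  u @ \oo --> l -> u @ \oo --> l' -> l = l'.
Proof. by move=> ul ul'; apply: (cvg_unique _ ul ul') => //; exact: norm_hausdorff. Qed.

Lemma cvg_cauchy_sequence V (u : nat -> V) (l : V) :
  u @ \oo --> l -> cauchy_sequence u.
Proof.
move=> /hnorm_cvgP ul e e0; have e2 : 0 < e / 2 by rewrite divr_gt0.
have [N uN] := ul _ e2; exists N => m n /uN um /uN un.
by rewrite (le_trans (hnorm_triangle l _ _)) // hnormBC; lra.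
Qed.

Lemma closure_approx V (A : set V) (x : V) :
  closure A x -> forall e : R, 0 < e -> exists2 a, A a & hnorm (x - a) <= e.
Proof.
move=> Ax e e0; have e0' : 0 < e%:C by rewrite ltcR.
have [|a [Aa]] := Ax (ball x e%:C); first exact: nbhsx_ballx.
rewrite -ball_normE /ball_ /= -hnormE ltcR => xa; exists a => //; exact: ltW.
Qed.

Lemma closure_seq V (A : set V) (x : V) :
  closure A x -> exists2 u : nat -> V, (forall n, A (u n)) & u @ \oo --> x.
Proof.
move=> /closure_approx Ax.
have /choice[u uP] : forall n : nat, exists a, A a /\ hnorm (x - a) <= n.+1%:R^-1.
  move=> n; have [|a Aa xa] := Ax n.+1%:R^-1; first by rewrite invr_gt0.
  by exists a.
exists u; first by move=> n; have [] := uP n.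
apply: (@hnorm_cvg_bound _ _ _ (fun n => n.+1%:R^-1)) => [e /invS_lt[N eN]|n].
  by exists N => n /eN /ltW.
by have [] := uP n.
Qed.

Lemma seq_closure (V : topologicalType) (A : set V) (u : nat -> V) (x : V) :
  (forall n, A (u n)) -> u @ \oo --> x -> closure A x.
Proof.
move=> Au ux; apply: (@closed_cvg _ _ \oo _ u (closure A)) => //.
  exact: closed_closure.
by near=> n; apply: subset_closure; exact: Au.
Unshelve. all: by end_near. Qed.

Lemma closure_pair_seq V W (A : set (V * W)) x y :
  closure A (x, y) -> exists u v,
  [/\ forall n : nat, A (u n, v n), u @ \oo --> x & v @ \oo --> y].
Proof.
move=> Axy.
have /choice[u uP] : forall n : nat, exists p, A p /\
    (hnorm (x - p.1) <= n.+1%:R^-1 /\ hnorm (y - p.2) <= n.+1%:R^-1).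
  move=> n; have n0 : 0 < (n.+1%:R^-1 : R)%:C by rewrite ltcR invr_gt0.
  have [|p [Ap]] := Axy (ball x (n.+1%:R^-1)%:C `*` ball y (n.+1%:R^-1)%:C).
    exists (ball x (n.+1%:R^-1)%:C, ball y (n.+1%:R^-1)%:C) => //.
    by split; exact: nbhsx_ballx.
  rewrite -!ball_normE /ball_ /= => -[]; rewrite /= -!hnormE !ltcR => /ltW ? /ltW ?.
  by exists p.
have nb : forall e : R, 0 < e -> exists N, forall n, (N <= n)%N -> n.+1%:R^-1 <= e.
  by move=> e /invS_lt[N eN]; exists N => n /eN /ltW.
exists (fst \o u), (snd \o u); split=> [n||] /=.
- by have [] := uP n; case: (u n).
- by apply: (hnorm_cvg_bound nb) => n; have [_ []] := uP n.
- by apply: (hnorm_cvg_bound nb) => n; have [_ []] := uP n.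
Qed.

Lemma seq_closure_pair V W (A : set (V * W)) (u : nat -> V) (v : nat -> W) x y :
  (forall n, A (u n, v n)) -> u @ \oo --> x -> v @ \oo --> y ->
  closure A (x, y).
Proof.
move=> Auv ux vy; apply: (@seq_closure _ _ (fun n => (u n, v n))) => //.
exact: cvg_pair.
Qed.

Lemma cvg_bcomp H K L (S : nat -> 'B(K, L)) (T : nat -> 'B(H, K)) s t :
  S @ \oo --> s -> T @ \oo --> t -> (fun n => S n ** T n) @ \oo --> s ** t.
Proof.
move=> /hnorm_cvgP Ss /hnorm_cvgP Tt; apply/hnorm_cvgP => e e0.
pose c := opnorm s + opnorm t + 1.
have c1 : 1 <= c by rewrite /c lerDr addr_ge0 ?opnorm_ge0.
have c0 : 0 < c by lra.
pose d := Num.min 1 (e / (2 * c)).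
have d0 : 0 < d by rewrite lt_min ltr01 divr_gt0 // mulr_gt0.
have [N1 SN] := Ss _ d0; have [N2 TN] := Tt _ d0.
exists (maxn N1 N2) => n; rewrite geq_max => /andP[/SN Sn /TN Tn].
have -> : s ** t - S n ** T n = (s - S n) ** t + S n ** (t - T n).
  by rewrite bcompBl bcompBr subrKA.
have d1 : d <= 1 by rewrite ge_min lexx.
have dc : d * (2 * c) <= e by rewrite -ler_pdivlMr ?mulr_gt0 // ge_min lexx orbT.
rewrite (le_trans (hnormD _ _)) // (le_trans (lerD (opnorm_comp _ _) (opnorm_comp _ _))) //.
have Sb : opnorm (S n) <= opnorm s + d.
  have := hnormD (S n - s) s; rewrite subrK hnormBC !hnorm_bop.
  by move: Sn; rewrite !hnorm_bop; lra.
have := opnorm_ge0 (S n); have := opnorm_ge0 (s - S n); have := opnorm_ge0 (t - T n).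
have := opnorm_ge0 s; have := opnorm_ge0 t.
move: Sn Tn Sb; rewrite !hnorm_bop => h1 h2 h3 h4 h5 h6 h7 h8.
have h9 : opnorm (s - S n) * opnorm t <= d * opnorm t by rewrite ler_wpM2r.
have h10 : opnorm (S n) * opnorm (t - T n) <= (opnorm s + d) * d by rewrite ler_pM.
apply: (le_trans (lerD h9 h10)); apply: (le_trans _ dc); rewrite /c; nra.
Qed.

Lemma cvg_adj H K (T : nat -> 'B(H, K)) t :
  T @ \oo --> t -> (fun n => adj (T n)) @ \oo --> adj t.
Proof.
move=> /hnorm_cvgP Tt; apply/hnorm_cvgP => e /Tt[N TN]; exists N => n /TN.
by rewrite -adjB !hnorm_bop opnorm_adj.
Qed.

Lemma cvg_bop H K (T : nat -> 'B(H, K)) (t : 'B(H, K)) x :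
  T @ \oo --> t -> (fun n => T n x) @ \oo --> t x.
Proof.
move=> /hnorm_cvgP Tt; apply/hnorm_cvgP => e e0.
have k0 : 0 < hnorm x + 1 by rewrite ltr_wpDl ?hnorm_ge0.
have d0 : 0 < e / (hnorm x + 1) by rewrite divr_gt0.
have [N TN] := Tt _ d0; exists N => n /TN; rewrite ler_pdivlMr // => h.
rewrite -bopB (le_trans (le_opnorm _ _)) //; apply: le_trans h.
by rewrite ler_wpM2l ?opnorm_ge0 // lerDl.
Qed.

(** The Cauchy estimate in the form |u_m x - u_n x| <= e |x| passes to the pointwise limit, which
    gives both boundedness of the limit and convergence in norm. *)
Lemma bop_complete H K (u : nat -> 'B(H, K)) :
  cauchy_sequence u -> exists l : 'B(H, K), u @ \oo --> l.
Proof.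
move=> uc.
have ucx e : 0 < e -> exists N, forall m n, (N <= m)%N -> (N <= n)%N ->
    forall x, hnorm (u m x - u n x) <= e * hnorm x.
  move=> /uc[N uN]; exists N => m n Nm Nn x; rewrite -bopB.
  by rewrite (le_trans (le_opnorm _ _)) // ler_wpM2r ?hnorm_ge0 // uN.
have /choice[f uf] : forall x, exists y : K, (fun n => u n x) @ \oo --> y.
  move=> x; apply: complete_cauchy => e e0.
  have k0 : 0 < hnorm x + 1 by rewrite ltr_wpDl ?hnorm_ge0.
  have d0 : 0 < e / (hnorm x + 1) by rewrite divr_gt0.
  have [N uN] := ucx _ d0; exists N => m n Nm Nn.
  rewrite (le_trans (uN m n Nm Nn x)) // mulrAC ler_pdivrMr //.
  by rewrite ler_wpM2l ?lerDl // ltW.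
have ufx e : 0 < e -> exists N, forall n, (N <= n)%N ->
    forall x, hnorm (f x - u n x) <= e * hnorm x.
  move=> /ucx[N uN]; exists N => n Nn x; apply/ler_addgt0Pr => d d0.
  have /hnorm_cvgP/(_ _ d0)[N' fN'] := uf x.
  have Nm := leq_maxl N N'; have Nm' := leq_maxr N N'.
  rewrite (le_trans (hnorm_triangle (u (maxn N N') x) _ _)) //.
  by rewrite addrC lerD // ?uN // fN'.
have lf : linear f.
  move=> a x y; apply: cvg_unique_norm (uf (a *: x + y)) _.
  rewrite (_ : (fun n => _) = (fun n => a *: u n x + u n y)); last first.
    by apply/funext => n; rewrite linearP.
  by apply: cvgD; [apply: cvgZl_tmp; exact: uf|exact: uf].
have [N0 fN0] := ufx 1 ltr01.
have [||T Tf] := @bop_exists _ H K f (1 + opnorm (u N0)) _ lf.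
- by rewrite addr_ge0 ?opnorm_ge0.
- move=> x; have := fN0 N0 (leqnn _) x; have := le_opnorm (u N0) x.
  have := hnormD (f x - u N0 x) (u N0 x); rewrite subrK; lra.
exists T; apply/hnorm_cvgP => e e0; have [N fN] := ufx e e0.
exists N => n /fN fn; apply: opnorm_bound; first exact: ltW.
by move=> x; rewrite bopB Tf.
Qed.

Lemma geometric_cauchy V (u : nat -> V) (c q : R) : 0 <= c -> 0 <= q < 1 ->
  (forall n, hnorm (u n.+1 - u n) <= c * q ^+ n) -> cauchy_sequence u.
Proof.
move=> c0 /andP[q0 q1] uq e e0.
have q1' : 0 < 1 - q by rewrite subr_gt0.
(* The partial geometric sum, multiplied by 1 - q to keep the induction free of division. *)
have step n k : hnorm (u (n + k)%N - u n) * (1 - q) <= c * q ^+ n * (1 - q ^+ k).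
  elim: k => [|k IH]; first by rewrite addn0 subrr hnorm0 mul0r expr0 subrr mulr0.
  apply: (@le_trans _ _ ((hnorm (u (n + k.+1)%N - u (n + k)%N) + hnorm (u (n + k)%N - u n)) * (1 - q))).
    by rewrite ler_pM2r // hnorm_triangle.
  have := uq (n + k)%N; rewrite -addnS exprD mulrA => uk.
  rewrite mulrDl (le_trans (lerD (ler_wpM2r (ltW q1') uk) IH)) //.
  by rewrite -!mulrA -!mulrDr exprS !ler_wpM2l ?exprn_ge0 //; lra.
have : (fun n => c / (1 - q) * q ^+ n) @ \oo --> (0 : R).
  rewrite -[0](mulr0 (c / (1 - q))); apply: cvgMl_tmp; apply: cvg_expr.
  by rewrite ger0_norm.
have e2 : 0 < e / 2 by rewrite divr_gt0.
move=> /cvgrPdist_le/(_ _ e2)[N _ cN].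
have half n : (N <= n)%N -> hnorm (u n - u N) <= e / 2.
  move=> Nn; have := step N (n - N)%N; rewrite subnKC // => h.
  have := cN N (leqnn N); rewrite /= sub0r normrN ger0_norm; last first.
    by rewrite !mulr_ge0 ?invr_ge0 ?exprn_ge0 // ltW.
  apply: le_trans; rewrite mulrAC ler_pdivlMr //; apply: le_trans h _.
  by rewrite ler_piMr ?mulr_ge0 ?exprn_ge0 // lerBlDr lerDl exprn_ge0.
exists N => m n /half hm /half hn.
by rewrite (le_trans (hnorm_triangle (u N) _ _)) // (hnormBC (u N)); lra.
Qed.

End limits.

Section linear_subspaces.
Context {R : realType}.

Section algebraic.
Context {V : lmodType R[i]} {A : set V}.
Hypothesis sA : linear_subspace A.

Lemma subspace0 : A 0.
Proof. by case: sA. Qed.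

Lemma subspaceZ (a : R[i]) x : A x -> A (a *: x).
Proof. by move=> Ax; case: sA => A0 AD; rewrite -[a *: x]addr0; exact: AD. Qed.

Lemma subspaceD x y : A x -> A y -> A (x + y).
Proof. by move=> Ax Ay; case: sA => A0 AD; rewrite -[x]scale1r; exact: AD. Qed.

Lemma subspaceB x y : A x -> A y -> A (x - y).
Proof. by move=> Ax Ay; apply: subspaceD => //; rewrite -scaleN1r; exact: subspaceZ. Qed.

Lemma subspace_sum I (r : seq I) (P : pred I) (f : I -> V) :
  (forall i, P i -> A (f i)) -> A (\sum_(i <- r | P i) f i).
Proof. by move=> Af; elim/big_ind : _ => //; [exact: subspace0|exact: subspaceD]. Qed.

End algebraic.

Lemma lspan_subspace (V : lmodType R[i]) (A : set V) : linear_subspace (lspan A).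
Proof.
split=> [B [[B0 _] _]//|a x y Ax Ay B sB].
by case: (sB) => -[_ BD] _; exact: BD (Ax B sB) (Ay B sB).
Qed.

Lemma sub_lspan (V : lmodType R[i]) (A : set V) : A `<=` lspan A.
Proof. by move=> x Ax B [_]; apply. Qed.

Lemma lspan_min (V : lmodType R[i]) (A B : set V) :
  linear_subspace B -> A `<=` B -> lspan A `<=` B.
Proof. by move=> sB AB x Ax; apply: Ax. Qed.

Lemma closure_subspace (V : normedModType R[i]) (A : set V) :
  linear_subspace A -> linear_subspace (closure A).
Proof.
move=> [A0 AD]; split; first exact: subset_closure.
move=> a x y /closure_seq[u Au ux] /closure_seq[v Av vy].
apply: (@seq_closure _ _ (fun n => a *: u n + v n)) => [n|]; first exact: AD.
by apply: cvgD => //; apply: cvgZl_tmp.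
Qed.

Lemma cspan_subspace (V : normedModType R[i]) (A : set V) : linear_subspace (cspan A).
Proof. exact/closure_subspace/lspan_subspace. Qed.

Lemma sub_cspan (V : normedModType R[i]) (A : set V) : A `<=` cspan A.
Proof. move=> x Ax; apply: subset_closure; exact: sub_lspan. Qed.

Lemma closure_min (V : topologicalType) (A B : set V) :
  closed B -> A `<=` B -> closure A `<=` B.
Proof. by move=> cB AB; rewrite [B](closure_id _).1 //; exact: closure_subset. Qed.

Lemma cspan_min (V : normedModType R[i]) (A B : set V) :
  linear_subspace B -> closed B -> A `<=` B -> cspan A `<=` B.
Proof. by move=> sB cB AB; apply: closure_min => //; exact: lspan_min. Qed.

Lemma closed_seq (V : topologicalType) (A : set V) (u : nat -> V) (x : V) :
  closed A -> (forall n, A (u n)) -> u @ \oo --> x -> A x.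
Proof. by move=> cA Au ux; rewrite [A](closure_id _).1 //; exact: seq_closure ux. Qed.

End linear_subspaces.

Lemma closed_seq_pair (R : realType) (V W : normedModType R[i]) (A : set (V * W))
    (u : nat -> V) (v : nat -> W) x y : closed A ->
  (forall n, A (u n, v n)) -> u @ \oo --> x -> v @ \oo --> y -> A (x, y).
Proof.
by move=> cA Auv ux vy; rewrite [A](closure_id _).1 //; exact: seq_closure_pair ux vy.
Qed.

(* [ext f g] is the extension by continuity of the map [f i |-> g i]. *)
Section extension.
Context {R : realType} {V W : normedModType R[i]} {I : Type}.
Variables (f : I -> V) (g : I -> W).

Definition graph := [set (f i, g i) | i in [set: I]].

Definition ext (x : V) : W := xget 0 [set y | closure graph (x, y)].

(** The map is encoded by two families over an index type, so that the same extension serves [alpha]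
    with [rep_map X], the inclusion of M with [nu], and the inclusion of an image with a morphism.
    Linearity becomes the existence of an index realizing both combinations; sequential completeness
    of the target is the only completeness needed. *)
Record bounded_graph (c : R) : Prop := BoundedGraph {
  bg_ge0 : 0 <= c ;
  bg_zero : exists i, f i = 0 /\ g i = 0 ;
  bg_lin : forall (a : R[i]) i j,
    exists k, f k = a *: f i + f j /\ g k = a *: g i + g j ;
  bg_bound : forall i, hnorm (g i) <= c * hnorm (f i) ;
  bg_complete : forall u : nat -> W, cauchy_sequence u -> exists l : W, u @ \oo --> l }.

Variable c : R.
Hypothesis fg : bounded_graph c.

Lemma graph_lin (a : R[i]) x y x' y' : graph (x, y) -> graph (x', y') ->
  graph (a *: x + x', a *: y + y').
Proof.
by move=> [i _ [<- <-]] [j _ [<- <-]]; have [k [<- <-]] := bg_lin fg a i j; exists k.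
Qed.

Lemma closure_graph_lin (a : R[i]) x y x' y' :
  closure graph (x, y) -> closure graph (x', y') ->
  closure graph (a *: x + x', a *: y + y').
Proof.
move=> /closure_pair_seq[u [v [uv ux vy]]] /closure_pair_seq[u' [v' [uv' ux' vy']]].
apply: (@seq_closure_pair _ _ _ _ (fun n => a *: u n + u' n) (fun n => a *: v n + v' n)).
- by move=> n; exact: graph_lin.
- by apply: cvgD => //; apply: cvgZl_tmp.
- by apply: cvgD => //; apply: cvgZl_tmp.
Qed.

(** This is what makes the closed graph single-valued: two values at x differ by a value at 0. *)
Lemma closure_graph_bound x y : closure graph (x, y) -> hnorm y <= c * hnorm x.
Proof.
have c0 := bg_ge0 fg; move=> /closure_pair_seq[u [v [uv /hnorm_cvgP ux /hnorm_cvgP vy]]].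
apply/ler_addgt0Pr => e e0.
have e1 : 0 < e / (c + 1) by rewrite divr_gt0 // ltr_wpDl.
have [N uN] := ux _ e1; have [N' vN'] := vy _ e1.
set n := maxn N N'; have := uN n (leq_maxl _ _); have := vN' n (leq_maxr _ _).
have [i _ [<- <-]] := uv n => h1 h2.
have h3 := hnorm_triangle (g i) y 0; rewrite !subr0 in h3.
have h4 := hnorm_triangle x (f i) 0; rewrite !subr0 hnormBC in h4.
have h6 := ler_wpM2l c0 (le_trans h4 (lerD h2 (lexx _))).
apply: (le_trans h3); apply: (le_trans (lerD h1 (le_trans (bg_bound fg i) h6))).
have : e / (c + 1) * (c + 1) = e by rewrite divfK // gt_eqF // ltr_wpDl.
by set d := e / _; lra.
Qed.

Lemma closure_graph_fun x y y' :
  closure graph (x, y) -> closure graph (x, y') -> y = y'.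
Proof.
move=> xy xy'; apply/eqP; rewrite -subr_eq0; apply/eqP/hnorm_le0.
have := closure_graph_bound (closure_graph_lin (a := -1) xy' xy).
by rewrite !scaleN1r (addrC _ x) subrr hnorm0 mulr0 addrC.
Qed.

Lemma ext_eq x y : closure graph (x, y) -> ext x = y.
Proof.
move=> xy; rewrite /ext; case: xgetP => [z _ xz|/(_ y)//].
exact: closure_graph_fun xz xy.
Qed.

Lemma ext_graph x : closure (range f) x -> closure graph (x, ext x).
Proof.
move=> /closure_seq[u uf ux].
have /choice[s su] : forall n, exists i, f i = u n.
  by move=> n; have [i _ <-] := uf n; exists i.
have [|l gl] := bg_complete fg (u := fun n => g (s n)).
  move=> e e0; have e1 : 0 < e / (c + 1) by rewrite divr_gt0 // ltr_wpDl // (bg_ge0 fg).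
  have [N uN] := cvg_cauchy_sequence ux e1; exists N => m n Nm Nn.
  have [k [fk gk]] := bg_lin fg (-1) (s n) (s m).
  have := bg_bound fg k; rewrite fk gk !scaleN1r (addrC (- g _)) (addrC (- f _)) !su => h.
  apply: (le_trans h); have := ler_wpM2l (bg_ge0 fg) (uN m n Nm Nn).
  move=> /le_trans; apply; rewrite mulrA ler_pdivrMr ?ltr_wpDl ?(bg_ge0 fg) //.
  by rewrite mulrC ler_pM2l // lerDl.
have xl : closure graph (x, l).
  apply: (@seq_closure_pair _ _ _ _ u (fun n => g (s n))) => // n.
  by rewrite -su; exists (s n).
by rewrite (ext_eq xl).
Qed.

Lemma ext_fun i : ext (f i) = g i.
Proof. by apply: ext_eq; apply: subset_closure; exists i. Qed.

Lemma ext_lin a x y : closure (range f) x -> closure (range f) y ->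
  ext (a *: x + y) = a *: ext x + ext y.
Proof. by move=> fx fy; apply: ext_eq; apply: closure_graph_lin; exact: ext_graph. Qed.

Lemma ext_bound x : closure (range f) x -> hnorm (ext x) <= c * hnorm x.
Proof. by move=> fx; apply: closure_graph_bound; exact: ext_graph. Qed.

Lemma range_subspace : linear_subspace (range f).
Proof.
split; first by have [i [fi _]] := bg_zero fg; exists i.
move=> a _ _ [i _ <-] [j _ <-]; have [k [<- _]] := bg_lin fg a i j; by exists k.
Qed.

Lemma ext0 : ext 0 = 0.
Proof. by have [i [fi gi]] := bg_zero fg; rewrite -fi ext_fun. Qed.

Lemma extD x y : closure (range f) x -> closure (range f) y ->
  ext (x + y) = ext x + ext y.
Proof. by move=> fx fy; rewrite -[x]scale1r ext_lin // !scale1r. Qed.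

Lemma extB x y : closure (range f) x -> closure (range f) y ->
  ext (x - y) = ext x - ext y.
Proof. by move=> fx fy; rewrite -scaleN1r addrC ext_lin // scaleN1r addrC. Qed.

Lemma ext_sum J (r : seq J) (P : pred J) (x : J -> V) :
  (forall j, P j -> closure (range f) (x j)) ->
  ext (\sum_(j <- r | P j) x j) = \sum_(j <- r | P j) ext (x j).
Proof.
move=> fx; suff [] : closure (range f) (\sum_(j <- r | P j) x j) /\
  ext (\sum_(j <- r | P j) x j) = \sum_(j <- r | P j) ext (x j) by [].
elim/big_rec2 : _ => [|j y z Pj [fz zy]].
  by split; [exact: (subspace0 (closure_subspace range_subspace)) | exact: ext0].
split; first by apply: (subspaceD (closure_subspace range_subspace)) => //; exact: fx.
by rewrite extD ?zy //; exact: fx.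
Qed.

Lemma ext_cvg (u : nat -> V) x : (forall n, closure (range f) (u n)) ->
  u @ \oo --> x -> (fun n => ext (u n)) @ \oo --> ext x.
Proof.
move=> fu ux; have fx : closure (range f) x.
  by apply: closed_seq fu ux; exact: closed_closure.
have c0 := bg_ge0 fg.
move/hnorm_cvgP : ux => ux; apply/hnorm_cvgP => e e0.
have c1 : 0 < c + 1 by rewrite ltr_wpDl.
have e1 : 0 < e / (c + 1) by rewrite divr_gt0.
have [N uN] := ux _ e1; exists N => n /uN; rewrite ler_pdivlMr // => h.
rewrite -extB // (le_trans (ext_bound _)) //.
  exact: (subspaceB (closure_subspace range_subspace)).
by apply: le_trans h; rewrite mulrC ler_wpM2l ?hnorm_ge0 // lerDl.
Qed.

End extension.

(** * Positive two-by-two blocks and contractivity *)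

Section ucp_maps.
Context {R : realType}.
Implicit Types H K L : hilbertType R.

(** The form of the operator matrix [c, T; T^*, c] at (x, y) is c (|x|^2 + |y|^2) + 2 Re <T y, x>,
    and the last term is at least -2c |x| |y|. *)
Lemma block_positive H (T : 'B(H)) (c : R) : opnorm T <= c -> forall x y,
  0 <= c%:C * ('[x, x] + '[y, y]) + '[T y, x] + '[adj T x, y].
Proof.
move=> Tc x y; have -> : '[adj T x, y] = Num.conj '[T y, x] by rewrite adj_dot dotC.
have -> : c%:C * ('[x, x] + '[y, y]) + '[T y, x] + Num.conj '[T y, x] =
    (c * (hnorm x ^+ 2 + hnorm y ^+ 2) + 2 * complex.Re '[T y, x])%:C.
  rewrite !dotxx; case: '[T y, x] => p q; apply/eqP; rewrite eq_complex /=.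
  by apply/andP; split; apply/eqP; ring.
rewrite ler0c; have := Re_cauchy_schwarz (- T y) x.
have := le_opnorm T y; rewrite hnormN -scaleN1r dotZl mulN1r raddfN /=.
have := hnorm_ge0 x; have := hnorm_ge0 y; have := opnorm_ge0 T.
have := sqr_ge0 (hnorm x - hnorm y); have := hnorm_ge0 (T y).
set t := complex.Re _ => h1 h2 h3 h4 h5 h6 h7.
have h8 : hnorm (T y) * hnorm x <= c * (hnorm y * hnorm x).
  by rewrite mulrA ler_wpM2r // (le_trans h6) // ler_wpM2r.
nra.
Qed.

(** The converse reading of a positive block. It yields compatibility with adjoints and the norm
    bound at once, so that both pass from one map to another along positivity of 2 x 2 matrices. *)
Lemma block_positive_inv H (S S' : 'B(H)) (c : R) : 0 <= c ->
  (forall x y, 0 <= c%:C * ('[x, x] + '[y, y]) + '[S y, x] + '[S' x, y]) ->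
  S' = adj S /\ opnorm S <= c.
Proof.
move=> c0 h.
have S'S : S' = adj S.
  apply: bop_ext => x; apply: dot_inj => y; rewrite adj_dot [RHS]dotC.
  (* A nonnegative element of R[i] is real; reality of the form at y and at i y determines both
     parts of <S' x, y>. *)
  have := h x y; have := h x ((0 +i* 1) *: y).
  have -> : S ((0 +i* 1) *: y) = (0 +i* 1) *: S y by rewrite linearZ.
  rewrite !dotZl !dotZr; move: ('[S y, x]) ('[S' x, y]) => [p q] [p' q'].
  rewrite !dotxx !lecE /= => /andP[/eqP h1 _] /andP[/eqP h2 _].
  by apply/eqP; rewrite eq_complex /=; apply/andP; split; apply/eqP; lra.
split=> //; subst S'; apply: opnorm_bound => // y.
(* Positivity at x = -t S y. The best parameter is t = 1/c; for c = 0 any positive t forces S y =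
   0. *)
have hy (t : R) : 2 * t * hnorm (S y) ^+ 2 <=
    c * (t ^+ 2 * hnorm (S y) ^+ 2 + hnorm y ^+ 2).
  have := h ((- t)%:C *: S y) y; rewrite adj_dot dotZl !dotZr dotZl conjC_real.
  rewrite !dotxx !lecE /= => /andP[_]; nra.
have [c1|c1] := eqVneq c 0.
  have := hy 1; rewrite c1 !mul0r mulr1 => s0; have := sqr_ge0 (hnorm (S y)) => s1.
  have /eqP : hnorm (S y) ^+ 2 = 0 by lra.
  by rewrite sqrf_eq0 => /eqP ->.
have cp : 0 < c by rewrite lt_neqAle eq_sym c1.
rewrite -ler_sqr ?nnegrE ?mulr_ge0 ?hnorm_ge0 // exprMn.
have := ler_wpM2l c0 (hy c^-1).
have -> : c * (2 * c^-1 * hnorm (S y) ^+ 2) = 2 * hnorm (S y) ^+ 2 by field.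
have -> : c * (c * (c^-1 ^+ 2 * hnorm (S y) ^+ 2 + hnorm y ^+ 2)) =
  hnorm (S y) ^+ 2 + c ^+ 2 * hnorm y ^+ 2 by field.
by lra.
Qed.

Section opsys_elements.
Context {S : opsys R}.

Lemma os_subspace : linear_subspace (S : set _).
Proof. by case: (os_is_opsys S). Qed.

Lemma os_memP (s : S) : (S : set _) (val s).
Proof. exact/set_mem/valP. Qed.

Definition os_zero : S := SigSub (mem_set (subspace0 os_subspace)).

Definition os_lin (a : R[i]) (s t : S) : S :=
  SigSub (mem_set (os_subspace.2 a (val s) (val t) (os_memP s) (os_memP t))).

Lemma os_star_subproof (s : S) : adj (val s) \in (S : set _).
Proof. by apply/mem_set; case: (os_is_opsys S) => _ + _; apply; exact: os_memP. Qed.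

Definition os_star (s : S) : S := SigSub (os_star_subproof s).

Lemma os_one_subproof : bid (os_space S) \in (S : set _).
Proof. by apply/mem_set; case: (os_is_opsys S). Qed.

Definition os_one : S := SigSub os_one_subproof.

Definition os_scale (a : R[i]) (s : S) : S := os_lin a s os_zero.

Section linear_maps.
Context {V : lmodType R[i]} {f : S -> V}.
Hypothesis lf : linear_on f.

Lemma os_f0 : f os_zero = 0.
Proof.
have := lf (a := 1) (x := os_zero) (y := os_zero) (z := os_zero).
rewrite /= scaler0 addr0 scale1r => /(_ erefl) /eqP.
by rewrite -subr_eq0 opprD addNKr oppr_eq0 => /eqP.
Qed.

Lemma os_f_lin a s t : f (os_lin a s t) = a *: f s + f t.
Proof. exact: lf. Qed.

Lemma os_fZ a s : f (os_scale a s) = a *: f s.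
Proof. by rewrite os_f_lin os_f0 addr0. Qed.

End linear_maps.

Lemma os_f1 K (f : S -> 'B(K)) : unital f -> f os_one = bid K.
Proof. by move=> uf; exact: uf. Qed.

Definition block2 (a b c d : S) : 'M[S]_2 :=
  \matrix_(i, j) if i == 0 then (if j == 0 then a else b) else (if j == 0 then c else d).

Lemma mxpos_block2 K (f : S -> 'B(K)) a b c d :
  mxpos (map_mx f (block2 a b c d)) <->
  forall x y, 0 <= '[f a x + f b y, x] + '[f c x + f d y, y].
Proof.
split=> [h x y|h xi].
  have := h (fun i => if i == 0 then x else y).
  by rewrite /mxact !big_ord_recl !big_ord0 /= !mxE /= !addr0.
have := h (xi ord0) (xi (lift ord0 ord0)).
by rewrite /mxact !big_ord_recl !big_ord0 /= !mxE /= !addr0.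
Qed.

Section pair.
Context {H K : hilbertType R} {alpha : S -> 'B(H)} {phi : S -> 'B(K)}.
Hypotheses (la : linear_on alpha) (ua : unital alpha).
Hypotheses (lphi : linear_on phi) (uphi : unital phi).
Hypothesis posP : forall n (X : 'M[S]_n), mxpos (map_mx alpha X) -> mxpos (map_mx phi X).
Hypothesis star_a : forall s, alpha (os_star s) = adj (alpha s).

(** The block [c, s; s^*, c] with c = |alpha s| is positive under [alpha], hence under [phi], and
    [block_positive_inv] reads off the result. Stating it for a pair of maps lets [alpha] be the
    inclusion of S as well as any complete order embedding. *)
Lemma pair_star_contractive s :
  phi (os_star s) = adj (phi s) /\ opnorm (phi s) <= opnorm (alpha s).
Proof.
apply: block_positive_inv (opnorm_ge0 _) _ => x y.
pose c := (opnorm (alpha s))%:C.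
have : mxpos (map_mx alpha (block2 (os_scale c os_one) s (os_star s) (os_scale c os_one))).
  apply/mxpos_block2 => u v; have := block_positive (lexx (opnorm (alpha s))) u v.
  rewrite !(os_fZ la) (os_f1 ua) star_a !bopZ /= !dotDl !dotZl mulrDr.
  by congr (0 <= _); ring.
move=> /posP /mxpos_block2 /(_ x y).
rewrite !(os_fZ lphi) (os_f1 uphi) !bopZ /= !dotDl !dotZl mulrDr.
by congr (0 <= _); ring.
Qed.

End pair.
End opsys_elements.

End ucp_maps.

(** * Unital completely positive maps *)

Section choi.
Context {R : realType} {S : opsys R}.

Definition block3 (a b c a' b' c' a'' b'' c'' : S) : 'M[S]_3 :=
  \matrix_(i, j) nth a (nth [::] [:: [:: a; b; c]; [:: a'; b'; c']; [:: a''; b''; c'']] i) j.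

Lemma mxpos_block3 (K : hilbertType R) (f : S -> 'B(K)) a b c a' b' c' a'' b'' c'' :
  mxpos (map_mx f (block3 a b c a' b' c' a'' b'' c'')) <->
  forall x y z, 0 <= '[f a x + (f b y + f c z), x] +
    ('[f a' x + (f b' y + f c' z), y] + '[f a'' x + (f b'' y + f c'' z), z]).
Proof.
split=> [h x y z|h xi].
  have := h (fun i => nth x [:: x; y; z] i).
  by rewrite /mxact !big_ord_recl !big_ord0 /= !mxE /= !addr0.
have := h (xi ord0) (xi (lift ord0 ord0)) (xi (lift ord0 (lift ord0 ord0))).
by rewrite /mxact !big_ord_recl !big_ord0 /= !mxE /= !addr0.
Qed.

Context {H K : hilbertType R} {alpha : S -> 'B(H)} {phi : S -> 'B(K)}.
Hypotheses (la : linear_on alpha) (ua : unital alpha).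
Hypotheses (lphi : linear_on phi) (uphi : unital phi).
Hypothesis posP : forall n (X : 'M[S]_n), mxpos (map_mx alpha X) -> mxpos (map_mx phi X).
Hypothesis star_a : forall s, alpha (os_star s) = adj (alpha s).

(* The matrix [c aa*, c a, as; c a*, c, s; (as)*, s*, c] with c = |s| is positive,
   being D [c, s; s*, c] D* with D the matrix [a, 0; 1, 0; 0, 1]; its image under
   [phi] has a null vector in the first two coordinates, so these must be
   orthogonal to the third one. *)
Lemma pair_mult (a s u v : S) :
  alpha u = alpha a ** alpha s -> alpha v = alpha a ** adj (alpha a) ->
  phi v = phi a ** adj (phi a) -> phi u = phi a ** phi s.
Proof.
move=> au av pv; pose c := (opnorm (alpha s))%:C.
have stphi t : phi (os_star t) = adj (phi t).
  by have [] := pair_star_contractive la ua lphi uphi posP star_a t.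
have : mxpos (map_mx alpha (block3
    (os_scale c v) (os_scale c a) u
    (os_scale c (os_star a)) (os_scale c os_one) s
    (os_star u) (os_star s) (os_scale c os_one))).
  apply/mxpos_block3 => x y z.
  have := block_positive (lexx (opnorm (alpha s))) (adj (alpha a) x + y) z.
  rewrite !(os_fZ la) (os_f1 ua) !star_a au av adj_comp !bopZ /= -/c !linearD /=.
  rewrite !(dotDl, dotDr, dotZl) !dot_adj.
  by congr (0 <= _); ring.
move=> /posP /mxpos_block3 pos.
apply/eqP; rewrite -subr_eq0; apply/eqP/bop_ext => z; rewrite bop0.
set D := phi u - _; have Dz : D z = phi u z - phi a (phi s z) by [].
clearbody D.
have hD x : 0 <= c * '[z, z] + '[D z, x] + '[x, D z].
  (* The null vector is (x, -phi(a)^* x): it is killed by the upper left 2 x 2 block because phi(v)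
     = phi(a) phi(a)^*. *)
  have := pos x (- adj (phi a) x) z.
  rewrite !(os_fZ lphi) (os_f1 uphi) !stphi pv !bopZ /= !linearN /=.
  rewrite !Dz !(dotBl, dotBr, dotDl, dotDr, dotZl, dotNl, dotNr) !dot_adj ?adjK.
  by congr (0 <= _); ring.
have hD2 (t : R) : 2 * t * hnorm (D z) ^+ 2 <= opnorm (alpha s) * hnorm z ^+ 2.
  have := hD ((- t)%:C *: D z); rewrite dotZl !dotZr conjC_real !dotxx !lecE /=.
  by move=> /andP[_]; lra.
have s0 := mulr_ge0 (opnorm_ge0 (alpha s)) (sqr_ge0 (hnorm z)).
apply: hnorm0_eq0; apply/eqP; rewrite -sqrf_eq0 eq_le sqr_ge0 andbT leNgt; apply/negP => D0.
(* The bound in [hD2] is independent of t, and this value of t exceeds it when D z is nonzero. *)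
have := hD2 ((opnorm (alpha s) * hnorm z ^+ 2 + 1) / hnorm (D z) ^+ 2).
by rewrite -mulrA divfK ?gt_eqF //; lra.
Qed.

End choi.

Section ucp_star.
Context {R : realType} {S : opsys R} {K : hilbertType R} {phi : S -> 'B(K)}.

Lemma ucp_star : ucp phi -> forall s, phi (os_star s) = adj (phi s).
Proof.
move=> [lphi uphi pos] s.
by have [] := @pair_star_contractive _ S _ K val phi (fun _ _ _ _ => id)
  (fun _ => id) lphi uphi pos (fun _ => erefl) s.
Qed.

Lemma coe_ucp : complete_order_embedding phi -> ucp phi.
Proof. by move=> [? ? pos]; split=> // n X /pos. Qed.

(** If phi(s) = 0 then the block [0, s; s^*, 0] has zero, hence positive, image; so it is itself
    positive, and [block_positive_inv] with c = 0 gives s = 0. *)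
Lemma coe_inj : complete_order_embedding phi -> injective phi.
Proof.
move=> cphi; have [lphi uphi pos] := cphi.
have ker s : phi s = 0 -> val s = 0.
  move=> s0; apply/hnorm_le0; rewrite hnorm_bop.
  suff h x y : 0 <= 0%:C * ('[x, x] + '[y, y]) + '[val s y, x] + '[adj (val s) x, y].
    by have [_] := block_positive_inv (lexx 0) h.
  have : mxpos (map_mx phi (block2 (os_zero (S := S)) s (os_star s) os_zero)).
    apply/mxpos_block2 => u v.
    by rewrite (os_f0 lphi) (ucp_star (coe_ucp cphi)) s0 adj0 !bop0 addr0 !dot0l addr0.
  have v0 : val (os_zero (S := S)) = 0 by [].
  move=> /pos /mxpos_block2 /(_ x y).
  by rewrite v0 !bop0 addr0 add0r mul0r add0r.
move=> s t st; apply/val_inj/eqP; rewrite -subr_eq0; apply/eqP.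
have := ker (os_lin (-1) t s); rewrite os_f_lin // st scaleN1r addNr /= => /(_ erefl).
by rewrite scaleN1r addrC.
Qed.

End ucp_star.

(** * The bimodule property and the extension of representations to closures *)

Section representation_extension.
Context {R : realType} {S : opsys R} {E : injective_envelope S} {H : hilbertType R}.
Variable alpha : S -> 'B(H).
Implicit Types X : crep E.

(** The representation seen as a map on the closure of the copy of S in B(H). Outside this closure
    it takes the default value 0, which is why the rules below ask for membership. *)
Definition hat (X : crep E) : 'B(H) -> 'B(rep_space X) := ext alpha (rep_map X).

Variable A : set 'B(H).

(* [alpha] carries the multiplier C*-algebra of [S], with its product, onto [A]. *)
Record faithful_model : Prop := FaithfulModel {
  fm_coe : complete_order_embedding alpha ;
  fm_gen : generates_envelope E alpha ;
  fm_mult : alpha @` multipliers E = A ;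
  fm_star : forall a, A a -> A (adj a) }.

Hypothesis fm : faithful_model.
Let cs := closure (range alpha).

(** The definition of multipliers puts the product a s, formed in the injective envelope, into the
    copy of S there; the *-homomorphism [rho] agrees with [alpha] on S and carries that product to
    composition in B(H). *)
Lemma multipliers_mul a s : multipliers E a ->
  exists u, ie_emb E u = ie_emb E a ** ie_emb E s /\ alpha u = alpha a ** alpha s.
Proof.
move=> [_ /(_ s)[[u _ us] _]]; exists u; split=> //.
have [rho [[_ rhoM _] _ _ rhoE]] := fm_gen fm.
have envE t : ie_emb E t \in cstar_envelope E.
  by apply/mem_set => D [_]; apply; exists t.
by rewrite -!(rhoE _ (SigSub (envE _)) erefl); exact: rhoM.
Qed.

Lemma fm_alpha_star s : alpha (os_star s) = adj (alpha s).
Proof. exact: (ucp_star (coe_ucp (fm_coe fm))). Qed.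

Lemma fm_inj : injective alpha.
Proof. exact: coe_inj (fm_coe fm). Qed.

Lemma fm_multP s : A (alpha s) -> multipliers E s.
Proof. by rewrite -(fm_mult fm) => -[t Et /fm_inj <-]. Qed.

Lemma fm_multE s : multipliers E s -> A (alpha s).
Proof. by move=> Es; rewrite -(fm_mult fm); exists s. Qed.

Lemma fm_sub : A `<=` range alpha.
Proof. by rewrite -(fm_mult fm) => _ [s _ <-]; exists s. Qed.

Lemma fm_bounded_graph X : bounded_graph alpha (rep_map X) 1.
Proof.
have [lX uX pX] := rep_ucp X; have [la ua pa] := fm_coe fm.
split=> // [|a s t|s|u].
- by exists os_zero; rewrite !os_f0.
- by exists (os_lin a s t); rewrite !os_f_lin.
- rewrite mul1r !hnorm_bop.
  have [//|_ ->//] := pair_star_contractive la ua lX uX _ fm_alpha_star s.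
  by move=> n Y /pa /pX.
- exact: bop_complete.
Qed.

Lemma hatE X s : hat X (alpha s) = rep_map X s.
Proof. exact: ext_fun (fm_bounded_graph X) s. Qed.

Lemma hat_graph X x : cs x -> extends alpha x (hat X x).
Proof. exact: ext_graph (fm_bounded_graph X) x. Qed.

Lemma hat_eq X x (y : 'B(rep_space X)) : extends alpha x y -> hat X x = y.
Proof. exact: ext_eq (fm_bounded_graph X) x y. Qed.

Lemma cs_subspace : linear_subspace cs.
Proof.
have [la _ _] := fm_coe fm.
apply: closure_subspace; split; first by exists os_zero => //; rewrite os_f0.
by move=> a _ _ [s _ <-] [t _ <-]; exists (os_lin a s t); rewrite ?os_f_lin.
Qed.

Lemma cs_sub : range alpha `<=` cs.
Proof. exact: subset_closure. Qed.

Lemma cs_A : A `<=` cs.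
Proof. by move=> a /fm_sub; exact: cs_sub. Qed.

Lemma cs_adj x : cs x -> cs (adj x).
Proof.
move=> /closure_seq[u us ux]; apply: (seq_closure _ (cvg_adj ux)) => n.
by have [s _ <-] := us n; exists (os_star s); rewrite ?fm_alpha_star.
Qed.

(** This is [pair_mult] with v = a a^*: since a and a^* are both multipliers, the representation is
    multiplicative on this product. The element u comes from the multiplier property alone, so one u
    serves all X. *)
Lemma range_mul a s : A a -> exists2 u, alpha u = a ** alpha s &
  forall X, rep_map X u = hat X a ** rep_map X s.
Proof.
rewrite -(fm_mult fm) => -[a' a'E <-]; have [u [_ us]] := multipliers_mul s a'E.
exists u => // X; rewrite hatE.
have [lX uX pX] := rep_ucp X; have [la ua pa] := fm_coe fm.
have a'sE : multipliers E (os_star a').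
  by apply: fm_multP; rewrite fm_alpha_star; apply: (fm_star fm); exact: fm_multE.
have [v [Ev av]] := multipliers_mul (os_star a') a'E.
apply: (@pair_mult _ _ _ _ alpha _ la ua lX uX _ fm_alpha_star a' s u v) => //.
- by move=> n Y /pa /pX.
- by rewrite av fm_alpha_star.
- by rewrite (rep_mult X a'E a'sE Ev) (ucp_star (rep_ucp X)).
Qed.

Lemma cs_mull a x : A a -> cs x -> cs (a ** x).
Proof.
move=> Aa /closure_seq[u us ux].
apply: (seq_closure _ (cvg_bcomp (cvg_cst a) ux)) => n.
by have [s _ <-] := us n; have [v <- _] := range_mul s Aa; exists v.
Qed.

Lemma range_mulr a s : A a -> range alpha (alpha s ** a).
Proof.
move=> /(fm_star fm) /(range_mul (os_star s))[u ua _]; exists (os_star u) => //.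
by rewrite fm_alpha_star ua adj_comp fm_alpha_star !adjK.
Qed.

Lemma cs_mulr a x : A a -> cs x -> cs (x ** a).
Proof.
move=> /(fm_star fm) Aa /cs_adj /(cs_mull Aa) /cs_adj.
by rewrite adj_comp !adjK.
Qed.

Lemma hat_adj X x : cs x -> hat X (adj x) = adj (hat X x).
Proof.
move=> /(@hat_graph X) /closure_pair_seq[u [v [uv ux vx]]].
apply: hat_eq; apply: (seq_closure_pair _ (cvg_adj ux) (cvg_adj vx)) => n.
have [s _ [<- <-]] := uv n; exists (os_star s) => //.
by rewrite fm_alpha_star (ucp_star (rep_ucp X)).
Qed.

Lemma hat1 X : hat X (bid H) = bid _.
Proof.
have [lX uX pX] := rep_ucp X; have [la ua pa] := fm_coe fm.
by rewrite -(os_f1 ua) hatE os_f1.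
Qed.

Lemma hat_mull X a x : A a -> cs x -> hat X (a ** x) = hat X a ** hat X x.
Proof.
move=> Aa /(@hat_graph X) /closure_pair_seq[u [v [uv ux vx]]].
apply: hat_eq; apply: (seq_closure_pair _ (cvg_bcomp (cvg_cst a) ux)
  (cvg_bcomp (cvg_cst (hat X a)) vx)) => n.
have [s _ [<- <-]] := uv n; have [w <- wX] := range_mul s Aa.
by exists w => //; rewrite wX.
Qed.

Lemma hat_mulr X a x : A a -> cs x -> hat X (x ** a) = hat X x ** hat X a.
Proof.
move=> Aa sx; have As := fm_star fm Aa; have xs := cs_adj sx; have sa := cs_A Aa.
rewrite -[x ** a]adjK adj_comp hat_adj; last exact: cs_mull.
by rewrite hat_mull // !hat_adj // adj_comp !adjK.
Qed.

Lemma hat_sum X J (r : seq J) (P : pred J) (x : J -> 'B(H)) :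
  (forall j, P j -> cs (x j)) ->
  hat X (\sum_(j <- r | P j) x j) = \sum_(j <- r | P j) hat X (x j).
Proof. by move=> xs; exact: (ext_sum (fm_bounded_graph X) r xs). Qed.

Lemma hat_lin X a x y : cs x -> cs y -> hat X (a *: x + y) = a *: hat X x + hat X y.
Proof. by move=> sx sy; exact: (ext_lin (fm_bounded_graph X)). Qed.

Lemma hat_bound X x : cs x -> opnorm (hat X x) <= opnorm x.
Proof. by move=> sx; rewrite -[leRHS]mul1r; exact: (ext_bound (fm_bounded_graph X) sx). Qed.

Lemma hat_cvg X (u : nat -> 'B(H)) x : (forall n, cs (u n)) ->
  u @ \oo --> x -> (fun n => hat X (u n)) @ \oo --> hat X x.
Proof. by move=> us ux; exact: (ext_cvg (fm_bounded_graph X)). Qed.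

End representation_extension.

(** * Ternary rings of operators *)

Section tro_theory.
Context {R : realType}.
Implicit Types H K : hilbertType R.

Lemma adj_setK H K (M : set 'B(H, K)) : adj_set (adj_set M) = M.
Proof.
apply/seteqP; split=> [_ [_ [m Mm <-] <-]|m Mm]; first by rewrite adjK.
by exists (adj m); [exists m | rewrite adjK].
Qed.

Lemma closure_adj_set H K (M : set 'B(H, K)) x :
  closure M x -> closure (adj_set M) (adj x).
Proof.
move=> /closure_seq[u uM ux]; apply: (seq_closure _ (cvg_adj ux)) => n.
by exists (u n).
Qed.

Lemma closure_adj_setE H K (M : set 'B(H, K)) x :
  closure (adj_set M) x -> closure M (adj x).
Proof. by move=> /closure_adj_set; rewrite adj_setK. Qed.

Lemma subspace_adj_set H K (M : set 'B(H, K)) :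
  linear_subspace M -> linear_subspace (adj_set M).
Proof.
move=> [M0 MD]; split; first by exists 0; rewrite ?adj0.
move=> a _ _ [x Mx <-] [y My <-]; exists (Num.conj a *: x + y); first exact: MD.
by rewrite adjD adjZ conjCK.
Qed.

Lemma is_tro_adj H K (M : set 'B(H, K)) : is_tro M -> is_tro (adj_set M).
Proof.
move=> [sM M3]; split; first exact: subspace_adj_set.
move=> _ _ _ [a Ma <-] [b Mb <-] [c Mc <-]; exists (c ** adj b ** a); first exact: M3.
by rewrite !adj_comp !adjK bcompA.
Qed.

Section closure.
Context {H K : hilbertType R} {M : set 'B(H, K)}.
Hypothesis tM : is_tro M.
Let N := closure M.
Let A := cspan (prod_set (adj_set M) M).
Let B := cspan (prod_set M (adj_set M)).

Lemma tro_closure_subspace : linear_subspace N.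
Proof. by apply: closure_subspace; case: tM. Qed.

Lemma tro_mul3 x y z : N x -> N y -> N z -> N (x ** adj y ** z).
Proof.
move=> /closure_seq[u uM ux] /closure_seq[v vM vy] /closure_seq[w wM wz].
apply: (seq_closure _ (cvg_bcomp (cvg_bcomp ux (cvg_adj vy)) wz)) => n.
by case: tM => _; apply.
Qed.

Lemma tro_left x y : N x -> N y -> A (adj x ** y).
Proof.
move=> /closure_seq[u uM ux] /closure_seq[v vM vy].
apply: (closed_seq (@closed_closure _ _) _ (cvg_bcomp (cvg_adj ux) vy)) => n.
apply: sub_cspan; exists (adj (u n)); first by exists (u n).
by exists (v n).
Qed.

Lemma tro_mulr x a : N x -> A a -> N (x ** a).
Proof.
move=> Nx; move: a; apply: (@cspan_min _ _ _ [set a | N (x ** a)]).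
- split; first by rewrite /= bcomp0r; exact: (subspace0 tro_closure_subspace).
  by move=> c a b /= ? ?; rewrite bcompDr bcompZr; apply: tro_closure_subspace.2.
- move=> a /closure_seq[u /= uN ua].
  by apply: (closed_seq (@closed_closure _ _) uN (cvg_bcomp (cvg_cst x) ua)).
- move=> _ [_ [m Mm <-] [n Mn <-]] /=; rewrite bcompA.
  by apply: tro_mul3 => //; exact: subset_closure.
Qed.

Lemma tro_A_adj a : A a -> A (adj a).
Proof.
move: a; apply: (@cspan_min _ _ _ [set a | A (adj a)]).
- split; first by rewrite /= adj0; exact: (subspace0 (cspan_subspace _)).
  by move=> c x y /= ? ?; rewrite adjD adjZ; apply: (cspan_subspace _).2.
- move=> x /closure_seq[u /= uN ux].
  by apply: (closed_seq (@closed_closure _ _) uN (cvg_adj ux)).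
- move=> _ [_ [x Mx <-] [y My <-]] /=; rewrite adj_comp adjK.
  by apply: tro_left; exact: subset_closure.
Qed.

End closure.

Lemma tro_mull H K (M : set 'B(H, K)) (b : 'B(K)) x : is_tro M ->
  cspan (prod_set M (adj_set M)) b -> closure M x -> closure M (b ** x).
Proof.
move=> tM Bb /closure_adj_set Mx; rewrite -[b ** x]adjK adj_comp.
apply: closure_adj_setE; apply: (tro_mulr (is_tro_adj tM) Mx).
by apply: tro_A_adj; rewrite adj_setK.
Qed.

End tro_theory.

(** * Exact finite units in the closure of a nondegenerate TRO *)

Section exact_units.
Context {R : realType} {H K : hilbertType R} {M : set 'B(H, K)}.
Hypothesis tM : is_tro M.
Let N := closure M.
Hypothesis unitM : cspan (prod_set M (adj_set M)) (bid K).

Lemma approximate_unit (e : R) : 0 < e ->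
  exists p (m n : 'I_p -> 'B(H, K)), [/\ forall i, M (m i), forall i, M (n i) &
    opnorm (bid K - \sum_i m i ** adj (n i)) <= e].
Proof.
move=> e0; have [x] := closure_approx unitM e0.
suff : lspan (prod_set M (adj_set M)) `<=` [set x | exists s : seq ('B(H, K) * 'B(H, K)),
    (forall p, p \in s -> M p.1 /\ M p.2) /\ x = \sum_(p <- s) p.1 ** adj p.2].
  move=> sp /sp [s [sM ->]] se.
  exists (size s), (fun i => (tnth (in_tuple s) i).1), (fun i => (tnth (in_tuple s) i).2).
  by split=> [i|i|]; rewrite -?(big_tnth _ _ s xpredT (fun p => p.1 ** adj p.2)) //;
    have [] := sM _ (mem_tnth i (in_tuple s)).
apply: lspan_min => [|_ [m Mm [_ [n Mn <-] <-]]] /=; last first.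
  exists [:: (m, n)]; rewrite big_seq1; split=> // p; by rewrite inE => /eqP ->.
split; first by exists [::]; rewrite big_nil.
move=> a _ _ [s [sM ->]] [t [tM' ->]].
exists ([seq (a *: p.1, p.2) | p <- s] ++ t); split.
  move=> p; rewrite mem_cat => /orP[/mapP[q qs ->]|/tM'//].
  by have [? ?] := sM q qs; split=> //; apply: subspaceZ => //; case: tM.
rewrite big_cat big_map scaler_sumr; congr (_ + _); apply: eq_bigr => p _.
by rewrite bcompZl.
Qed.

(** Positivity at x + y bounds -2 Re <P y, x> by q (|x|^2 + |y|^2); thus the block [q, P; P, q] is
    positive and [block_positive_inv] applies, without any spectral theory. *)
Lemma positive_opnorm (P : 'B(K)) (q : R) : 0 <= q -> adj P = P ->
  (forall x, 0 <= complex.Re '[P x, x] <= q * hnorm x ^+ 2) -> opnorm P <= q.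
Proof.
move=> q0 sP hP; apply: (@proj2 (P = adj P)).
apply: block_positive_inv => // x y.
have -> : '[P x, y] = Num.conj '[P y, x] by rewrite -{1}sP adj_dot dotC.
have /andP[+ _] := hP (x + y); have /andP[_] := hP x; have /andP[_] := hP y.
rewrite (linearD P) !dotDl !dotDr !raddfD /=.
have -> : complex.Re '[P x, y] = complex.Re '[P y, x].
  by rewrite -{1}sP adj_dot Re_dotC.
rewrite !dotxx lecE; case: '[P y, x] => a b /= h1 h2 h3.
by apply/andP; split; [apply/eqP; ring | nra].
Qed.

Definition row_defect p (r : 'I_p -> 'B(H, K)) := bid K - \sum_i r i ** adj (r i).

Lemma row_defect_sa p (r : 'I_p -> 'B(H, K)) : adj (row_defect r) = row_defect r.
Proof.
rewrite /row_defect adjB adj_bid adj_sum; congr (_ - _).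
by apply: eq_bigr => i _; rewrite adj_comp adjK.
Qed.

Lemma Re_row p (r : 'I_p -> 'B(H, K)) x :
  complex.Re '[(\sum_i r i ** adj (r i)) x, x] = \sum_i hnorm (adj (r i) x) ^+ 2.
Proof.
rewrite bop_sum dot_suml raddf_sum; apply: eq_bigr => i _.
by rewrite sqr_hnorm_op adjK.
Qed.

(** From r_i r_i^* <= r r^* = 1 - e <= 2; the square root of 2 would do, 2 is merely convenient. *)
Lemma row_bound p (r : 'I_p -> 'B(H, K)) i : opnorm (row_defect r) <= 1 ->
  opnorm (r i) <= 2.
Proof.
move=> r1; rewrite -opnorm_adj; apply: opnorm_bound => // x.
rewrite -ler_sqr ?nnegrE ?mulr_ge0 ?hnorm_ge0 // exprMn.
have : hnorm (adj (r i) x) ^+ 2 <= complex.Re '[(\sum_i r i ** adj (r i)) x, x].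
  by rewrite Re_row (bigD1 i) //= lerDl sumr_ge0 // => j _; exact: sqr_ge0.
have -> : \sum_i r i ** adj (r i) = bid K - row_defect r by rewrite opprB addrC subrK.
rewrite bopB dotBl dotxx raddfB /= => h1.
have := Re_cauchy_schwarz (- row_defect r x) x; have := le_opnorm (row_defect r) x.
rewrite hnormN dotNl raddfN /=; have := hnorm_ge0 x; have := hnorm_ge0 (row_defect r x).
move: h1; set u := hnorm (_ x); set v := hnorm x; set w := hnorm (row_defect r x).
move=> h1 h2 h3 h4 h5; have h6 : opnorm (row_defect r) * v <= v by rewrite ler_piMl.
by nra.
Qed.

(* If sum m_i n_i^* is close to 1 then, by Cauchy-Schwarz, sum m_i m_i^* is bounded
   below; rescaling the m_i makes it a contraction at distance < 1 from 1. *)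
Lemma initial_row : exists p (r : 'I_p -> 'B(H, K)) (q : R),
  [/\ forall i, M (r i), 0 <= q < 1 & opnorm (row_defect r) <= q].
Proof.
have [|p [m [n [Mm Mn mn]]]] := @approximate_unit 2^-1; first by rewrite invr_gt0.
pose C := \sum_i opnorm (n i) ^+ 2; pose D := 1 + \sum_i opnorm (m i) ^+ 2.
have C0 : 0 <= C by apply: sumr_ge0 => i _; exact: sqr_ge0.
have D1 : 1 <= D by rewrite lerDl; apply: sumr_ge0 => i _; exact: sqr_ge0.
(* The weight in u v <= (t/2) u^2 + v^2 / (2t), applied to u = |n_i^* x| and v = |m_i^* x|. Since t
   C <= 1/2, the n-part takes at most 1/4 of the available |x|^2 / 2, and the remaining quarter
   bounds the m-part below by t/2. *)
pose t := (2 * (C + 1))^-1.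
have t0 : 0 < t by rewrite invr_gt0 mulr_gt0 // ltr_wpDl.
have tC : t * (2 * (C + 1)) = 1 by rewrite mulVf // gt_eqF // mulr_gt0 // ltr_wpDl.
have t1 : t <= 2^-1 by nra.
have sumM (f : 'I_p -> 'B(H, K)) x :
    \sum_i hnorm (adj (f i) x) ^+ 2 <= (\sum_i opnorm (f i) ^+ 2) * hnorm x ^+ 2.
  rewrite mulr_suml ler_sum // => i _; rewrite -exprMn.
  rewrite ler_sqr ?nnegrE ?hnorm_ge0 ?mulr_ge0 ?hnorm_ge0 ?opnorm_ge0 //.
  by rewrite -(opnorm_adj (f i)) le_opnorm.
have low x : t / 2 * hnorm x ^+ 2 <= \sum_i hnorm (adj (m i) x) ^+ 2.
  have := Re_cauchy_schwarz ((bid K - \sum_i m i ** adj (n i)) x) x.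
  have := le_trans (le_opnorm (bid K - \sum_i m i ** adj (n i)) x)
    (ler_wpM2r (hnorm_ge0 x) mn).
  rewrite bopB dotBl dotxx raddfB /= => h1 h2.
  have h3 : complex.Re '[(\sum_i m i ** adj (n i)) x, x] <=
      \sum_i (t / 2 * hnorm (adj (n i) x) ^+ 2 + (2 * t)^-1 * hnorm (adj (m i) x) ^+ 2).
    rewrite bop_sum dot_suml raddf_sum; apply: ler_sum => i _ /=.
    rewrite dot_adj (le_trans (Re_cauchy_schwarz _ _)) //.
    set u := hnorm _; set v := hnorm _.
    have : (2 * t)^-1 * (2 * t) = 1 by rewrite mulVf // gt_eqF // mulr_gt0.
    have := sqr_ge0 (t * u - v); have : 0 < (2 * t)^-1 by rewrite invr_gt0 mulr_gt0.
    set s := (2 * t)^-1 => s0 h st.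
    have : 0 <= s * (t * u - v) ^+ 2 by rewrite mulr_ge0 // ltW.
    have -> : s * (t * u - v) ^+ 2 = s * t * (t * u ^+ 2 - 2 * u * v) + s * v ^+ 2 by ring.
    have -> : s * t = 2^-1 by lra.
    by lra.
  rewrite big_split -!mulr_sumr /= in h3.
  have h4 := sumM n x; rewrite -/C in h4.
  set s2 := \sum_i hnorm (adj (m i) x) ^+ 2 in h3 *.
  set s1 := \sum_i hnorm (adj (n i) x) ^+ 2 in h3 h4.
  have h5 : hnorm (x - (\sum_i m i ** adj (n i)) x) * hnorm x <= 2^-1 * hnorm x ^+ 2.
    by rewrite expr2 mulrA ler_wpM2r ?hnorm_ge0.
  have h6 : t / 2 * s1 <= t / 2 * (C * hnorm x ^+ 2) by rewrite ler_wpM2l // divr_ge0 // ltW.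
  have x0 := sqr_ge0 (hnorm x).
  have h7 : t * C * hnorm x ^+ 2 <= 2^-1 * hnorm x ^+ 2 by rewrite ler_wpM2r //; lra.
  have h8 : 4^-1 * hnorm x ^+ 2 <= (2 * t)^-1 * s2 by lra.
  have := ler_wpM2l (ltW (mulr_gt0 (ltr0n _ 2) t0)) h8.
  by rewrite mulrA [X in _ <= X -> _]mulrA mulfV ?mul1r ?gt_eqF ?mulr_gt0 //; lra.
(* As D dominates sum |m_i|^2, the rescaled row is a contraction; its defect is then positive and,
   by [low], at most 1 - t/(2D). *)
pose l := (Num.sqrt D)^-1.
have l2 : l ^+ 2 = D^-1 by rewrite exprVn sqr_sqrtr //; lra.
have Di0 : 0 < D^-1 by rewrite invr_gt0; lra.
have Di1 : D^-1 <= 1 by rewrite invf_le1; lra.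
have DD : D^-1 * D = 1 by rewrite mulVf // gt_eqF; lra.
exists p, (fun i => l%:C *: m i), (1 - D^-1 * (t / 2)); split.
- by move=> i; apply: subspaceZ => //; case: tM.
- by apply/andP; split; nra.
apply: positive_opnorm; [by nra|exact: row_defect_sa|move=> x].
have -> : complex.Re '[row_defect (fun i => l%:C *: m i) x, x] =
    hnorm x ^+ 2 - D^-1 * \sum_i hnorm (adj (m i) x) ^+ 2.
  rewrite bopB dotBl raddfB /= dotxx Re_row /= mulr_sumr; congr (_ - _).
  by apply: eq_bigr => i _; rewrite adjZr bopZ hnormZr exprMn real_normK ?num_real // l2.
have := low x; have := sumM m x; have x0 := sqr_ge0 (hnorm x).
set s := \sum_i hnorm _ ^+ 2 => h1 h2.
have h3 : D^-1 * s <= hnorm x ^+ 2.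
  rewrite mulrC ler_pdivrMr; last by lra.
  by apply: (le_trans h1); rewrite mulrC ler_wpM2l // /D lerDr.
by have h4 := ler_wpM2l (ltW Di0) h2; lra.
Qed.

End exact_units.

(** This is (1 + e/2)^2 (1 - e) = 1 - (3/4) e^2 - (1/4) e^3. Pairing with vectors turns the powers
    of e into scalars, and only 2a = 1 is used about a. *)
Lemma newton_identity (R : realType) (K : hilbertType R) (e : 'B(K)) :
  let a := (2^-1)%:C in
  bid K - (bid K + a *: e) ** (bid K - e) ** (bid K + a *: e) =
  (3 / 4)%:C *: (e ** e) + (4^-1)%:C *: (e ** e ** e).
Proof.
move=> a; apply: bop_ext => x; apply: dot_inj => y.
have h z : (bid K + a *: e) z = z + a *: e z by [].
have h' z : (bid K - e) z = z - e z by [].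
have cE (S T : 'B(K)) z : (S ** T) z = S (T z) by [].
rewrite bopB bopD !bopZ !cE h !h' h !(linearD e, linearB e, linearZ_LR e).
rewrite /= ?(linearD e, linearN e, linearB e, linearZ_LR e) !(dotDl, dotBl, dotNl, dotZl).
move: '[e x, y] '[e (e x), y] '[e (e (e x)), y] '[x, y] => u v w t.
have -> : (3 / 4)%:C = 3 * a * a :> R[i].
  by rewrite /a; apply/eqP; rewrite eq_complex /=; apply/andP; split; apply/eqP; field.
have -> : (4^-1)%:C = a * a :> R[i].
  by rewrite /a; apply/eqP; rewrite eq_complex /=; apply/andP; split; apply/eqP; field.
have a2 : 2 * a = 1.
  by rewrite /a; apply/eqP; rewrite eq_complex /=; apply/andP; split; apply/eqP; field.
have a3 : 3 * a * a = 2 * a * (2 * a) - a * a by ring.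
have {}a3 : 3 * a * a = 2 * a - a * a by rewrite a3 {1}a2 mul1r.
rewrite a3.
transitivity ((1 - 2 * a) * u + (2 * a - a * a) * v + a * a * w); first by ring.
by rewrite {1}a2 subrr mul0r add0r.
Qed.

Section exact_units_limit.
Context {R : realType} {H K : hilbertType R} {M : set 'B(H, K)}.
Hypothesis tM : is_tro M.
Let N := closure M.
Hypothesis unitM : cspan (prod_set M (adj_set M)) (bid K).

(* Newton's iteration for the polar decomposition: it turns the defect e into
   3/4 e^2 + 1/4 e^3. *)
Definition newton_step p (r : 'I_p -> 'B(H, K)) : 'I_p -> 'B(H, K) :=
  fun i => r i + (2^-1)%:C *: (row_defect r ** r i).

Lemma newton_defect p (r : 'I_p -> 'B(H, K)) :
  row_defect (newton_step r) = (3 / 4)%:C *: (row_defect r ** row_defect r) +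
    (4^-1)%:C *: (row_defect r ** row_defect r ** row_defect r).
Proof.
have sa := row_defect_sa r.
have : \sum_i r i ** adj (r i) = bid K - row_defect r by rewrite opprB addrC subrK.
set e := row_defect r in sa *; pose a : R[i] := (2^-1)%:C => rr.
have -> : row_defect (newton_step r) =
    bid K - (bid K + a *: e) ** (bid K - e) ** (bid K + a *: e).
  rewrite /row_defect -rr bcomp_sumr bcomp_suml; congr (_ - _); apply: eq_bigr => i _.
  rewrite /newton_step -/e -/a adjD adjZr adj_comp sa.
  have -> : r i + a *: (e ** r i) = (bid K + a *: e) ** r i.
    by rewrite bcompDl bcomp1l bcompZl.
  have -> : adj (r i) + a *: (adj (r i) ** e) = adj (r i) ** (bid K + a *: e).
    by rewrite bcompDr bcomp1r bcompZr.
  by rewrite !bcompA.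
exact: newton_identity.
Qed.

Lemma newton_step_closure p (r : 'I_p -> 'B(H, K)) :
  (forall i, N (r i)) -> forall i, N (newton_step r i).
Proof.
move=> Nr i; have sN := tro_closure_subspace tM.
apply: (subspaceD sN); first exact: Nr.
apply: (subspaceZ sN); rewrite bcompBl bcomp1l bcomp_suml; apply: (subspaceB sN); first exact: Nr.
by apply: (subspace_sum sN) => j _; exact: (tro_mul3 tM (Nr j) (Nr j) (Nr i)).
Qed.

Lemma exact_row : exists p (r : 'I_p -> 'B(H, K)),
  (forall i, N (r i)) /\ \sum_i r i ** adj (r i) = bid K.
Proof.
have [p [r0 [q [Mr0 /andP[q0 q1] rq]]]] := initial_row tM unitM.
pose r k := iter k (@newton_step p) r0.
have Nr k i : N (r k i).
  elim: k i => [|k IH] i; first exact: subset_closure.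
  exact: newton_step_closure.
(* Convergence is quadratic, but geometric decay suffices: |e|^2 and |e|^3 are both at most q
   q^(k+1), and the weights 3/4 and 1/4 add up to 1. *)
have rk k : opnorm (row_defect (r k)) <= q ^+ k.+1.
  elim: k => [|k IH]; first by rewrite expr1.
  rewrite [r _]iterS newton_defect -/(r k); set e := row_defect (r k) in IH *.
  have qk : q ^+ k.+1 <= q by rewrite exprS ler_piMr // exprn_ile1 // ltW.
  have e0 := opnorm_ge0 e; have e1 : opnorm e <= q by apply: le_trans qk.
  have h2 : opnorm (e ** e) <= opnorm e ^+ 2 by exact: opnorm_comp.
  have h3 : opnorm (e ** e ** e) <= opnorm e ^+ 2.
    apply: (le_trans (opnorm_comp _ _)); apply: (@le_trans _ _ (opnorm (e ** e) * 1)).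
      by rewrite ler_wpM2l ?opnorm_ge0 //; lra.
    by rewrite mulr1.
  rewrite -hnorm_bop (le_trans (hnormD _ _)) // !hnormZr !ger0_norm ?invr_ge0 ?divr_ge0 //.
  rewrite !hnorm_bop.
  have h4 : opnorm e ^+ 2 <= q * q ^+ k.+1 by rewrite expr2 ler_pM.
  by rewrite (exprS _ k.+1); lra.
(* The increment is e_k r_k / 2, and [row_bound] cancels the factor 1/2. *)
have rc i : cauchy_sequence (fun k => r k i).
  apply: (@geometric_cauchy _ _ _ 1 q) => // [|k]; first by rewrite q0.
  rewrite {1}/r iterS -/(r k) /newton_step (addrC (r k i)) addrK hnormZr mul1r.
  have k1 : opnorm (row_defect (r k)) <= 1.
    by rewrite (le_trans (rk k)) // exprn_ile1 // ltW.
  have := row_bound i k1; have := opnorm_comp (row_defect (r k)) (r k i).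
  rewrite hnorm_bop ger0_norm ?invr_ge0 // => h1 h2.
  have h3 : opnorm (row_defect (r k)) * opnorm (r k i) <= q ^+ k.+1 * 2.
    by rewrite ler_pM ?opnorm_ge0.
  have h4 : q ^+ k.+1 <= q ^+ k by rewrite exprS ler_piMl ?exprn_ge0 // ltW.
  by lra.
have /choice[s rs] : forall i, exists l : 'B(H, K), (fun k => r k i) @ \oo --> l.
  by move=> i; exact: bop_complete.
exists p, s; split=> [i|]; first by apply: closed_seq (rs i) => //; exact: closed_closure.
apply/esym/eqP; rewrite -subr_eq0; apply/eqP.
apply: (@cvg_unique_norm _ _ (fun k => row_defect (r k))).
  apply: cvgB; first exact: cvg_cst.
  apply: cvg_bigsum => i; apply: cvg_bcomp => //; exact: cvg_adj.
apply: (@hnorm_cvg_bound _ _ _ _ (fun k => q ^+ k)) => [e e0|k].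
  have : GRing.exp q @ \oo --> (0 : R) by apply: cvg_expr; rewrite ger0_norm.
  move=> /cvgrPdist_le/(_ _ e0)[n _ nq]; exists n => k /nq.
  by rewrite /= sub0r normrN ger0_norm // exprn_ge0.
by rewrite sub0r hnormN hnorm_bop (le_trans (rk k)) // exprS ler_piMl ?exprn_ge0 // ltW.
Qed.

(* Neumann series: if e is the defect of (d, b) then b_i + e^* n_i has defect e0 e. *)
Lemma exact_pair : exists p (d b : 'I_p -> 'B(H, K)),
  [/\ forall i, M (d i), forall i, N (b i) & \sum_i d i ** adj (b i) = bid K].
Proof.
have [|p [m [n [Mm Mn mn]]]] := approximate_unit tM unitM (e := 2^-1).
  by rewrite invr_gt0.
pose e (b : 'I_p -> 'B(H, K)) := bid K - \sum_i m i ** adj (b i).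
pose step (b : 'I_p -> 'B(H, K)) i := b i + adj (e b) ** n i.
pose b k := iter k step n.
have sN := tro_closure_subspace tM.
have Nm i : N (m i) by exact: subset_closure.
have Nn i : N (n i) by exact: subset_closure.
have Nb k i : N (b k i).
  elim: k i => [//|k IH] i; rewrite /b iterS -/(b k).
  apply: (subspaceD sN); first exact: IH.
  rewrite /e adjB adj_bid adj_sum bcompBl bcomp1l.
  apply: (subspaceB sN); first exact: Nn.
  rewrite bcomp_suml.
  apply: (subspace_sum sN) => j _; rewrite adj_comp adjK.
  exact: (tro_mul3 tM (IH j) (Nm j) (Nn i)).
have eS k : e (b k.+1) = e n ** e (b k).
  rewrite {1}/b iterS -/(b k) [in LHS]/e.
  under eq_bigr => i _ do rewrite /step adjD bcompDr adj_comp adjK bcompA.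
  rewrite big_split /= opprD addrA -/(e (b k)) -bcomp_suml.
  by rewrite {2}/e bcompBl bcomp1l.
have ek k : opnorm (e (b k)) <= 2^-1 ^+ k.+1.
  elim: k => [|k IH]; first by rewrite expr1.
  rewrite eS (le_trans (opnorm_comp _ _)) // (exprS _ k.+1).
  by rewrite ler_pM ?opnorm_ge0.
have h2 : 0 <= (2^-1 : R) < 1 by apply/andP; split; lra.
have /choice[s bs] : forall i, exists l : 'B(H, K), (fun k => b k i) @ \oo --> l.
  move=> i; apply: bop_complete.
  apply: (@geometric_cauchy _ _ _ (opnorm (n i)) 2^-1) => // [|k]; first exact: opnorm_ge0.
  rewrite {1}/b iterS -/(b k) /step (addrC (b k i)) addrK hnorm_bop.
  rewrite (le_trans (opnorm_comp _ _)) // mulrC ler_wpM2l ?opnorm_ge0 // opnorm_adj.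
  rewrite (le_trans (ek k)) // exprS ler_piMl ?exprn_ge0 ?invr_ge0 //; lra.
exists p, m, s; split=> // [i|].
  by apply: closed_seq (bs i) => //; exact: closed_closure.
apply/esym/eqP; rewrite -subr_eq0; apply/eqP.
apply: (@cvg_unique_norm _ _ (fun k => e (b k))).
  apply: cvgB; first exact: cvg_cst.
  apply: cvg_bigsum => i; apply: cvg_bcomp; [exact: cvg_cst|exact: cvg_adj].
apply: (@hnorm_cvg_bound _ _ _ _ (fun k => 2^-1 ^+ k)) => [d d0|k].
  have : GRing.exp (2^-1) @ \oo --> (0 : R) by apply: cvg_expr; rewrite ger0_norm; lra.
  move=> /cvgrPdist_le/(_ _ d0)[n' _ nq]; exists n' => k /nq.
  by rewrite /= sub0r normrN ger0_norm // exprn_ge0 // invr_ge0.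
rewrite sub0r hnormN hnorm_bop (le_trans (ek k)) // exprS ler_piMl ?exprn_ge0 ?invr_ge0 //; lra.
Qed.

End exact_units_limit.

(** * Induced objects *)

Lemma dot_cspan0 (R : realType) (V : hilbertType R) (D : set V) y :
  cspan D = setT -> (forall x, D x -> '[x, y] = 0) -> y = 0.
Proof.
move=> DT Dy; have Dy' x : lspan D x -> '[x, y] = 0.
  apply: (@lspan_min _ _ D [set x | '[x, y] = 0]) => //; split; first exact: dot0l.
  by move=> a u v /= u0 v0; rewrite dotDl dotZl u0 v0 mulr0 addr0.
have [y0|y0] := eqVneq (hnorm y) 0; first exact: hnorm0_eq0.
have yp : 0 < hnorm y / 2 by rewrite divr_gt0 // lt_neqAle eq_sym y0 hnorm_ge0.
have : closure (lspan D : set V) y by rewrite -/(cspan D) DT.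
move=> /closure_approx/(_ _ yp)[z /Dy' zy yz].
have := Re_cauchy_schwarz (y - z) y; rewrite dotBl zy subr0 dotxx /= => h.
have {}yz := ler_wpM2r (hnorm_ge0 y) yz; clear DT Dy Dy' zy; exfalso; nra.
Qed.

Section adapted_theory.
Context {R : realType} {S T : opsys R}.
Context {ES : injective_envelope S} {ET : injective_envelope T}.
Context {H K : hilbertType R} {alpha : S -> 'B(H)} {beta : T -> 'B(K)}.
Context {M : set 'B(H, K)}.

(** The symmetry of the situation: statements about T or G are those about S or F for M^*. *)
Lemma adapted_adj : adapted ES ET alpha beta M -> adapted ET ES beta alpha (adj_set M).
Proof.
move=> [[ca cb] [ga gb] [tM [u1 u2] ST TS] mA mB].
split=> //; [|by rewrite adj_setK|by rewrite adj_setK].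
by split; [exact: is_tro_adj | split | |]; rewrite adj_setK.
Qed.

Hypothesis hM : adapted ES ET alpha beta M.

Lemma ad_tro : is_tro M.
Proof. by case: hM => _ _ []. Qed.

Lemma ad_unitH : cspan (prod_set (adj_set M) M) (bid H).
Proof. by case: hM => _ _ [_ []]. Qed.

Lemma ad_unitK : cspan (prod_set M (adj_set M)) (bid K).
Proof. by case: hM => _ _ [_ []]. Qed.

Lemma ad_modelS : faithful_model (E := ES) alpha (cspan (prod_set (adj_set M) M)).
Proof. by case: hM => [[ca cb] [ga gb] _ mA mB]; split=> // a; apply: tro_A_adj. Qed.

Lemma ad_tro_conj x t y : closure M x -> closure (range beta) t -> closure M y ->
  closure (range alpha) (adj x ** t ** y).
Proof.
move=> /closure_seq[u uM ux] /closure_seq[v vM vy] /closure_seq[w wM wz].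
apply: (closed_seq (@closed_closure _ _) _ (cvg_bcomp (cvg_bcomp (cvg_adj ux) vy) wz)) => n.
case: hM => _ _ [_ _ ST _] _ _; apply: ST.
exists (adj (u n) ** v n); last by exists (w n).
by exists (adj (u n)); [exists (u n)|exists (v n)].
Qed.

Lemma ad_row : exists p (r : 'I_p -> 'B(H, K)),
  (forall i, closure M (r i)) /\ \sum_i r i ** adj (r i) = bid K.
Proof. exact: exact_row ad_tro ad_unitK. Qed.

End adapted_theory.

Section adapted_sym.
Context {R : realType} {S T : opsys R}.
Context {ES : injective_envelope S} {ET : injective_envelope T}.
Context {H K : hilbertType R} {alpha : S -> 'B(H)} {beta : T -> 'B(K)}.
Context {M : set 'B(H, K)}.
Hypothesis hM : adapted ES ET alpha beta M.

Lemma ad_modelT : faithful_model (E := ET) beta (cspan (prod_set M (adj_set M))).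
Proof. by have := ad_modelS (adapted_adj hM); rewrite adj_setK. Qed.

Lemma ad_tro_conj' x s y : closure M x -> closure (range alpha) s -> closure M y ->
  closure (range beta) (x ** s ** adj y).
Proof.
move=> /closure_adj_set Mx ss /closure_adj_set My.
by have := ad_tro_conj (adapted_adj hM) Mx ss My; rewrite adjK.
Qed.

Lemma ad_col : exists p (c : 'I_p -> 'B(H, K)),
  (forall i, closure M (c i)) /\ \sum_i adj (c i) ** c i = bid H.
Proof.
have [p [r [Mr rr]]] := ad_row (adapted_adj hM).
exists p, (fun i => adj (r i)); split=> [i|]; first exact: closure_adj_setE.
by rewrite -[RHS]rr; apply: eq_bigr => i _; rewrite adjK.
Qed.

Section induced_map.
Let N := closure M.
Let A := cspan (prod_set (adj_set M) M).
Let cS := closure (range alpha).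
Let cT := closure (range beta).
Let fmS := ad_modelS hM.
Let fmT := ad_modelT.

(* The properties of the map [nu] of an induced object, extended by continuity
   to the closure of [M] and to the closures of the operator systems. *)
Record induced_map (X : crep ES) (Y : crep ET)
    (nu : 'B(H, K) -> 'B(rep_space X, rep_space Y)) : Prop := InducedMap {
  im_inner : forall a b, N a -> N b ->
    adj (nu b) ** nu a = hat alpha X (adj b ** a) ;
  im_rep : forall a b t, N a -> N b -> cT t ->
    adj (nu b) ** hat beta Y t ** nu a = hat alpha X (adj b ** t ** a) ;
  im_total : forall y, (forall a x, N a -> '[nu a x, y] = 0) -> y = 0 }.

Section theory.
Context {X : crep ES} {Y : crep ET}.
Context {nu : 'B(H, K) -> 'B(rep_space X, rep_space Y)}.
Hypothesis im : induced_map nu.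

Lemma ad_algebra_closure : A `<=` cS.
Proof. exact: cs_A fmS. Qed.

(** An operator into the space of Y is determined by its products with all nu(b)^*. Linearity of
    [nu] and its module properties are therefore consequences of the inner product formulas and need
    not be part of [induced_map]. *)
Lemma im_faithful (L : hilbertType R) (Z Z' : 'B(L, rep_space Y)) :
  (forall b, N b -> adj (nu b) ** Z = adj (nu b) ** Z') -> Z = Z'.
Proof.
move=> ZZ'; apply/eqP; rewrite -subr_eq0; apply/eqP/bop_ext => x; rewrite bop0.
apply: (im_total im) => a y Na; rewrite dot_adj.
have -> : adj (nu a) ((Z - Z') x) = (adj (nu a) ** (Z - Z')) x by [].
by rewrite bcompBr ZZ' // subrr bop0 dotC dot0l rmorph0.
Qed.

Lemma im_faithful2 (Z Z' : 'B(rep_space Y)) :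
  (forall a b, N a -> N b -> adj (nu b) ** Z ** nu a = adj (nu b) ** Z' ** nu a) -> Z = Z'.
Proof.
move=> ZZ'; have h a : N a -> Z ** nu a = Z' ** nu a.
  by move=> Na; apply: im_faithful => b Nb; rewrite !bcompA; exact: ZZ'.
rewrite -[Z]adjK -[Z']adjK; congr adj; apply: im_faithful => a Na.
by rewrite -!adj_comp h.
Qed.

Lemma im_mulr x a : N x -> A a -> nu (x ** a) = nu x ** hat alpha X a.
Proof.
move=> Nx Aa; have Nxa := tro_mulr (ad_tro hM) Nx Aa.
apply: im_faithful => b Nb; rewrite bcompA !(im_inner im) // bcompA.
by rewrite (hat_mulr fmS) //; apply: ad_algebra_closure; exact: tro_left.
Qed.

Lemma im_lin c x y : N x -> N y -> nu (c *: x + y) = c *: nu x + nu y.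
Proof.
move=> Nx Ny; have Nxy := (tro_closure_subspace (ad_tro hM)).2 c x y Nx Ny.
apply: im_faithful => b Nb; rewrite bcompDr bcompZr !(im_inner im) // bcompDr bcompZr.
by rewrite (hat_lin fmS) //; apply: ad_algebra_closure; exact: tro_left.
Qed.

Lemma im_bound x : N x -> opnorm (nu x) <= opnorm x.
Proof.
move=> Nx; rewrite -ler_sqr ?nnegrE ?opnorm_ge0 //.
rewrite (le_trans (sqr_opnorm_le _)) // (im_inner im) //.
rewrite (le_trans (hat_bound fmS _ _)) //; first by apply: ad_algebra_closure; exact: tro_left.
by rewrite (le_trans (opnorm_comp _ _)) // opnorm_adj.
Qed.

Lemma im_cvg (u : nat -> 'B(H, K)) x : (forall n, N (u n)) -> u @ \oo --> x ->
  (fun n => nu (u n)) @ \oo --> nu x.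
Proof.
move=> Nu ux; have Nx : N x by apply: closed_seq Nu ux; exact: closed_closure.
have sN := tro_closure_subspace (ad_tro hM).
move/hnorm_cvgP : ux => ux; apply/hnorm_cvgP => e /ux[n un]; exists n => k /un.
apply: le_trans; have := im_bound (subspaceB sN Nx (Nu k)).
have -> // : nu (x - u k) = nu x - nu (u k).
by rewrite -scaleN1r addrC im_lin // scaleN1r addrC.
Qed.

(** Between nu(b)^* and nu(a) the left side becomes sum phi(b^* r_i) phi(r_i^* a) = phi(b^* r r^* a)
    = phi(b^* a), because phi is multiplicative on [M^* M]. *)
Lemma im_row p (r : 'I_p -> 'B(H, K)) : (forall i, N (r i)) ->
  \sum_i r i ** adj (r i) = bid K -> \sum_i nu (r i) ** adj (nu (r i)) = bid (rep_space Y).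
Proof.
move=> Nr rr; apply: im_faithful2 => a b Na Nb.
rewrite bcomp1r (im_inner im) // bcomp_sumr bcomp_suml.
have -> : adj b ** a = \sum_i (adj b ** r i) ** (adj (r i) ** a).
  rewrite -[in LHS](bcomp1r (adj b)) -rr bcomp_sumr bcomp_suml.
  by apply: eq_bigr => i _; rewrite !bcompA.
have Abr i := tro_left Nb (Nr i); have Ara i := tro_left (Nr i) Na.
rewrite (hat_sum fmS) => [|i _]; last exact: (cs_mull fmS (Abr i) (ad_algebra_closure (Ara i))).
apply: eq_bigr => i _; rewrite (hat_mull fmS _ (Abr i) (ad_algebra_closure (Ara i))).
by rewrite -!(im_inner im) // !bcompA.
Qed.

(** Between nu(b)^* and nu(a) both sides are phi(b^* m s n^* a): the factors b^* m and n^* a are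
    multipliers and can be pulled out of phi. *)
Lemma im_conj m n s : N m -> N n -> cS s ->
  hat beta Y (m ** s ** adj n) = nu m ** hat alpha X s ** adj (nu n).
Proof.
move=> Nm Nn Ss; apply: im_faithful2 => a b Na Nb.
rewrite (im_rep im) //; last exact: ad_tro_conj'.
rewrite !bcompA (im_inner im) // -[RHS]bcompA (im_inner im) //.
have Abm := tro_left Nb Nm; have Ana := tro_left Nn Na.
rewrite -(hat_mull fmS) // -(hat_mulr fmS) //; last exact: (cs_mull fmS).
by rewrite !bcompA.
Qed.

End theory.

Section from_object.
Context {X : crep ES} {Y : crep ET} {nu : M -> 'B(rep_space X, rep_space Y)}.
Hypothesis io : induced_object alpha beta nu.

Definition nu_ext : 'B(H, K) -> 'B(rep_space X, rep_space Y) := ext val nu.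

Lemma set_val_mem (m : M) : M (val m).
Proof. exact/set_mem/valP. Qed.

Lemma val_closure (m : M) : N (val m).
Proof. by apply: subset_closure; exact: set_val_mem. Qed.
Arguments val_closure : clear implicits.

Lemma nu_inner (a b : M) : adj (nu b) ** nu a = hat alpha X (adj (val b) ** val a).
Proof.
have [s _ sE] := fm_sub fmS (tro_left (val_closure b) (val_closure a)).
apply: bop_ext => x; apply: dot_inj => y.
have [_ _ inner _ _] := io.
by rewrite [in LHS]/= adj_dot (inner _ _ _ _ _ sE) -sE (hatE fmS).
Qed.

(** The bound is |nu(m)|^2 <= |phi(m^* m)| <= |m|^2. *)
Lemma nu_bounded_graph : bounded_graph (val : M -> 'B(H, K)) nu 1.
Proof.
have [lnu _ _ _ _] := io; have [M0 MD] : linear_subspace M by case: (ad_tro hM).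
split=> // [|c m n|m|u]; last exact: bop_complete.
- pose z : M := SigSub (mem_set M0); exists z; split=> //.
  have := lnu 1 z z z; rewrite /= scaler0 addr0 scale1r => /(_ erefl) /eqP.
  by rewrite -subr_eq0 opprD addNKr oppr_eq0 => /eqP.
- pose k : M := SigSub (mem_set (MD c _ _ (set_val_mem m) (set_val_mem n))).
  by exists k; split=> //; exact: lnu.
- rewrite mul1r !hnorm_bop -ler_sqr ?nnegrE ?opnorm_ge0 //.
  rewrite (le_trans (sqr_opnorm_le _)) // nu_inner.
  rewrite (le_trans (hat_bound fmS _ _)) //.
    by apply: ad_algebra_closure; apply: tro_left; exact: val_closure.
  by rewrite (le_trans (opnorm_comp _ _)) // opnorm_adj.
Qed.

Lemma nu_extE m : nu_ext (val m) = nu m.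
Proof. exact: ext_fun nu_bounded_graph m. Qed.

Lemma N_seq x : N x -> exists2 u : nat -> M, (fun n => val (u n)) @ \oo --> x &
  (fun n => nu (u n)) @ \oo --> nu_ext x.
Proof.
move=> /closure_seq[v vM vx].
exists (fun n => SigSub (mem_set (vM n)) : M) => //.
under eq_fun => n do rewrite -nu_extE.
apply: (ext_cvg nu_bounded_graph) => // n; rewrite range_val.
by apply: subset_closure; exact: vM.
Qed.

Lemma induced_map_ext : induced_map nu_ext.
Proof.
have [_ _ _ tot rep] := io; split.
- move=> a b /N_seq[u ua nua] /N_seq[v vb nvb].
  apply: (cvg_unique_norm (cvg_bcomp (cvg_adj nvb) nua)).
  under eq_fun => n do rewrite nu_inner.
  apply: (hat_cvg fmS) => [n|]; last by apply: cvg_bcomp => //; exact: cvg_adj.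
  by apply: ad_algebra_closure; apply: tro_left; exact: val_closure.
- move=> a b t /N_seq[u ua nua] /N_seq[v vb nvb] /closure_seq[w wT wt].
  have hw : (fun n => hat beta Y (w n)) @ \oo --> hat beta Y t.
    by apply: (hat_cvg fmT) => // n; apply: subset_closure; exact: wT.
  apply: (cvg_unique_norm (cvg_bcomp (cvg_bcomp (cvg_adj nvb) hw) nua)).
  rewrite (_ : (fun n => _) = fun n => hat alpha X (adj (val (v n)) ** w n ** val (u n))).
    apply: (hat_cvg fmS) => [n|]; last by do 2?[apply: cvg_bcomp => //]; exact: cvg_adj.
    by apply: (ad_tro_conj hM); [exact: val_closure|apply: subset_closure; exact: wT|exact: val_closure].
  apply/funext => n; have [t' _ <-] := wT n; rewrite (hatE fmT).
  apply: bop_ext => x; apply: dot_inj => y.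
  have gr : extends alpha (adj (val (v n)) ** beta t' ** val (u n))
      (hat alpha X (adj (val (v n)) ** beta t' ** val (u n))); last first.
    by rewrite [in LHS]/= adj_dot (rep _ _ _ _ _ _ gr).
  apply: (hat_graph fmS); apply: (ad_tro_conj hM); [exact: val_closure| |exact: val_closure].
  by apply: subset_closure; exists t'.
- move=> y yN; apply: (dot_cspan0 tot) => _ [m _ [x _ <-]].
  by rewrite -nu_extE yN //; exact: val_closure.
Qed.

End from_object.
End induced_map.
End adapted_sym.
Arguments induced_map {R S T ES ET H K} alpha beta M {X Y} nu.

(** * Completely bounded maps and induced morphisms *)

Section vector_norm.
Context {R : realType} {H : hilbertType R} {n : nat}.
Implicit Types x y : 'I_n -> H.

Lemma sqr_vnorm x : vnorm x ^+ 2 = \sum_i hnorm (x i) ^+ 2.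
Proof. by rewrite sqr_sqrtr // sumr_ge0 // => i _; exact: sqr_ge0. Qed.

Lemma vnorm0 : vnorm (fun _ : 'I_n => 0 : H) = 0.
Proof. by rewrite /vnorm big1 ?sqrtr0 // => i _; rewrite hnorm0 expr0n. Qed.

Lemma vnorm_eq0 x : vnorm x = 0 -> x = fun=> 0.
Proof.
move=> x0; apply/funext => i; apply: hnorm_le0.
by rewrite (le_trans (hnorm_le_vnorm x i)) // x0.
Qed.

Lemma sqr_vnormD x y :
  vnorm (fun i => x i + y i) ^+ 2 =
  vnorm x ^+ 2 + vnorm y ^+ 2 + 2 * \sum_i complex.Re '[x i, y i].
Proof.
rewrite !sqr_vnorm mulr_sumr -!big_split /=; apply: eq_bigr => i _.
by rewrite sqr_hnormD.
Qed.

Lemma vnormZa (a : R[i]) x : vnorm (fun i => a *: x i) = complex.Re `|a| * vnorm x.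
Proof.
have a0 : 0 <= complex.Re `|a| by rewrite normc_def /= sqrtr_ge0.
apply/eqP; rewrite -(eqrXn2 (n := 2)) ?vnorm_ge0 ?mulr_ge0 ?vnorm_ge0 //.
rewrite exprMn !sqr_vnorm mulr_sumr; apply/eqP; apply: eq_bigr => i _.
by rewrite hnormZ exprMn.
Qed.

Lemma vnorm_cauchy_schwarz x y :
  \sum_i complex.Re '[x i, y i] <= vnorm x * vnorm y.
Proof.
have [x0|x0] := eqVneq (vnorm x) 0.
  by rewrite x0 mul0r (vnorm_eq0 x0) big1 // => i _; rewrite dot0l.
have [y0|y0] := eqVneq (vnorm y) 0.
  by rewrite y0 mulr0 (vnorm_eq0 y0) big1 // => i _; rewrite Re_dotC dot0l.
have xy : 0 < vnorm x * vnorm y.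
  by rewrite mulr_gt0 // lt_neqAle eq_sym ?x0 ?y0 vnorm_ge0.
rewrite -(ler_pM2l xy); have := sqr_ge0 (vnorm (fun i => (vnorm y)%:C *: x i + (- vnorm x)%:C *: y i)).
rewrite sqr_vnormD !vnormZa !normc_def /= expr0n !addr0 !sqrtr_sqr normrN.
rewrite !ger0_norm ?vnorm_ge0 //.
under eq_bigr => i _ do rewrite dotZl dotZr conjC_real mulrA -rmorphM ReM_real.
rewrite -mulr_sumr.
set u := vnorm x; set v := vnorm y; set w := \sum_i _ => h; nra.
Qed.

Lemma vnormD x y : vnorm (fun i => x i + y i) <= vnorm x + vnorm y.
Proof.
rewrite -ler_sqr ?nnegrE ?addr_ge0 ?vnorm_ge0 // sqr_vnormD.
have := vnorm_cauchy_schwarz x y.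
by move: (vnorm x) (vnorm y) (\sum_i _) => u v w; nra.
Qed.

Lemma vnorm_le_sum x : vnorm x <= \sum_i hnorm (x i).
Proof.
have s0 (P : pred 'I_n) : 0 <= \sum_(i | P i) hnorm (x i).
  by apply: sumr_ge0 => i _; exact: hnorm_ge0.
rewrite -ler_sqr ?nnegrE ?vnorm_ge0 // sqr_vnorm.
suff [] : 0 <= \sum_i hnorm (x i) /\
  \sum_i hnorm (x i) ^+ 2 <= (\sum_i hnorm (x i)) ^+ 2 by [].
elim/big_rec2 : _ => [|i a b _ [a0 ba]]; first by rewrite expr0n.
have x0 := hnorm_ge0 (x i); split; first exact: addr_ge0.
by nra.
Qed.

End vector_norm.

Section matrix_norm.
Context {R : realType}.
Implicit Types H K : hilbertType R.

Lemma mxnorm_ge0 H K n (X : 'M['B(H, K)]_n) : 0 <= mxnorm X.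
Proof.
apply: (le_trans (vnorm_ge0 (mxact X (fun=> 0)))); apply: mxnorm_ge.
by rewrite vnorm0.
Qed.

Lemma mxact_le H K n (X : 'M['B(H, K)]_n) xi :
  vnorm (mxact X xi) <= mxnorm X * vnorm xi.
Proof.
have [x0|x0] := eqVneq (vnorm xi) 0.
  rewrite x0 mulr0 (vnorm_eq0 x0) (_ : mxact X _ = fun=> 0) ?vnorm0 //.
  by apply/funext => i; rewrite /mxact big1 // => j _; rewrite linear0.
have xp : 0 < vnorm xi by rewrite lt_neqAle eq_sym x0 vnorm_ge0.
pose a := (vnorm xi)^-1; have a0 : 0 <= a by rewrite invr_ge0 vnorm_ge0.
have := @mxnorm_ge _ _ _ _ X (fun i => a%:C *: xi i).
rewrite vnormZ // mulVf // => /(_ (lexx _)).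
have -> : mxact X (fun i => a%:C *: xi i) = fun i => a%:C *: mxact X xi i.
  apply/funext => i; rewrite /mxact scaler_sumr; apply: eq_bigr => j _.
  exact: linearZ_LR.
by rewrite vnormZ // mulrC ler_pdivrMr.
Qed.

Lemma mxnorm_bound H K n (X : 'M['B(H, K)]_n) (c : R) : 0 <= c ->
  (forall xi, vnorm (mxact X xi) <= c * vnorm xi) -> mxnorm X <= c.
Proof. by move=> c0 h; apply: mxnorm_le => xi x1; rewrite (le_trans (h xi)) // ler_piMr. Qed.

(** A crude entrywise estimate; it is enough for approximating a matrix of fixed size entry by
    entry. *)
Lemma mxnorm_perturb H K n (X Y : 'M['B(H, K)]_n) :
  mxnorm X <= mxnorm Y + \sum_i \sum_j opnorm (X i j - Y i j).
Proof.
have s0 : 0 <= \sum_i \sum_j opnorm (X i j - Y i j).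
  by do 2 apply: sumr_ge0 => ? _; exact: opnorm_ge0.
apply: mxnorm_bound => [|xi]; first by rewrite addr_ge0 ?mxnorm_ge0.
have -> : mxact X xi = fun i => mxact Y xi i + \sum_j (X i j - Y i j) (xi j).
  apply/funext => i; rewrite /mxact -big_split; apply: eq_bigr => j _.
  by rewrite bopB /= addrC subrK.
rewrite (le_trans (vnormD _ _)) // mulrDl lerD ?mxact_le //.
rewrite (le_trans (vnorm_le_sum _)) // mulr_suml ler_sum // => i _.
rewrite (le_trans (hnorm_sum _ _ _)) // mulr_suml ler_sum // => j _.
rewrite (le_trans (le_opnorm _ _)) // ler_wpM2l ?opnorm_ge0 //.
exact: hnorm_le_vnorm.
Qed.

Lemma vnorm1 H (x : 'I_1 -> H) : vnorm x = hnorm (x ord0).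
Proof. by rewrite /vnorm big_ord1 sqrtr_sqr ger0_norm // hnorm_ge0. Qed.

Lemma mxnorm1 H K (T : 'B(H, K)) : mxnorm (const_mx T : 'M['B(H, K)]_1) = opnorm T.
Proof.
apply/eqP; rewrite eq_le; apply/andP; split.
  apply: mxnorm_bound => [|xi]; first exact: opnorm_ge0.
  by rewrite !vnorm1 /mxact big_ord1 mxE le_opnorm.
apply: opnorm_bound => [|x]; first exact: mxnorm_ge0.
have := mxact_le (const_mx T : 'M['B(H, K)]_1) (fun=> x).
by rewrite !vnorm1 /mxact big_ord1 mxE.
Qed.

Section completely_bounded_extension.
Context {H K : hilbertType R} {A : set 'B(H)} {f : A -> 'B(K)} {c : R}.
Hypotheses (sA : linear_subspace A) (lf : linear_on f).
Hypotheses (c0 : 0 <= c) (fc : (cb_norm f <= c%:E)%E).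

Lemma cb_bound n (X : 'M[A]_n) : mxnorm (map_mx f X) <= c * mxnorm (map_mx val X).
Proof.
apply/ler_addgt0Pr => e e0.
(* [cb_norm_bound] needs a positive t while the norm of the matrix may vanish; the surplus e/(c+1)
   costs at most e. *)
have d0 : 0 < e / (c + 1) by rewrite divr_gt0 // ltr_wpDl.
have t0 : 0 < mxnorm (map_mx val X) + e / (c + 1) by rewrite ltr_wpDl ?mxnorm_ge0.
have /= := cb_norm_bound sA lf fc t0 (X := X); rewrite lerDl ltW // => /(_ isT) h.
apply: (le_trans h); rewrite mulrDl (mulrC c) lerD2l mulrAC ler_pdivrMr ?ltr_wpDl //.
by rewrite ler_wpM2l ?lerDl // ltW.
Qed.

Lemma cb_bounded_graph : bounded_graph (val : A -> 'B(H)) f c.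
Proof.
have memA (x : A) : A (val x) by exact/set_mem/valP.
split=> // [|a x y|x|u]; last exact: bop_complete.
- pose z : A := SigSub (mem_set sA.1); exists z; split=> //.
  have := lf (a := 1) (x := z) (y := z) (z := z).
  rewrite /= scaler0 addr0 scale1r => /(_ erefl) /eqP.
  by rewrite -subr_eq0 opprD addNKr oppr_eq0 => /eqP.
- pose k : A := SigSub (mem_set (sA.2 a _ _ (memA x) (memA y))).
  by exists k; split=> //; exact: lf.
- have := cb_bound (const_mx x : 'M[A]_1); rewrite !map_const_mx.
  by rewrite !hnorm_bop !mxnorm1.
Qed.

Definition cb_ext : 'B(H) -> 'B(K) := ext val f.

Lemma cb_ext_bound n (Z : 'M['B(H)]_n) : (forall i j, closure A (Z i j)) ->
  mxnorm (map_mx cb_ext Z) <= c * mxnorm Z.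
Proof.
move=> AZ; apply/ler_addgt0Pr => e e0.
pose k : R := \sum_(i < n) \sum_(j < n) 1.
have k0 : 0 <= k by do 2 apply: sumr_ge0 => ? _.
(* Here k = n^2. The entrywise error d enters twice, through the norm of the approximating matrix
   and through the extension, each time as c k d; the summand 1 keeps the denominator positive. *)
pose d := e / (2 * c * k + 1).
have ck0 : 0 <= c * k by rewrite mulr_ge0.
have k1 : 0 < 2 * c * k + 1 by rewrite -mulrA; lra.
have d0 : 0 < d by rewrite divr_gt0.
have dk : d * (2 * c * k + 1) = e by rewrite /d divfK // gt_eqF.
have /choice[X XP] : forall p : 'I_n * 'I_n, exists x : A, hnorm (Z p.1 p.2 - val x) <= d.
  move=> p; have [x Ax xd] := closure_approx (AZ p.1 p.2) d0.
  by exists (SigSub (mem_set Ax)).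
pose Y : 'M[A]_n := \matrix_(i, j) X (i, j).
have h1 : mxnorm (map_mx val Y) <= mxnorm Z + k * d.
  rewrite (le_trans (mxnorm_perturb _ Z)) // lerD2l /k mulr_suml ler_sum // => i _.
  rewrite mulr_suml ler_sum // => j _; rewrite !mxE mul1r -hnorm_bop hnormBC.
  exact: (XP (i, j)).
have h2 : mxnorm (map_mx cb_ext Z) <= mxnorm (map_mx f Y) + k * (c * d).
  rewrite (le_trans (mxnorm_perturb _ (map_mx f Y))) // lerD2l.
  rewrite /k mulr_suml ler_sum // => i _; rewrite mulr_suml ler_sum // => j _.
  rewrite !mxE mul1r -(ext_fun cb_bounded_graph) -hnorm_bop -(extB cb_bounded_graph).
  - rewrite (le_trans (ext_bound cb_bounded_graph _)) //.
      rewrite range_val; apply: (subspaceB (closure_subspace sA)) => //.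
      by apply: subset_closure; exact/set_mem/valP.
    by rewrite ler_wpM2l // (XP (i, j)).
  - by rewrite range_val.
  - by apply: subset_closure; exists (X (i, j)).
have := cb_bound Y => h3; have := ler_wpM2l c0 h1 => h4.
apply: (le_trans h2); apply: (le_trans (lerD (le_trans h3 h4) (lexx _))).
by rewrite -dk; lra.
Qed.

End completely_bounded_extension.
Arguments cb_ext {H K A} f _.
End matrix_norm.
Arguments cb_ext {R H K A} f _.

Section amplification.
Context {R : realType} {L L' : hilbertType R} {n p : nat}.
Variable w : 'I_p -> 'B(L, L').
Hypothesis ww : \sum_a w a ** adj (w a) = bid L'.

Let I := ('I_n * 'I_p)%type.
Let q := #|{: I}|.

(** The adjoint of the diagonal amplification of the row w, an isometry since w w^* = 1; [amp_adj]
    is the amplification itself. Pairs (i, a) are flattened by enumeration because [mxnorm] takes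
    matrices indexed by ordinals. *)
Definition amp (x : 'I_n -> L') : 'I_q -> L :=
  fun k => adj (w (enum_val k).2) (x (enum_val k).1).

Definition amp_adj (y : 'I_q -> L) : 'I_n -> L' :=
  fun i => \sum_a w a (y (enum_rank (i, a))).

Lemma sum_amp (V : nmodType) (F : I -> V) :
  \sum_(k < q) F (enum_val k) = \sum_i \sum_a F (i, a).
Proof.
rewrite -(big_enum_val (A := {: I}) F) /= pair_big /=.
by apply: eq_bigr => -[].
Qed.

Lemma vnorm_amp x : vnorm (amp x) = vnorm x.
Proof.
apply/eqP; rewrite -(eqrXn2 (n := 2)) ?vnorm_ge0 // !sqr_vnorm; apply/eqP.
rewrite (sum_amp (fun k => hnorm (adj (w k.2) (x k.1)) ^+ 2)) /=.
apply: eq_bigr => i _; rewrite sqr_hnorm.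
have -> : '[x i, x i] = '[(\sum_a w a ** adj (w a)) (x i), x i] by rewrite ww.
rewrite bop_sum dot_suml raddf_sum; apply: eq_bigr => a _.
by rewrite sqr_hnorm_op adjK.
Qed.

(** With V the amplified row and V^* isometric, |V y|^2 = Re <y, V^* V y> <= |y| |V y|. *)
Lemma vnorm_amp_adj y : vnorm (amp_adj y) <= vnorm y.
Proof.
pose z := amp (amp_adj y).
have h : \sum_k complex.Re '[y k, z k] = vnorm (amp_adj y) ^+ 2.
  rewrite sqr_vnorm.
  transitivity (\sum_(k < q) complex.Re '[y (enum_rank (enum_val k)),
      adj (w (enum_val k).2) (amp_adj y (enum_val k).1)]).
    by apply: eq_bigr => k _; rewrite enum_valK.
  rewrite (sum_amp (fun k => complex.Re '[y (enum_rank k), adj (w k.2) (amp_adj y k.1)])).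
  apply: eq_bigr => i _; rewrite sqr_hnorm {3}/amp_adj dot_suml raddf_sum.
  by apply: eq_bigr => a _; rewrite /= dot_adj.
have := vnorm_cauchy_schwarz y z; rewrite h /z vnorm_amp.
have [->|x0] := eqVneq (vnorm (amp_adj y)) 0; first by rewrite vnorm_ge0.
by rewrite expr2 ler_pM2r // lt_neqAle eq_sym x0 vnorm_ge0.
Qed.

End amplification.

Section representation_morphisms.
Context {R : realType} {S : opsys R} {E : injective_envelope S}.
Context {H : hilbertType R} {alpha : S -> 'B(H)} {A : set 'B(H)}.
Hypothesis fm : faithful_model (E := E) alpha A.
Implicit Types X Y Z : crep E.

Definition rh_ext X Y (Phi : rep_hom X Y) : 'B(rep_space X) -> 'B(rep_space Y) :=
  cb_ext (fun x => val (Phi x)).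

Lemma rh_bounded_graph X Y (Phi : rep_hom X Y) : exists c,
  bounded_graph (val : rep_img X -> 'B(rep_space X)) (fun x => val (Phi x)) c.
Proof.
have [c c0 Pc] := completely_boundedP (rh_cb Phi); exists c.
exact: (cb_bounded_graph (rep_img_subspace X) (rh_linear Phi) (ltW c0) Pc).
Qed.

Lemma rh_extE X Y (Phi : rep_hom X Y) x : rh_ext Phi (val x) = val (Phi x).
Proof. have [c h] := rh_bounded_graph Phi; exact: ext_fun h x. Qed.

Lemma rh_ext_eq X Y (Phi : rep_hom X Y) x y :
  closure [set (val x, val (Phi x)) | x in [set: rep_img X]] (x, y) -> rh_ext Phi x = y.
Proof. have [c h] := rh_bounded_graph Phi; exact: ext_eq h x y. Qed.

Lemma rh_ext_sum X Y (Phi : rep_hom X Y) J (s : seq J) (P : pred J) (x : J -> 'B(rep_space X)) :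
  (forall j, P j -> closure (rep_img X) (x j)) ->
  rh_ext Phi (\sum_(j <- s | P j) x j) = \sum_(j <- s | P j) rh_ext Phi (x j).
Proof.
have [c h] := rh_bounded_graph Phi; move=> xi; apply: (ext_sum h) => j Pj.
by rewrite range_val; exact: xi.
Qed.

Lemma rh_ext_lin X Y (Phi : rep_hom X Y) a x y :
  closure (rep_img X) x -> closure (rep_img X) y ->
  rh_ext Phi (a *: x + y) = a *: rh_ext Phi x + rh_ext Phi y.
Proof.
have [c h] := rh_bounded_graph Phi; move=> xi yi.
by apply: (ext_lin h); rewrite range_val.
Qed.

Lemma rh_ext_cvg X Y (Phi : rep_hom X Y) (u : nat -> 'B(rep_space X)) (x : 'B(rep_space X)) :
  (forall n, closure (rep_img X) (u n)) -> u @ \oo --> x ->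
  (fun n => rh_ext Phi (u n)) @ \oo --> rh_ext Phi x.
Proof.
have [c h] := rh_bounded_graph Phi; move=> ui ux.
by apply: (ext_cvg h) => // n; rewrite range_val; exact: ui.
Qed.

Lemma hat_img X x : closure (range alpha) x -> closure (rep_img X) (hat alpha X x).
Proof.
move=> /closure_seq[u us ux].
have us' n : closure (range alpha) (u n) by apply: subset_closure; exact: us.
apply: (seq_closure _ (hat_cvg fm us' ux)) => n.
by have [s _ <-] := us n; rewrite (hatE fm); exists s.
Qed.

Lemma img_mul X a b x : A a -> A b -> rep_img X x ->
  rep_img X (hat alpha X a ** x ** hat alpha X b).
Proof.
move=> Aa Ab [s _ <-]; have [u ua uX] := range_mul fm s Aa.
have [v _ vb] := range_mulr fm u Ab.
exists v => //; rewrite -(hatE fm) vb (hat_mulr fm) ?(hatE fm) ?uX //.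
by apply: subset_closure; exists u.
Qed.

Lemma img_mul_closure X a b x : A a -> A b -> closure (rep_img X) x ->
  closure (rep_img X) (hat alpha X a ** x ** hat alpha X b).
Proof.
move=> Aa Ab /closure_seq[u us ux].
apply: (seq_closure _ (cvg_bcomp (cvg_bcomp (cvg_cst (hat alpha X a)) ux)
  (cvg_cst (hat alpha X b)))) => n.
exact: img_mul.
Qed.

Lemma rh_ext_bimod X Y (Phi : rep_hom X Y) a b x : A a -> A b ->
  closure (rep_img X) x ->
  rh_ext Phi (hat alpha X a ** x ** hat alpha X b) =
  hat alpha Y a ** rh_ext Phi x ** hat alpha Y b.
Proof.
move=> Aa Ab /closure_seq[u us ux].
have us' n : closure (rep_img X) (u n) by apply: subset_closure; exact: us.
pose f n := hat alpha X a ** u n ** hat alpha X b.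
have fx : f @ \oo --> hat alpha X a ** x ** hat alpha X b.
  by apply: cvg_bcomp; [apply: cvg_bcomp; [exact: cvg_cst|exact: ux]|exact: cvg_cst].
have h1 := rh_ext_cvg (Phi := Phi) (fun n => img_mul_closure Aa Ab (us' n)) fx.
apply: (cvg_unique_norm h1).
rewrite (_ : (fun n => _) = fun n => hat alpha Y a ** rh_ext Phi (u n) ** hat alpha Y b).
  by apply: cvg_bcomp; [apply: cvg_bcomp; [exact: cvg_cst|exact: rh_ext_cvg]|exact: cvg_cst].
apply/funext => n; rewrite /f.
have [a' a'E a'a] : (alpha @` multipliers E) a by rewrite (fm_mult fm).
have [b' b'E b'b] : (alpha @` multipliers E) b by rewrite (fm_mult fm).
rewrite -a'a -b'b !(hatE fm).
pose y : rep_img X := SigSub (mem_set (us n)).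
have yn : rep_img X (rep_map X a' ** u n ** rep_map X b').
  by have := img_mul Aa Ab (us n); rewrite -a'a -b'b !(hatE fm).
pose z : rep_img X := SigSub (mem_set yn).
rewrite -[u n]/(val y) -[rep_map X a' ** _ ** _]/(val z) !rh_extE.
by rewrite (rh_bimod Phi (a := a') (b := b') (x := y)).
Qed.

End representation_morphisms.

Section induced_morphism.
Context {R : realType} {S T : opsys R}.
Context {ES : injective_envelope S} {ET : injective_envelope T}.
Context {H K : hilbertType R} {alpha : S -> 'B(H)} {beta : T -> 'B(K)}.
Context {M : set 'B(H, K)}.
Hypothesis hM : adapted ES ET alpha beta M.
Let N := closure M.
Let cS := closure (range alpha).
Let cT := closure (range beta).
Let fmS := ad_modelS hM.
Let fmT := ad_modelT hM.

Lemma im_img (X : crep ES) (Y : crep ET) nu a b y : induced_map alpha beta M (X := X) (Y := Y) nu ->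
  N a -> N b -> closure (rep_img Y) y ->
  closure (rep_img X) (adj (nu b) ** y ** nu a).
Proof.
move=> im Na Nb /closure_seq[u uT uy].
have h : (fun n => adj (nu b) ** u n ** nu a) @ \oo --> adj (nu b) ** y ** nu a.
  by apply: cvg_bcomp; [apply: cvg_bcomp; [exact: cvg_cst|exact: uy]|exact: cvg_cst].
apply: (closed_seq (@closed_closure _ _) _ h) => n.
have [t _ <-] := uT n; rewrite -(hatE fmT).
have tT : cT (beta t) by apply: subset_closure; exists t.
rewrite (im_rep im) //; apply: (hat_img fmS); exact: (ad_tro_conj hM).
Qed.

Context {X1 X2 : crep ES} {Y1 Y2 : crep ET}.
Context {nu1 : 'B(H, K) -> 'B(rep_space X1, rep_space Y1)}.
Context {nu2 : 'B(H, K) -> 'B(rep_space X2, rep_space Y2)}.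
Hypothesis im1 : induced_map alpha beta M nu1.
Hypothesis im2 : induced_map alpha beta M nu2.
Context {p : nat} {r : 'I_p -> 'B(H, K)}.
Hypothesis (Nr : forall i, N (r i)) (rr : \sum_i r i ** adj (r i) = bid K).
Variable Phi : rep_hom X1 X2.

(* For a row [r] with r r^* = 1 this is the value at [Phi] of the induced functor. *)
Definition theta (y : 'B(rep_space Y1)) : 'B(rep_space Y2) :=
  \sum_i \sum_j nu2 (r i) ** rh_ext Phi (adj (nu1 (r i)) ** y ** nu1 (r j)) **
    adj (nu2 (r j)).

Lemma row_expand (y : 'B(rep_space Y1)) :
  y = \sum_i \sum_j nu1 (r i) ** (adj (nu1 (r i)) ** y ** nu1 (r j)) ** adj (nu1 (r j)).
Proof.
have h := im_row hM im1 Nr rr.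
rewrite -{1}[y]bcomp1l -h -{1}[_ ** y]bcomp1r -h bcomp_suml.
rewrite [LHS]bcomp_suml; apply: eq_bigr => i _.
by rewrite bcomp_sumr; apply: eq_bigr => j _; rewrite !bcompA.
Qed.

(** The products nu1(r_i)^* nu1(m) = phi1(r_i^* m) are images of multipliers, so they pass through
    [Phi] and reappear as nu2(r_i)^* nu2(m); the row relation for nu2 then eliminates r. In
    particular the value does not depend on the row. *)
Lemma theta_conj m n s : N m -> N n -> cS s ->
  theta (nu1 m ** hat alpha X1 s ** adj (nu1 n)) =
  nu2 m ** rh_ext Phi (hat alpha X1 s) ** adj (nu2 n).
Proof.
move=> Nm Nn Ss; have h := im_row hM im2 Nr rr.
rewrite -[in RHS](bcomp1l (nu2 m)) -[in RHS](bcomp1r (adj (nu2 n))) -h.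
rewrite bcomp_suml !bcomp_suml; apply: eq_bigr => i _.
rewrite !bcomp_sumr; apply: eq_bigr => j _.
rewrite -![in RHS]bcompA [in RHS](bcompA (adj (nu2 (r i)))) (im_inner im2 Nm (@Nr i)).
rewrite [in RHS](bcompA (adj (nu2 n))) (im_inner im2 (@Nr j) Nn).
rewrite -![in LHS]bcompA [in LHS](bcompA (adj (nu1 (r i)))) (im_inner im1 Nm (@Nr i)).
rewrite [in LHS](im_inner im1 (@Nr j) Nn) ![in LHS]bcompA.
rewrite (rh_ext_bimod fmS Phi (tro_left (@Nr i) Nm) (tro_left Nn (@Nr j)) (hat_img fmS Ss)).
by rewrite !bcompA.
Qed.

Section uniqueness.
Variable Theta : rep_hom Y1 Y2.
Hypothesis ThetaE : forall (m n : 'B(H, K)) (s : S), M m -> M n ->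
  closure [set (val y, val (Theta y)) | y in [set: rep_img Y1]]
    (nu1 n ** rep_map X1 s ** adj (nu1 m),
     nu2 n ** val (Phi (to_img X1 s)) ** adj (nu2 m)).

Lemma morphism_conj m n s : N m -> N n -> cS s ->
  rh_ext Theta (nu1 n ** hat alpha X1 s ** adj (nu1 m)) =
  nu2 n ** rh_ext Phi (hat alpha X1 s) ** adj (nu2 m).
Proof.
move=> /closure_seq[u uM um] /closure_seq[v vM vn] /closure_seq[w wS ws].
have Nu k : N (u k) by apply: subset_closure; exact: uM.
have Nv k : N (v k) by apply: subset_closure; exact: vM.
have Sw k : cS (w k) by apply: subset_closure; exact: wS.
have nu1u := im_cvg hM im1 Nu um; have nu2u := im_cvg hM im2 Nu um.
have nu1v := im_cvg hM im1 Nv vn; have nu2v := im_cvg hM im2 Nv vn.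
have hw := hat_cvg fmS (X := X1) Sw ws.
have Phiw := rh_ext_cvg (Phi := Phi) (fun k => hat_img fmS (X := X1) (Sw k)) hw.
have c1 : (fun k => nu1 (v k) ** hat alpha X1 (w k) ** adj (nu1 (u k))) @ \oo -->
    nu1 n ** hat alpha X1 s ** adj (nu1 m).
  by apply: cvg_bcomp; [exact: cvg_bcomp|exact: cvg_adj].
have c2 : (fun k => nu2 (v k) ** rh_ext Phi (hat alpha X1 (w k)) ** adj (nu2 (u k))) @ \oo -->
    nu2 n ** rh_ext Phi (hat alpha X1 s) ** adj (nu2 m).
  by apply: cvg_bcomp; [exact: cvg_bcomp|exact: cvg_adj].
apply: rh_ext_eq.
apply: (closed_seq_pair (@closed_closure _ _) _ c1 c2) => k.
have [s' _ s'E] := wS k; rewrite -s'E (hatE fmS).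
rewrite (_ : rep_map X1 s' = val (to_img X1 s')) // rh_extE.
exact: ThetaE.
Qed.

(** Uniqueness: [ThetaE] prescribes the morphism only on conjugates, and [row_expand] writes y as a
    finite sum of conjugates. The summands lie in the closure of the image, hence the detour through
    [rh_ext Theta]. *)
Lemma morphism_theta y : val (Theta y) = theta (val y).
Proof.
rewrite -rh_extE {1}[val y]row_expand.
have [t _ ty] : rep_img Y1 (val y) by exact/set_mem/valP.
have yE i j : adj (nu1 (r i)) ** val y ** nu1 (r j) =
    hat alpha X1 (adj (r i) ** beta t ** r j).
  by rewrite -ty -(hatE fmT) (im_rep im1 (@Nr j) (@Nr i) (subset_closure (imageT beta t))).
have sr i j : cS (adj (r i) ** beta t ** r j).
  exact: (ad_tro_conj hM (@Nr i) (subset_closure (imageT beta t)) (@Nr j)).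
have img i j : closure (rep_img Y1) (nu1 (r i) **
    hat alpha X1 (adj (r i) ** beta t ** r j) ** adj (nu1 (r j))).
  rewrite -(im_conj hM im1 (@Nr i) (@Nr j) (@sr i j)); apply: (hat_img fmT).
  exact: (ad_tro_conj' hM (@Nr i) (@sr i j) (@Nr j)).
rewrite (rh_ext_sum Theta) => [|i _]; last first.
  apply: subspace_sum => [|j _]; first exact/closure_subspace/rep_img_subspace.
  by rewrite yE; exact: img.
apply: eq_bigr => i _; rewrite (rh_ext_sum Theta) => [|j _]; last by rewrite yE.
by apply: eq_bigr => j _; rewrite yE morphism_conj.
Qed.

End uniqueness.

(** The matrix with entries nu1(r_a)^* Y_ij nu1(r_b) is the conjugate of Y by the amplified row of
    X1, so its norm is at most that of Y. The extension of [Phi] is applied to its np x np entries,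
    and the result is compressed by the amplified row of X2. *)
Lemma theta_bound (c : R) n (Y : 'M['B(rep_space Y1)]_n) : 0 <= c ->
  (rep_cb_norm Phi <= c%:E)%E -> (forall i j, closure (rep_img Y1) (Y i j)) ->
  mxnorm (map_mx theta Y) <= c * mxnorm Y.
Proof.
move=> c0 Pc YI; have h1 := im_row hM im1 Nr rr; have h2 := im_row hM im2 Nr rr.
pose I := ('I_n * 'I_p)%type.
pose Z : 'M['B(rep_space X1)]_#|{: I}| := \matrix_(k, l)
  (adj (nu1 (r (enum_val k).2)) ** Y (enum_val k).1 (enum_val l).1 ** nu1 (r (enum_val l).2)).
have ZI k l : closure (rep_img X1) (Z k l) by rewrite mxE; apply: im_img.
have ZY : mxnorm Z <= mxnorm Y.
  apply: mxnorm_bound => [|eta]; first exact: mxnorm_ge0.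
  have -> : mxact Z eta = amp (nu1 \o r) (mxact Y (amp_adj (nu1 \o r) eta)).
    apply/funext => k; rewrite /amp /mxact /= linear_sum /=.
    transitivity (\sum_(l < #|{: I}|) adj (nu1 (r (enum_val k).2))
      (Y (enum_val k).1 (enum_val l).1 (nu1 (r (enum_val l).2) (eta (enum_rank (enum_val l)))))).
      by apply: eq_bigr => l _; rewrite mxE enum_valK.
    rewrite (sum_amp (fun l : I => adj (nu1 (r (enum_val k).2))
      (Y (enum_val k).1 l.1 (nu1 (r l.2) (eta (enum_rank l)))))).
    by apply: eq_bigr => j _; rewrite /amp_adj !linear_sum.
  rewrite vnorm_amp // (le_trans (mxact_le _ _)) // ler_wpM2l ?mxnorm_ge0 //.
  exact: vnorm_amp_adj.
apply: mxnorm_bound => [|xi]; first by rewrite mulr_ge0 ?mxnorm_ge0.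
have -> : mxact (map_mx theta Y) xi =
    amp_adj (nu2 \o r) (mxact (map_mx (rh_ext Phi) Z) (amp (nu2 \o r) xi)).
  apply/funext => i; rewrite /amp_adj /mxact /=.
  transitivity (\sum_j \sum_a \sum_b nu2 (r a)
     (rh_ext Phi (adj (nu1 (r a)) ** Y i j ** nu1 (r b)) (adj (nu2 (r b)) (xi j)))).
    apply: eq_bigr => j _; rewrite mxE /theta bop_sum; apply: eq_bigr => a _.
    by rewrite bop_sum.
  rewrite exchange_big /=; apply: eq_bigr => a _; rewrite linear_sum /=.
  pose F (l : I) := nu2 (r a) (rh_ext Phi (adj (nu1 (r a)) ** Y i l.1 ** nu1 (r l.2))
     (adj (nu2 (r l.2)) (xi l.1))).
  rewrite -(sum_amp F); apply: eq_bigr => l _.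
  by rewrite /F !mxE enum_rankK.
rewrite (le_trans (vnorm_amp_adj h2 _)) // (le_trans (mxact_le _ _)) // vnorm_amp //.
rewrite ler_wpM2r ?vnorm_ge0 //; apply: (@le_trans _ _ (c * mxnorm Z)).
  exact: (cb_ext_bound (rep_img_subspace X1) (rh_linear Phi) c0 Pc).
by rewrite ler_wpM2l.
Qed.

End induced_morphism.

(** * Unitary intertwiners as isomorphisms of representations *)

Section unitary_equivalence.
Context {R : realType} {S : opsys R} {E : injective_envelope S}.

Lemma vnorm_isometry (L L' : hilbertType R) (V : 'B(L, L')) n (x : 'I_n -> L) :
  adj V ** V = bid L -> vnorm (fun i => V (x i)) = vnorm x.
Proof.
move=> VV; congr Num.sqrt; apply: eq_bigr => i _.
by rewrite sqr_hnorm_op VV -sqr_hnorm.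
Qed.

Section conjugation.
Context {Z X : crep E} {V : 'B(rep_space X, rep_space Z)}.
Hypotheses (V1 : adj V ** V = bid _) (V2 : V ** adj V = bid _).
Hypothesis VE : forall s, adj V ** rep_map Z s ** V = rep_map X s.

Lemma conj_img_subproof (z : rep_img Z) : adj V ** val z ** V \in rep_img X.
Proof.
apply/mem_set; have [s _ <-] : rep_img Z (val z) by exact: set_mem (valP z).
by exists s.
Qed.

Definition conj_fun (z : rep_img Z) : rep_img X := SigSub (conj_img_subproof z).

Lemma conj_linear : linear_on (fun z => val (conj_fun z)).
Proof. by move=> a x y z /= ->; rewrite bcompDr bcompZr bcompDl bcompZl. Qed.

Lemma conj_cb : completely_bounded (fun z => val (conj_fun z)).
Proof.
apply: (@le_lt_trans _ _ 1%:E); last exact: ltry.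
apply: ge_ereal_sup => _ [n [Y [Y1 ->]]]; rewrite lee_fin.
apply: le_trans Y1; apply: mxnorm_bound => [|xi]; first exact: mxnorm_ge0.
have -> : mxact (map_mx (fun z => val (conj_fun z)) Y) xi =
    fun i => adj V (mxact (map_mx val Y) (fun j => V (xi j)) i).
  apply/funext => i; rewrite /mxact linear_sum; apply: eq_bigr => j _.
  by rewrite !mxE.
rewrite vnorm_isometry ?adjK // (le_trans (mxact_le _ _)) //.
by rewrite vnorm_isometry.
Qed.

Lemma conj_intertwine s : rep_map Z s ** V = V ** rep_map X s.
Proof. by rewrite -VE !bcompA V2 bcomp1l. Qed.

Lemma conj_intertwine_adj s : adj V ** rep_map Z s = rep_map X s ** adj V.
Proof. by rewrite -VE -!bcompA V2 bcomp1r. Qed.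

Lemma conj_bimod (a b : S) (x y : rep_img Z) :
  multipliers E a -> multipliers E b ->
  val y = rep_map Z a ** val x ** rep_map Z b ->
  val (conj_fun y) = rep_map X a ** val (conj_fun x) ** rep_map X b.
Proof.
move=> _ _ /= ->.
by rewrite !bcompA conj_intertwine_adj -!bcompA conj_intertwine.
Qed.

Definition conj_hom : rep_hom Z X := RepHom conj_linear conj_cb conj_bimod.

End conjugation.

Lemma conj_isomorphism (Z X : crep E) (V : 'B(rep_space X, rep_space Z))
  (V1 : adj V ** V = bid _) (V2 : V ** adj V = bid _)
  (VE : forall s, adj V ** rep_map Z s ** V = rep_map X s) :
  isomorphism (conj_hom V1 V2 VE : @hom (Rep E) Z X).
Proof.
have V1' : adj (adj V) ** adj V = bid _ by rewrite adjK.
have V2' : adj V ** adj (adj V) = bid _ by rewrite adjK.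
have VE' s : adj (adj V) ** rep_map X s ** adj V = rep_map Z s.
  by rewrite adjK -VE !bcompA V2 bcomp1l -bcompA V2 bcomp1r.
exists (conj_hom V1' V2' VE' : @hom (Rep E) X Z); split; apply: rep_hom_eq => x /=.
  by rewrite adjK !bcompA V2 bcomp1l -bcompA V2 bcomp1r.
by rewrite adjK !bcompA V1 bcomp1l -bcompA V1 bcomp1r.
Qed.

End unitary_equivalence.

Section induced_functor_maps.
Context {R : realType} {S T : opsys R}.
Context {ES : injective_envelope S} {ET : injective_envelope T}.
Context {H K : hilbertType R} {alpha : S -> 'B(H)} {beta : T -> 'B(K)}.
Context {M : set 'B(H, K)}.
Hypothesis hM : adapted ES ET alpha beta M.

Lemma induced_functor_maps (F : functor (Rep ES) (Rep ET)) :
  induced_functor alpha beta M F ->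
  exists nu : forall X : crep ES, 'B(H, K) -> 'B(rep_space X, rep_space (F X : crep ET)),
  (forall X, induced_map alpha beta M (nu X)) /\
  forall (X1 X2 : crep ES) (Phi : rep_hom X1 X2) (m n : 'B(H, K)) (s : S), M m -> M n ->
      closure [set (val y, val ((fmap F Phi : rep_hom (F X1 : crep ET) (F X2 : crep ET)) y))
                 | y in [set: rep_img (F X1 : crep ET)]]
        (nu X1 n ** rep_map X1 s ** adj (nu X1 m),
         nu X2 n ** val (Phi (to_img X1 s)) ** adj (nu X2 m)).
Proof.
move=> [nu [nuo nuF]]; exists (fun X => ext val (nu X)); split.
  by move=> X; exact: (induced_map_ext hM (nuo X)).
move=> X1 X2 Phi m n s Mm Mn.
have := nuF X1 X2 Phi (SigSub (mem_set Mm)) (SigSub (mem_set Mn)) s.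
by rewrite -!(nu_extE hM (nuo _)).
Qed.

End induced_functor_maps.

Section induced_functors.
Context {R : realType} {S T : opsys R}.
Context {ES : injective_envelope S} {ET : injective_envelope T}.
Context {H K : hilbertType R} {alpha : S -> 'B(H)} {beta : T -> 'B(K)}.
Context {M : set 'B(H, K)}.
Hypothesis hM : adapted ES ET alpha beta M.

Lemma rep_cb_normE (X Y : crep ES) (Phi : rep_hom X Y) :
  exists2 c : R, 0 <= c & rep_cb_norm Phi = c%:E.
Proof.
have := rh_cb Phi; rewrite /completely_bounded -/(rep_cb_norm Phi).
have : (0 <= rep_cb_norm Phi)%E.
  (* The empty matrix already shows that the supremum defining the cb-norm is nonnegative. *)
  pose Y0 : 'M[rep_img X]_0 := \matrix_(i, j) to_img X os_zero.
  apply: (@le_trans _ _ (mxnorm (map_mx (fun x => val (Phi x)) Y0))%:E).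
    by rewrite lee_fin mxnorm_ge0.
  apply: ereal_sup_ubound; exists 0%N, Y0; split=> //.
  apply: mxnorm_le => xi _; rewrite /vnorm big_ord0 sqrtr0; exact: ler01.
by case: (rep_cb_norm Phi) => [c|//|//]; exists c.
Qed.

Lemma induced_completely_contractive (F : functor (Rep ES) (Rep ET)) :
  induced_functor alpha beta M F -> completely_contractive F.
Proof.
move=> /(induced_functor_maps hM)[nu [im nuF]] X Y Phi.
have [p [r [Nr rr]]] := ad_row hM.
have [c c0 cE] := rep_cb_normE Phi.
rewrite cE; apply: ge_ereal_sup => _ [n [Z [Z1 ->]]]; rewrite lee_fin.
have -> : map_mx (fun x => val ((fmap F Phi : rep_hom (F X : crep ET) (F Y : crep ET)) x)) Z =
    map_mx (theta (nu1 := nu X) (nu2 := nu Y) (r := r) Phi) (map_mx val Z).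
  apply/matrixP => i j; rewrite !mxE.
  exact: (morphism_theta hM (im X) (im Y) Nr rr (nuF X Y Phi)).
rewrite (le_trans (theta_bound hM (im X) (im Y) Nr rr c0 _ _)) ?cE //.
  by move=> i j; rewrite mxE; apply: subset_closure; exact: (set_mem (valP (Z i j))).
by rewrite ler_piMr.
Qed.

(** * The natural unitary from a representation to its double transform *)

Section composition.
Variables (F : functor (Rep ES) (Rep ET)) (G : functor (Rep ET) (Rep ES)).
Hypotheses (iF : induced_functor alpha beta M F).
Hypotheses (iG : induced_functor beta alpha (adj_set M) G).

Let N := closure M.
Let cS := closure (range alpha).
Let cT := closure (range beta).
Let fmS := ad_modelS hM.
Let fmT := ad_modelT hM.
Let hM' := adapted_adj hM.

Section unitary.
Context {X : crep ES} {Y : crep ET} {Z : crep ES}.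
Context {nu : 'B(H, K) -> 'B(rep_space X, rep_space Y)}.
Context {mu : 'B(K, H) -> 'B(rep_space Y, rep_space Z)}.
Hypothesis imF : induced_map alpha beta M nu.
Hypothesis imG : induced_map beta alpha (adj_set M) mu.
Context {p : nat} {c : 'I_p -> 'B(H, K)}.
Hypothesis (Nc : forall i, N (c i)) (cc : \sum_i adj (c i) ** c i = bid H).

(** The map xi -> sum c_i^* (x) c_i (x) xi. Its adjoint is the canonical map m^* (x) n (x) xi ->
    phi(m^* n) xi, which shows that the choice of column is immaterial. *)
Definition compose_unitary : 'B(rep_space X, rep_space Z) :=
  \sum_i mu (adj (c i)) ** nu (c i).
Let W := compose_unitary.

Let Nc' i : closure (adj_set M) (adj (c i)).
Proof. exact: closure_adj_set (@Nc i). Qed.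

Lemma adj_compose_unitary : adj W = \sum_i adj (nu (c i)) ** adj (mu (adj (c i))).
Proof. by rewrite adj_sum; apply: eq_bigr => i _; rewrite adj_comp. Qed.

(** Applying [im_rep] for mu and then for nu turns the left side into sum phi(c_i^* c_i s c_j^* c_j)
    = phi(s). The case s = 1 is the isometry property. *)
Lemma compose_unitary_conj s : cS s ->
  adj W ** hat alpha Z s ** W = hat alpha X s.
Proof.
move=> Ss; rewrite adj_compose_unitary {1}/W /compose_unitary bcomp_suml bcomp_suml.
have -> : hat alpha X s = \sum_i \sum_j hat alpha X
    (adj (c i) ** (c i ** s ** adj (c j)) ** c j).
  have sE : s = \sum_i \sum_j adj (c i) ** (c i ** s ** adj (c j)) ** c j.
    rewrite -{1}[s]bcomp1l -cc -{1}[_ ** s]bcomp1r -cc bcomp_suml bcomp_suml.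
    by apply: eq_bigr => i _; rewrite bcomp_sumr; apply: eq_bigr => j _; rewrite !bcompA.
  have inS i j : cS (adj (c i) ** (c i ** s ** adj (c j)) ** c j).
    apply: (ad_tro_conj hM (@Nc i) _ (@Nc j)).
    exact: (ad_tro_conj' hM (@Nc i) Ss (@Nc j)).
  rewrite {1}sE (hat_sum fmS) => [|i _]; last first.
    by apply: subspace_sum => [|j _]; [exact: (cs_subspace fmS)|exact: inS].
  by apply: eq_bigr => i _; rewrite (hat_sum fmS) // => j _; exact: inS.
apply: eq_bigr => i _; rewrite bcomp_sumr; apply: eq_bigr => j _.
have inT := ad_tro_conj' hM (@Nc i) Ss (@Nc j).
rewrite -(im_rep imF (@Nc j) (@Nc i) inT).
have := im_rep imG (@Nc' j) (@Nc' i) Ss; rewrite adjK => <-.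
by rewrite !bcompA.
Qed.

Lemma compose_unitary_isometry : adj W ** W = bid _.
Proof.
have S1 : cS (bid H) by apply: (cs_A fmS); exact: ad_unitH hM.
by have := compose_unitary_conj S1; rewrite !(hat1 fmS) bcomp1r.
Qed.

(** Tested against the total family mu(m^* ) nu(n). By [h1] the adjoint of W sends it to phi(m^* n),
    and by [h2] W sends that back. *)
Lemma compose_unitary_coisometry : W ** adj W = bid _.
Proof.
have S1 : cS (bid H) by apply: (cs_A fmS); exact: ad_unitH hM.
have T1 : cT (bid K) by apply: (cs_A fmT); exact: ad_unitK hM.
apply: (im_faithful imG) => b /closure_adj_setE Nb.
apply: (im_faithful imF) => n Nn.
pose m := adj b; have Nm : N m by [].
have Nb' : closure (adj_set M) b by rewrite -[b]adjK; exact: closure_adj_set.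
have h1 : adj (nu n) ** adj (mu b) ** W = hat alpha X (adj n ** m).
  have AE : adj n ** m = \sum_j adj n ** (m ** adj (c j)) ** c j.
    rewrite -[LHS]bcomp1r -cc bcomp_sumr; apply: eq_bigr => j _.
    by rewrite !bcompA.
  have inT j : cT (m ** adj (c j)).
    by have := ad_tro_conj' hM Nm S1 (@Nc j); rewrite bcomp1r.
  rewrite AE (hat_sum fmS) => [|j _]; last exact: (ad_tro_conj hM Nn (@inT j) (@Nc j)).
  rewrite /W /compose_unitary bcomp_sumr; apply: eq_bigr => j _.
  rewrite -(im_rep imF (@Nc j) Nn (@inT j)) -(im_inner imG (@Nc' j) Nb').
  by rewrite !bcompA.
(* Here nu(c_i) nu(m)^* = psi(c_i m^* ) = mu(c_i^* )^* mu(m^* ), after which the row relation for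
   mu, with row c_i^*, removes the sum. *)
have h2 : W ** hat alpha X (adj m ** n) = mu b ** nu n.
  have <- := im_inner imF Nn Nm.
  rewrite -[RHS]bcomp1l.
  have Nc'' := @Nc'.
  have <- : \sum_i mu (adj (c i)) ** adj (mu (adj (c i))) = bid _.
    apply: (im_row hM' imG Nc'').
    by rewrite -[RHS]cc; apply: eq_bigr => i _; rewrite adjK.
  rewrite /W /compose_unitary !bcomp_suml; apply: eq_bigr => i _.
  have := im_conj hM imF (@Nc i) Nm S1; rewrite (hat1 fmS) !bcomp1r => cm.
  have := im_inner imG Nb' (@Nc' i); rewrite adjK => cb.
  rewrite !bcompA -[mu _ ** nu _ ** _]bcompA -cm /m adjK -cb !bcompA.
  by [].
rewrite bcomp1r !bcompA h1.
have -> : hat alpha X (adj n ** m) ** adj W = adj (W ** hat alpha X (adj m ** n)).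
  rewrite adj_comp -(hat_adj fmS); first by rewrite adj_comp adjK.
  by apply: (ad_algebra_closure hM); exact: tro_left.
by rewrite h2 adj_comp.
Qed.

End unitary.

Lemma compose_naturally_equivalent :
  naturally_equivalent (comp_functor G F) (id_functor (Rep ES)).
Proof.
have [nu [im nuF]] := induced_functor_maps hM iF.
have [mu [im' muG]] := induced_functor_maps hM' iG.
have [p [c [Nc cc]]] := ad_col hM.
pose W (X : crep ES) := compose_unitary (nu := nu X) (mu := mu (F X)) (c := c).
have W1 X := compose_unitary_isometry (im X) (im' (F X)) Nc cc.
have W2 X := compose_unitary_coisometry (im X) (im' (F X)) Nc cc.
have WE (X : crep ES) s : adj (W X) ** rep_map (G (F X) : crep ES) s ** W X = rep_map X s.
  have Ss : cS (alpha s) by apply: subset_closure; exists s.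
  by have := compose_unitary_conj (im X) (im' (F X)) Nc cc Ss; rewrite !(hatE fmS).
exists (fun X => conj_hom (W1 X) (W2 X) (WE X)); split.
  by move=> X; exact: conj_isomorphism.
move=> X1 X2 Phi; apply: rep_hom_eq => z.
have [s _ sz] : rep_img (G (F X1) : crep ES) (val z) by exact: set_mem (valP z).
have Ss : cS (alpha s) by apply: subset_closure; exists s.
have Nc' i : closure (adj_set M) (adj (c i)) by exact: closure_adj_set.
have cc' : \sum_i adj (c i) ** adj (adj (c i)) = bid H.
  by rewrite -[RHS]cc; apply: eq_bigr => i _; rewrite adjK.
(* The adjoints of the column entries form a row for M^*. In the [theta] formula for G with this row
   each middle term is a value of F(Phi) on a conjugate, and the double sum factors as W
   Phi(phi1(s)) W^*. Conjugating back by W gives naturality. *)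
have GF : val ((fmap G (fmap F Phi) : rep_hom (G (F X1) : crep ES) (G (F X2) : crep ES)) z) =
    W X2 ** val (Phi (to_img X1 s)) ** adj (W X2).
  rewrite (morphism_theta (adapted_adj hM) (im' (F X1)) (im' (F X2)) Nc' cc' (muG _ _ _)).
  rewrite adj_compose_unitary /W /compose_unitary /theta bcomp_suml bcomp_suml.
  apply: eq_bigr => i _; rewrite bcomp_sumr; apply: eq_bigr => j _.
  have -> : adj (mu (F X1) (adj (c i))) ** val z ** mu (F X1) (adj (c j)) =
      nu X1 (c i) ** hat alpha X1 (alpha s) ** adj (nu X1 (c j)).
    rewrite -(im_conj hM (im X1)) // -sz -(hatE fmS) (im_rep (im' (F X1))) ?adjK //.
  rewrite (morphism_conj hM (im X1) (im X2) (nuF _ _ _)) // (hatE fmS).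
  by rewrite -rh_extE !bcompA.
rewrite /= -/(W X2) -/(W X1).
transitivity (adj (W X2) ** (W X2 ** val (Phi (to_img X1 s)) ** adj (W X2)) ** W X2).
  by rewrite -GF.
rewrite !bcompA W1 bcomp1l -bcompA W1 bcomp1r; congr (val (Phi _)).
by apply/val_inj; rewrite /= -sz WE.
Qed.

End composition.
End induced_functors.

(** * Existence of the induced functors *)

(* The closed subspace {f | P f = f} of H^p.  For P_ij = phi (r_i^* r_j) with r a row
   such that r r^* = 1 it realizes the completion of M (x) H. *)
Section corner.
Context {R : realType} {H : hilbertType R} {p : nat}.
Variable P : 'I_p -> 'I_p -> 'B(H).

Definition corner_pred : {pred 'I_p -> H} :=
  [pred f | `[< forall i, \sum_j P i j (f j) = f i >]].

Lemma corner_submod : submod_closed corner_pred.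
Proof.
split=> [|a f g /asboolP fP /asboolP gP]; apply/asboolP => i.
  by rewrite big1 // => j _; exact: linear0.
rewrite -[RHS]/(a *: f i + g i) -fP -gP scaler_sumr -big_split /=.
by apply: eq_bigr => j _; rewrite -[(a *: f + g) j]/(a *: f j + g j) linearP.
Qed.

HB.instance Definition _ := GRing.isSubmodClosed.Build _ _ corner_pred corner_submod.

Record corner := Corner { corner_fun :> 'I_p -> H ; _ : corner_fun \in corner_pred }.

HB.instance Definition _ := [isSub for corner_fun].
HB.instance Definition _ := [Choice of corner by <:].
HB.instance Definition _ := [SubChoice_isSubLmodule of corner by <:].

Lemma cornerP (f : corner) i : \sum_j P i j (f j) = f i.
Proof. by case: f => f /= /asboolP. Qed.

Lemma corner_ext (f g : corner) : (forall i, f i = g i) -> f = g.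
Proof. by move=> fg; apply/val_inj/funext. Qed.

Lemma cornerD (f g : corner) i : (f + g) i = f i + g i.
Proof. by []. Qed.

Lemma cornerZ a (f : corner) i : (a *: f) i = a *: f i.
Proof. by []. Qed.

Lemma corner_sum I (s : seq I) (Q : pred I) (f : I -> corner) i :
  (\sum_(k <- s | Q k) f k) i = \sum_(k <- s | Q k) f k i.
Proof. by apply: (big_morph (fun g : corner => g i)). Qed.

Definition corner_norm (f : corner) : R[i] := (vnorm f)%:C.

Lemma corner_normD f g : corner_norm (f + g) <= corner_norm f + corner_norm g.
Proof. by rewrite -rmorphD lecR; exact: vnormD. Qed.

Lemma corner_normZ (a : R[i]) f : corner_norm (a *: f) = `|a| * corner_norm f.
Proof.
have ar : (complex.Re `|a|)%:C = `|a| by rewrite RRe_real // normr_real.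
by rewrite /corner_norm vnormZa rmorphM /= ar.
Qed.

Lemma corner_norm0_eq0 f : corner_norm f = 0 -> f = 0.
Proof. by move=> /(@complexI R)/vnorm_eq0 f0; apply: corner_ext => i; rewrite f0. Qed.

HB.instance Definition _ :=
  Lmodule_isNormed.Build R[i] corner corner_normD corner_normZ corner_norm0_eq0.

Lemma hnorm_corner (f : corner) : hnorm f = vnorm f.
Proof. by []. Qed.

(** Limits are taken coordinatewise; the equation P f = f survives because the finitely many P_ij
    are continuous. *)
Lemma corner_complete (F : set_system corner) : ProperFilter F -> cauchy F -> cvg F.
Proof.
move=> FF /cauchy_ballP Fc.
have Fi i : cvg ((fun f : corner => f i) @ F).
  apply/cauchy_cvgP/cauchy_ballP => e e0.
  have [[U V] [FU FV] UV] := Fc e e0.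
  exists ((fun f : corner => f i) @` U, (fun f : corner => f i) @` V).
    by split; [apply: filterS FU|apply: filterS FV] => f ?; exists f.
  move=> [_ _] [[f Uf <-] [g Vg <-]]; have := UV (f, g) (conj Uf Vg).
  rewrite -!ball_normE /ball_ /=; apply: le_lt_trans.
  rewrite -!hnormE lecR hnorm_corner; exact: (hnorm_le_vnorm (f - g) i).
pose l i := lim ((fun f : corner => f i) @ F).
have li i : (fun f : corner => f i) @ F --> l i by exact: Fi.
have lP : l \in corner_pred.
  apply/asboolP => i.
  have h : (fun f : corner => \sum_j P i j (f j)) @ F --> \sum_j P i j (l j).
    apply: cvg_bigsum => j.
    exact: (@continuous_cvg _ _ _ F FF (fun f : corner => f j) (P i j) _
      (@bop_continuous _ _ _ (P i j) (l j)) (li j)).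
  have {h} : (fun f : corner => f i) @ F --> \sum_j P i j (l j).
    rewrite (_ : (fun f : corner => f i) = (fun f : corner => \sum_j P i j (f j))) //.
    by apply/funext => f; rewrite cornerP.
  by move=> h; apply: (cvg_unique _ h (li i)); exact: norm_hausdorff.
apply/cvg_ex; exists (Corner lP); apply/cvgrPdist_le => e e0.
have er : (complex.Re e)%:C = e by rewrite RRe_real // gtr0_real.
have re0 : 0 < complex.Re e by rewrite -ltcR er.
(* The vector norm is at most the sum of p coordinate norms; p + 1 avoids a vanishing denominator
   when p = 0. *)
pose d := complex.Re e / p.+1%:R.
have d0 : 0 < d%:C by rewrite ltcR divr_gt0.
have : \forall f \near F, forall i, `|l i - (f : corner) i| <= d%:C.
  by apply: filter_forall => i; have /cvgrPdist_le := li i; exact.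
apply: filterS => f fd; rewrite -hnormE -er lecR hnorm_corner.
rewrite (le_trans (vnorm_le_sum _)) //; apply: (@le_trans _ _ (\sum_(i < p) d)).
  by apply: ler_sum => i _; rewrite -lecR hnormE; exact: fd.
rewrite sumr_const card_ord -mulr_natr /d -mulrA ler_piMr ?(ltW re0) //.
by rewrite mulrC ler_pdivrMr // mul1r ler_nat.
Qed.

HB.instance Definition _ := Uniform_isComplete.Build corner corner_complete.

Definition corner_dot (f g : corner) : R[i] := \sum_i '[f i, g i].

Lemma corner_dot_bilinear :
  bilinear_for
    (GRing.Scale.Law.clone _ _ ( *%R ) _) (GRing.Scale.Law.clone _ _ (Num.conj \; *%R ) _)
    (corner_dot : corner -> corner -> R[i]).
Proof.
split=> [g|f] a x y; rewrite /= /corner_dot mulr_sumr -big_split; apply: eq_bigr => i _.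
  by rewrite cornerD cornerZ dotDl dotZl.
by rewrite cornerD cornerZ dotDr dotZr.
Qed.

HB.instance Definition _ :=
  bilinear_isBilinear.Build R[i] corner corner R[i]
    (GRing.Scale.Law.clone _ _ ( *%R ) _) (GRing.Scale.Law.clone _ _ (Num.conj \; *%R ) _)
    corner_dot corner_dot_bilinear.

Lemma corner_dot_hermitian (f g : corner) :
  corner_dot f g = (-1) ^+ false * Num.conj (corner_dot g f).
Proof.
by rewrite expr0 mul1r rmorph_sum; apply: eq_bigr => i _; rewrite /= -dotC.
Qed.

HB.instance Definition _ :=
  isHermitianSesquilinear.Build R[i] corner false Num.conj corner_dot corner_dot_hermitian.

Lemma corner_dotxx f : corner_dot f f = (vnorm f ^+ 2)%:C.
Proof. by rewrite sqr_vnorm rmorph_sum; apply: eq_bigr => i _; rewrite dotxx. Qed.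

Lemma corner_dot_gt0 (f : corner) : f != 0 -> 0 < corner_dot f f.
Proof.
move=> f0; rewrite corner_dotxx ltcR exprn_gt0 // lt_neqAle vnorm_ge0 andbT eq_sym.
by apply: contra f0 => /eqP /vnorm_eq0 fE; apply/eqP/corner_ext => i; rewrite fE.
Qed.

HB.instance Definition _ := isDotProduct.Build R[i] corner corner_dot corner_dot_gt0.

Lemma corner_hdotE (f : corner) : corner_dot f f = `|f| ^+ 2.
Proof. by rewrite corner_dotxx rmorphXn. Qed.

HB.instance Definition _ := CompleteNormedModule_isHilbert.Build R corner corner_hdotE.

Lemma hdot_corner (f g : corner) : '[f, g] = \sum_i '[f i, g i].
Proof. by []. Qed.

Lemma corner_coord_subproof i :
  (fun f : corner => f i) \in @bounded_operator R corner H.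
Proof.
apply: (bounded_operatorP ler01) => // f.
by rewrite mul1r hnorm_corner hnorm_le_vnorm.
Qed.

Definition corner_coord i : 'B(corner, H) := Bop (corner_coord_subproof i).

Lemma corner_map_exists (L : hilbertType R) (U : 'I_p -> 'B(L, H)) :
  (forall i, \sum_j P i j ** U j = U i) ->
  exists V : 'B(L, corner), forall x i, V x i = U i x.
Proof.
move=> PU.
have inP x : (fun i => U i x) \in corner_pred.
  by apply/asboolP => i; rewrite -[in RHS]PU bop_sum.
have [|||V VE] := @bop_exists R L corner (fun x => Corner (inP x))
    (\sum_i opnorm (U i)).
- by apply: sumr_ge0 => i _; exact: opnorm_ge0.
- by move=> a x y; apply: corner_ext => i; rewrite /= linearP.
- move=> x; rewrite hnorm_corner (le_trans (vnorm_le_sum _)) // mulr_suml.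
  by apply: ler_sum => i _; exact: le_opnorm.
- by exists V => x i; rewrite VE.
Qed.

End corner.

Section induced_object_existence.
Context {R : realType} {S T : opsys R}.
Context {ES : injective_envelope S} {ET : injective_envelope T}.
Context {H K : hilbertType R} {alpha : S -> 'B(H)} {beta : T -> 'B(K)}.
Context {M : set 'B(H, K)}.
Hypothesis hM : adapted ES ET alpha beta M.
Let N := closure M.
Let cS := closure (range alpha).
Let cT := closure (range beta).
Let fmS := ad_modelS hM.
Let fmT := ad_modelT hM.

Lemma im_mull (X : crep ES) (Y : crep ET) nu b x :
  induced_map alpha beta M (X := X) (Y := Y) nu ->
  cspan (prod_set M (adj_set M)) b -> N x -> nu (b ** x) = hat beta Y b ** nu x.
Proof.
move=> im Bb Nx; apply: (im_faithful im) => c Nc.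
rewrite bcompA (im_inner im) ?(im_rep im) //; first by rewrite bcompA.
  exact: (cs_A fmT).
exact: (tro_mull (ad_tro hM)).
Qed.

Lemma induced_object_of_map (X : crep ES) (Y : crep ET) nu :
  induced_map alpha beta M (X := X) (Y := Y) nu ->
  induced_object alpha beta (fun m : M => nu (val m)).
Proof.
move=> im; split.
- by move=> a x y z ->; rewrite (im_lin hM im) //; exact: val_closure.
- move=> m n a aE ->; rewrite (im_mulr hM im) ?(hatE fmS) //; first exact: val_closure.
  exact: (fm_multE fmS).
- move=> a b s xi eta sE; rewrite -adj_dot -[adj _ _]/((adj (nu (val b)) ** nu (val a)) xi).
  by rewrite (im_inner im (@val_closure R H K M a) (@val_closure R H K M b)) -sE (hatE fmS).
(* Totality: each f is the finite sum of nu(r_i) applied to nu(r_i)^* f, and each r_i is a limit of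
   elements of M. *)
- have [p [r [Nr rr]]] := ad_row hM.
  apply/seteqP; split=> // f _.
  have -> : f = \sum_i nu (r i) (adj (nu (r i)) f).
    by rewrite -[LHS]/(bid _ f) -(im_row hM im Nr rr) bop_sum.
  apply: (subspace_sum (cspan_subspace _)) => i _.
  have [u uM ur] := closure_seq (Nr i).
  have Nu k : N (u k) by apply: subset_closure; exact: uM.
  have h := cvg_bop (x := adj (nu (r i)) f) (im_cvg hM im Nu ur).
  apply: (seq_closure _ h) => k; apply: sub_lspan.
  by exists (SigSub (mem_set (uM k))) => //; exists (adj (nu (r i)) f).
- move=> a b t xi eta y /(hat_eq fmS) <-.
  have tT : cT (beta t) by apply: subset_closure; exists t.
  rewrite -(im_rep im (@val_closure R H K M a) (@val_closure R H K M b) tT) (hatE fmT) [in RHS]/= adj_dot.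
  by [].
Qed.

(* Since [1 = sum_j d_j b_j^*] with [d_j] in [M], every element of the closure of
   [M] is a finite sum of elements [d_j a] with [a] in [M^* M]. *)
Lemma closure_conj_range :
  prod_set (prod_set (adj_set M) (range beta)) M `<=` range alpha ->
  forall x y t, N x -> N y -> range alpha (adj x ** beta t ** y).
Proof.
move=> inS x y t Nx Ny.
have [p [d [b [Md Nb db]]]] := exact_pair (ad_tro hM) (ad_unitK hM).
have bd : \sum_i b i ** adj (d i) = bid K.
  by rewrite -[RHS]adj_bid -db adj_sum; apply: eq_bigr => i _; rewrite adj_comp adjK.
have -> : adj x ** beta t ** y = \sum_i \sum_j
    (adj x ** b i) ** (adj (d i) ** beta t ** d j) ** (adj (b j) ** y).
  have e1 : adj x = \sum_i (adj x ** b i) ** adj (d i).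
    by rewrite -[LHS]bcomp1r -bd bcomp_sumr; apply: eq_bigr => i _; rewrite bcompA.
  have e2 : y = \sum_i d i ** (adj (b i) ** y).
    by rewrite -[LHS]bcomp1l -db bcomp_suml; apply: eq_bigr => i _; rewrite bcompA.
  rewrite [in LHS]e1 [in LHS]e2 bcomp_suml bcomp_suml; apply: eq_bigr => i _.
  by rewrite bcomp_sumr; apply: eq_bigr => j _; rewrite !bcompA.
have [lS _ _] := fm_coe fmS.
have sS : linear_subspace (range alpha).
  split; first by exists os_zero => //; rewrite os_f0.
  by move=> c _ _ [s _ <-] [s' _ <-]; exists (os_lin c s s'); rewrite ?os_f_lin.
apply: (subspace_sum sS) => i _; apply: (subspace_sum sS) => j _.
have [s _ sE] : range alpha (adj (d i) ** beta t ** d j).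
  apply: inS; exists (adj (d i) ** beta t); last by exists (d j).
  by exists (adj (d i)); [exists (d i)|exists (beta t) => //; exists t].
rewrite -sE; have [u uE _] := range_mul fmS s (tro_left Nx (Nb i)).
by rewrite -uE; exact: (range_mulr fmS u (tro_left (Nb j) Ny)).
Qed.

Section object.
Variable X : crep ES.
Context {p : nat} {r : 'I_p -> 'B(H, K)}.
Hypothesis (Nr : forall i, N (r i)) (rr : \sum_i r i ** adj (r i) = bid K).
Hypothesis rangeP : forall x y t, N x -> N y -> range alpha (adj x ** beta t ** y).

Let P (i j : 'I_p) := hat alpha X (adj (r i) ** r j).
Let L := corner P.

Lemma row_mull (x : 'B(K, H)) (y : 'B(H, K)) : x ** y = \sum_k (x ** r k) ** (adj (r k) ** y).
Proof.
rewrite -{1}[x]bcomp1r -rr bcomp_sumr bcomp_suml.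
by apply: eq_bigr => k _; rewrite !bcompA.
Qed.

(** Only the left factors x^* r_k have to be multipliers; the right ones may be arbitrary in the
    closure of S. This is what allows y to contain an element of T. *)
Lemma hat_row_mull x y : N x -> (forall k, cS (adj (r k) ** y)) ->
  hat alpha X (adj x ** y) =
  \sum_k hat alpha X (adj x ** r k) ** hat alpha X (adj (r k) ** y).
Proof.
move=> Nx cy; rewrite row_mull (hat_sum fmS) => [|k _]; last first.
  exact: (cs_mull fmS (tro_left Nx (@Nr k)) (cy k)).
by apply: eq_bigr => k _; rewrite (hat_mull fmS X (tro_left Nx (@Nr k)) (cy k)).
Qed.

Lemma hat_row_mulr (u : 'B(K, H)) a : N a -> (forall k, cS (u ** r k)) ->
  hat alpha X (u ** a) =
  \sum_k hat alpha X (u ** r k) ** hat alpha X (adj (r k) ** a).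
Proof.
move=> Na cu; rewrite row_mull (hat_sum fmS) => [|k _]; last first.
  exact: (cs_mulr fmS (tro_left (@Nr k) Na) (cu k)).
by apply: eq_bigr => k _; rewrite (hat_mulr fmS X (tro_left (@Nr k) Na) (cu k)).
Qed.

(** The coordinates come from x (x) xi = sum r_i (x) phi(r_i^* x) xi in the balanced tensor
    product. *)
Lemma row_embedding x : N x -> exists V : 'B(rep_space X, L),
  forall xi i, V xi i = hat alpha X (adj (r i) ** x) xi.
Proof.
move=> Nx; apply: corner_map_exists => i; apply/esym.
exact: (hat_row_mull (@Nr i) (fun k => ad_algebra_closure hM (tro_left (@Nr k) Nx))).
Qed.

Lemma row_compression t : cT t -> exists V : 'B(L),
  forall f i, V f i = \sum_j hat alpha X (adj (r i) ** t ** r j) (f j).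
Proof.
move=> Tt.
have [|V VE] := @corner_map_exists _ _ _ P _
    (fun i => \sum_j hat alpha X (adj (r i) ** t ** r j) ** corner_coord P j).
  move=> i; under eq_bigr => k _ do rewrite bcomp_sumr.
  rewrite exchange_big; apply: eq_bigr => j _ /=.
  have cr k : cS (adj (r k) ** (t ** r j)).
    by rewrite bcompA; exact: (ad_tro_conj hM (@Nr k) Tt (@Nr j)).
  rewrite -bcompA (hat_row_mull (@Nr i) cr) bcomp_suml.
  by apply: eq_bigr => k _; rewrite /P !bcompA.
by exists V => f i; rewrite VE bop_sum.
Qed.

Lemma induced_object_exists : exists (Y : crep ET) nu,
  induced_map alpha beta M (X := X) (Y := Y) nu.
Proof.
have /choice[psi psiE] : forall t : T, exists V : 'B(L), forall f i,
    V f i = \sum_j hat alpha X (adj (r i) ** beta t ** r j) (f j).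
  by move=> t; apply: row_compression; apply: subset_closure; exists t.
have rS i j t : cS (adj (r i) ** beta t ** r j).
  exact: (ad_tro_conj hM (@Nr i) (subset_closure (imageT beta t)) (@Nr j)).
have [lb ub pb] := fm_coe fmT; have [la ua pa] := fm_coe fmS.
have [lX uX pX] := rep_ucp X.
have psi_lin : linear_on psi.
  move=> a x y z zE; apply: bop_ext => g; apply: corner_ext => i.
  rewrite bopD bopZ cornerD cornerZ !psiE scaler_sumr -big_split; apply: eq_bigr => j _.
  by rewrite (lb a x y z zE) bcompDr bcompZr bcompDl bcompZl (hat_lin fmS X a (rS i j x) (rS i j y)).
have psi_unital : unital psi.
  move=> t tE; apply: bop_ext => g; apply: corner_ext => i.
  rewrite psiE (ub t tE); under eq_bigr => j _ do rewrite bcomp1r.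
  exact: cornerP.
(* The matrix with entries r_a^* beta(Z_ij) r_b is the compression of a positive matrix by the
   amplified row. By [rangeP] its entries come from S itself, so complete positivity of [rep_map X]
   applies. *)
have psi_pos n (Z : 'M[T]_n) : mxpos (map_mx val Z) -> mxpos (map_mx psi Z).
  move=> /pb Zpos xi.
  pose I := ('I_n * 'I_p)%type.
  have /choice[s sE] : forall q : I * I, exists s, alpha s =
      adj (r q.1.2) ** beta (Z q.1.1 q.2.1) ** r q.2.2.
    by move=> q; have [s _ <-] := rangeP (Z q.1.1 q.2.1) (@Nr q.1.2) (@Nr q.2.2); exists s.
  pose Q : 'M[S]_#|{: I}| := \matrix_(k, l) s (enum_val k, enum_val l).
  have /pa /pX Qpos : mxpos (map_mx alpha Q).
    move=> eta; pose y := amp_adj r eta.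
    suff -> : \sum_k '[mxact (map_mx alpha Q) eta k, eta k] =
      \sum_i '[mxact (map_mx beta Z) y i, y i] by exact: Zpos.
    transitivity (\sum_(k < #|{: I}|)
        '[mxact (map_mx alpha Q) eta (enum_rank (enum_val k)), eta (enum_rank (enum_val k))]).
      by apply: eq_bigr => k _; rewrite enum_valK.
    rewrite (sum_amp (fun k : I =>
        '[mxact (map_mx alpha Q) eta (enum_rank k), eta (enum_rank k)])).
    apply: eq_bigr => i _; rewrite {2}/y /amp_adj dot_sumr; apply: eq_bigr => a _.
    rewrite -adj_dot; congr '[_, _]; rewrite linear_sum /mxact.
    transitivity (\sum_(l < #|{: I}|) (adj (r a) ** beta (Z i (enum_val l).1) **
        r (enum_val l).2) (eta (enum_rank (enum_val l)))).
      by apply: eq_bigr => l _; rewrite !mxE sE enum_rankK enum_valK.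
    rewrite (sum_amp (fun l : I => (adj (r a) ** beta (Z i l.1) ** r l.2) (eta (enum_rank l)))).
    by apply: eq_bigr => j _; rewrite mxE /y /amp_adj !linear_sum.
  pose eta (k : 'I_#|{: I}|) := (xi (enum_val k).1 : L) (enum_val k).2.
  have := Qpos eta; congr (0 <= _).
  pose F (k : I) := '[\sum_j \sum_b rep_map X (s (k, (j, b))) ((xi j : L) b), (xi k.1 : L) k.2].
  transitivity (\sum_(k < #|{: I}|) F (enum_val k)).
    apply: eq_bigr => k _; congr '[_, _]; rewrite /mxact.
    rewrite -(sum_amp (fun l : I => rep_map X (s (enum_val k, l)) ((xi l.1 : L) l.2))).
    by apply: eq_bigr => l _; rewrite !mxE.
  rewrite sum_amp; apply: eq_bigr => i _; rewrite hdot_corner; apply: eq_bigr => a _.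
  congr '[_, _]; rewrite /mxact corner_sum; apply: eq_bigr => j _.
  rewrite mxE psiE; apply: eq_bigr => b _.
  by rewrite -(hatE fmS) sE.
have psi_ucp : ucp psi by [].
have psi_mult (a b c : T) : multipliers ET a -> multipliers ET b ->
    ie_emb ET c = ie_emb ET a ** ie_emb ET b -> psi c = psi a ** psi b.
  move=> aE bE cE; have [u [uE uM]] := multipliers_mul fmT b aE.
  have -> : c = u by apply: (coe_inj (ie_embP ET)); rewrite cE uE.
  apply: bop_ext => f; apply: corner_ext => i.
  rewrite [RHS]psiE psiE uM.
  transitivity (\sum_k \sum_j hat alpha X (adj (r i) ** beta a ** r k)
      (hat alpha X (adj (r k) ** beta b ** r j) (f j))); last first.
    by apply: eq_bigr => k _; rewrite psiE linear_sum.
  rewrite exchange_big; apply: eq_bigr => j _ /=.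
  (* A multiplier of T is absorbed into the TRO, so that r_i^* a r_k is a multiplier and
     [hat_row_mull] splits the product. *)
  have Na : N (adj (beta a) ** r i).
    apply: (tro_mull (ad_tro hM)) (@Nr i); apply: (fm_star fmT); exact: (fm_multE fmT).
  have rb k : cS (adj (r k) ** (beta b ** r j)) by rewrite bcompA; exact: rS.
  have ab : adj (r i) ** (beta a ** beta b) ** r j =
      adj (adj (beta a) ** r i) ** (beta b ** r j) by rewrite adj_comp adjK !bcompA.
  rewrite ab (hat_row_mull Na rb).
  by rewrite bop_sum; apply: eq_bigr => k _; rewrite adj_comp adjK !bcompA.
have psi_star (a b : T) : multipliers ET a ->
    ie_emb ET b = adj (ie_emb ET a) -> psi b = adj (psi a).
  move=> _ bE; rewrite -(ucp_star psi_ucp); congr psi.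
  apply: (coe_inj (ie_embP ET)); rewrite bE (ucp_star (coe_ucp (ie_embP ET))) //.
pose Y := CRep psi_ucp psi_mult psi_star.
(* Outside the closure of M the value is an arbitrary 0, never consulted by [induced_map]. *)
have /choice[nu nuE] : forall x, exists V : 'B(rep_space X, rep_space Y),
    N x -> forall xi i, (V xi : L) i = hat alpha X (adj (r i) ** x) xi.
  move=> x; case: (pselect (N x)) => [/row_embedding[V VE]|nNx]; first by exists V.
  by exists 0 => /nNx.
have nu_dot a b x (g : L) : N a -> N b ->
    '[(g : rep_space Y), nu b x] = \sum_i '[hat alpha X (adj b ** r i) (g i), x].
  move=> Na Nb; rewrite [LHS]hdot_corner; apply: eq_bigr => i _; rewrite nuE //.
  rewrite -adj_dot -(hat_adj fmS); first by rewrite adj_comp adjK.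
  exact: (ad_algebra_closure hM (tro_left (@Nr i) Nb)).
have inner a b : N a -> N b -> adj (nu b) ** nu a = hat alpha X (adj b ** a).
  move=> Na Nb; apply: bop_ext => x; apply: dot_inj => y.
  rewrite [in LHS]/= adj_dot (nu_dot a) // -dot_suml; congr '[_, _].
  rewrite (hat_row_mull Nb (fun k => ad_algebra_closure hM (tro_left (@Nr k) Na))) bop_sum.
  by apply: eq_bigr => i _; rewrite nuE.
(* The equation P f = f in coordinates, since P_ij = phi(r_i^* r_j); it yields totality of the range
   of [nu]. *)
have nu_row (f : L) : f = \sum_j nu (r j) (f j).
  apply: corner_ext => i; rewrite corner_sum -[LHS]cornerP.
  by apply: eq_bigr => j _; rewrite nuE //; exact: Nr.
exists Y, nu; split=> //.
- move=> a b t Na Nb /closure_seq[u uT ut].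
  have tT n : cT (u n) by apply: subset_closure; exact: uT.
  have Yu := hat_cvg fmT (X := Y) tT ut.
  have h1 : (fun n => adj (nu b) ** hat beta Y (u n) ** nu a) @ \oo -->
      adj (nu b) ** hat beta Y t ** nu a.
    by apply: cvg_bcomp; [apply: cvg_bcomp; [exact: cvg_cst|exact: Yu]|exact: cvg_cst].
  have h2 : (fun n => hat alpha X (adj b ** u n ** a)) @ \oo -->
      hat alpha X (adj b ** t ** a).
    apply: (hat_cvg fmS) => [n|]; first exact: (ad_tro_conj hM Nb (@tT n) Na).
    by apply: cvg_bcomp; [apply: cvg_bcomp; [exact: cvg_cst|exact: ut]|exact: cvg_cst].
  apply: (cvg_unique_norm h1); rewrite (_ : (fun n => _) = fun n => hat alpha X (adj b ** u n ** a)) //.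
  apply/funext => n; have [t' _ <-] := uT n; rewrite (hatE fmT).
  have T't : cT (beta t') by apply: subset_closure; exists t'.
  apply: bop_ext => x; apply: dot_inj => y.
  rewrite [in LHS]/= adj_dot (nu_dot a) // -dot_suml; congr '[_, _].
  have ra k : cS (adj (r k) ** (beta t' ** a)).
    by rewrite bcompA; exact: (ad_tro_conj hM (@Nr k) T't Na).
  rewrite -bcompA (hat_row_mull Nb ra).
  rewrite bop_sum; apply: eq_bigr => i _; rewrite [RHS]/=; congr (bop_fun _ _).
  rewrite psiE bcompA (hat_row_mulr Na) => [|k]; last exact: rS.
  by rewrite bop_sum; apply: eq_bigr => k _; rewrite nuE.
- move=> y yN; have yy : '[y, y] = 0.
    rewrite {1}[y](nu_row y) dot_suml big1 // => j _; apply: yN; exact: Nr.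
  apply: hnorm0_eq0; apply/eqP; rewrite -sqrf_eq0; apply/eqP/(@complexI R).
  by rewrite -dotxx yy.
Qed.

End object.
End induced_object_existence.

Section theta_morphism.
Context {R : realType} {S T : opsys R}.
Context {ES : injective_envelope S} {ET : injective_envelope T}.
Context {H K : hilbertType R} {alpha : S -> 'B(H)} {beta : T -> 'B(K)}.
Context {M : set 'B(H, K)}.
Hypothesis hM : adapted ES ET alpha beta M.
Let N := closure M.
Let cS := closure (range alpha).
Let fmS := ad_modelS hM.
Let fmT := ad_modelT hM.

Hypothesis rangeS : forall x y t, N x -> N y -> range alpha (adj x ** beta t ** y).
Hypothesis rangeT : forall x y s, N x -> N y -> range beta (x ** alpha s ** adj y).

Context {p : nat} {r : 'I_p -> 'B(H, K)}.
Hypothesis (Nr : forall i, N (r i)) (rr : \sum_i r i ** adj (r i) = bid K).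

(** By [rangeS] the coordinates of y lie in the image of X, not just in its closure. Thus [theta]
    evaluates [Phi] itself on them, which is what keeps its values inside the image of Y2. *)
Lemma img_coord (X : crep ES) (Y : crep ET) nu (y : rep_img Y) :
  induced_map alpha beta M (X := X) (Y := Y) nu ->
  exists s : 'I_p -> 'I_p -> S,
    (forall i j, adj (nu (r i)) ** val y ** nu (r j) = rep_map X (s i j)) /\
    val y = \sum_i \sum_j nu (r i) ** hat alpha X (alpha (s i j)) ** adj (nu (r j)).
Proof.
move=> im; have [t _ ty] : rep_img Y (val y) by exact: set_mem (valP y).
have /choice[s sE] : forall q : 'I_p * 'I_p, exists s,
    alpha s = adj (r q.1) ** beta t ** r q.2.
  by move=> q; have [s _ <-] := rangeS t (@Nr q.1) (@Nr q.2); exists s.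
have ys i j : adj (nu (r i)) ** val y ** nu (r j) = rep_map X (s (i, j)).
  rewrite -ty -(hatE fmT) (im_rep im (@Nr j) (@Nr i) (subset_closure (imageT beta t))).
  by rewrite -(sE (i, j)) (hatE fmS).
exists (fun i j => s (i, j)); split=> //.
rewrite {1}(row_expand hM im Nr rr (val y)); apply: eq_bigr => i _; apply: eq_bigr => j _.
by rewrite ys (hatE fmS).
Qed.

Lemma alpha_cS s : cS (alpha s).
Proof. by apply: subset_closure; exists s. Qed.

Section two.
Context {X1 X2 : crep ES} {Y1 Y2 : crep ET}.
Context {nu1 : 'B(H, K) -> 'B(rep_space X1, rep_space Y1)}.
Context {nu2 : 'B(H, K) -> 'B(rep_space X2, rep_space Y2)}.
Hypothesis im1 : induced_map alpha beta M nu1.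
Hypothesis im2 : induced_map alpha beta M nu2.
Variable Phi : rep_hom X1 X2.
Let th := theta (nu1 := nu1) (nu2 := nu2) (r := r) Phi.

Lemma theta_lin a x y : closure (rep_img Y1) x -> closure (rep_img Y1) y ->
  th (a *: x + y) = a *: th x + th y.
Proof.
move=> xI yI; rewrite /th /theta scaler_sumr -big_split; apply: eq_bigr => i _ /=.
rewrite scaler_sumr -big_split; apply: eq_bigr => j _ /=.
rewrite bcompDr bcompZr bcompDl bcompZl (rh_ext_lin Phi).
- by rewrite bcompDr bcompZr bcompDl bcompZl.
- exact: (im_img hM im1 (@Nr j) (@Nr i) xI).
- exact: (im_img hM im1 (@Nr j) (@Nr i) yI).
Qed.

Lemma theta_sum J (q : seq J) (x : J -> 'B(rep_space Y1)) :
  (forall j, closure (rep_img Y1) (x j)) ->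
  th (\sum_(j <- q) x j) = \sum_(j <- q) th (x j).
Proof.
move=> xI; have sI := closure_subspace (rep_img_subspace Y1).
have th0 : th 0 = 0.
  have := theta_lin 1 (subspace0 sI) (subspace0 sI); rewrite scaler0 addr0 scale1r.
  by move/eqP; rewrite -subr_eq0 opprD addNKr oppr_eq0 => /eqP.
elim: q => [|j q IH]; first by rewrite !big_nil.
rewrite !big_cons -IH -[x j]scale1r theta_lin ?scale1r //.
by apply: (subspace_sum sI) => i _; exact: xI.
Qed.

Lemma conj_in_img (X : crep ES) (Y : crep ET) nu m n s :
  induced_map alpha beta M (X := X) (Y := Y) nu ->
  N m -> N n -> rep_img Y (nu m ** hat alpha X (alpha s) ** adj (nu n)).
Proof.
move=> im Nm Nn; rewrite -(im_conj hM im Nm Nn (@alpha_cS s)).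
by have [t _ <-] := rangeT s Nm Nn; rewrite (hatE fmT); exists t.
Qed.

Lemma theta_img (y : rep_img Y1) : th (val y) \in rep_img Y2.
Proof.
apply/mem_set; have [s [ys _]] := img_coord y im1.
have sI := rep_img_subspace Y2.
apply: (subspace_sum sI) => i _; apply: (subspace_sum sI) => j _.
rewrite ys (_ : rep_map X1 (s i j) = val (to_img X1 (s i j))) // rh_extE.
have [s' _ <-] : rep_img X2 (val (Phi (to_img X1 (s i j)))) by exact: set_mem (valP _).
by rewrite -(hatE fmS); apply: conj_in_img; [exact: im2|exact: Nr|exact: Nr].
Qed.

Definition theta_fun (y : rep_img Y1) : rep_img Y2 := SigSub (theta_img y).

Lemma img_closure (Y : crep ET) (y : rep_img Y) : closure (rep_img Y) (val y).
Proof. by apply: subset_closure; exact: set_mem (valP y). Qed.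

Lemma theta_linear : linear_on (fun y => val (theta_fun y)).
Proof. by move=> a x y z /= ->; rewrite theta_lin //; exact: img_closure. Qed.

Lemma theta_cb : completely_bounded (fun y => val (theta_fun y)).
Proof.
have [c c0 cE] := rep_cb_normE Phi.
apply: (@le_lt_trans _ _ c%:E); last exact: ltry.
apply: ge_ereal_sup => _ [n [Z [Z1 ->]]]; rewrite lee_fin.
have -> : map_mx (fun y => val (theta_fun y)) Z = map_mx th (map_mx val Z).
  by apply/matrixP => i j; rewrite !mxE.
rewrite (le_trans (theta_bound hM im1 im2 Nr rr c0 _ _)) ?cE //.
  by move=> i j; rewrite mxE; exact: img_closure.
by rewrite ler_piMr.
Qed.

(** Multipliers of T are absorbed by M: psi(a) nu(r_i) = nu(a r_i), and similarly on the right with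
    the adjoint of b. Then [theta_conj] applies to the rows a r_i and b^* r_j in place of r. *)
Lemma theta_bimod (a b : T) (x y : rep_img Y1) :
  multipliers ET a -> multipliers ET b ->
  val y = rep_map Y1 a ** val x ** rep_map Y1 b ->
  val (theta_fun y) = rep_map Y2 a ** val (theta_fun x) ** rep_map Y2 b.
Proof.
move=> aE bE /= ->.
have Ba := fm_multE fmT aE; have Bb := fm_star fmT (fm_multE fmT bE).
have [s [_ xs]] := img_coord x im1.
have Na i : N (beta a ** r i) by exact: (tro_mull (ad_tro hM) Ba (@Nr i)).
have Nb i : N (adj (beta b) ** r i) by exact: (tro_mull (ad_tro hM) Bb (@Nr i)).
have nuL (X : crep ES) (Y : crep ET) nu : induced_map alpha beta M (X := X) (Y := Y) nu ->
    forall i, rep_map Y a ** nu (r i) = nu (beta a ** r i).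
  by move=> im i; rewrite (im_mull hM im Ba (@Nr i)) (hatE fmT).
have nuR (X : crep ES) (Y : crep ET) nu : induced_map alpha beta M (X := X) (Y := Y) nu ->
    forall i, adj (nu (r i)) ** rep_map Y b = adj (nu (adj (beta b) ** r i)).
  move=> im i; rewrite (im_mull hM im Bb (@Nr i)) adj_comp -(hat_adj fmT) ?adjK ?(hatE fmT) //.
  exact: (cs_A fmT Bb).
have E (Y : crep ET) (X : crep ES) nu (Z : 'I_p -> 'I_p -> 'B(rep_space X)) :
    induced_map alpha beta M (X := X) (Y := Y) nu ->
    rep_map Y a ** (\sum_i \sum_j nu (r i) ** Z i j ** adj (nu (r j))) ** rep_map Y b =
    \sum_i \sum_j nu (beta a ** r i) ** Z i j ** adj (nu (adj (beta b) ** r j)).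
  move=> im; rewrite bcomp_sumr bcomp_suml; apply: eq_bigr => i _.
  rewrite bcomp_sumr bcomp_suml; apply: eq_bigr => j _.
  by rewrite -(nuL _ _ _ im) -(nuR _ _ _ im) !bcompA.
have xI i j m n : N m -> N n ->
    closure (rep_img Y1) (nu1 m ** hat alpha X1 (alpha (s i j)) ** adj (nu1 n)).
  by move=> Nm Nn; apply: subset_closure; exact: conj_in_img.
have thx : th (val x) = \sum_i \sum_j
    nu2 (r i) ** rh_ext Phi (hat alpha X1 (alpha (s i j))) ** adj (nu2 (r j)).
  rewrite xs theta_sum => [|i]; last first.
    apply: (subspace_sum (closure_subspace (rep_img_subspace Y1))) => j _.
    by apply: xI; exact: Nr.
  apply: eq_bigr => i _; rewrite theta_sum => [|j]; last by apply: xI; exact: Nr.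
  apply: eq_bigr => j _.
  exact: (theta_conj hM im1 im2 Nr rr Phi (@Nr i) (@Nr j) (@alpha_cS (s i j))).
rewrite thx {1}xs !E // theta_sum => [|i]; last first.
  apply: (subspace_sum (closure_subspace (rep_img_subspace Y1))) => j _.
  by apply: xI; [exact: Na|exact: Nb].
apply: eq_bigr => i _; rewrite theta_sum => [|j]; last by apply: xI; [exact: Na|exact: Nb].
apply: eq_bigr => j _.
exact: (theta_conj hM im1 im2 Nr rr Phi (@Na i) (@Nb j) (@alpha_cS (s i j))).
Qed.

Definition theta_hom : rep_hom Y1 Y2 := RepHom theta_linear theta_cb theta_bimod.

End two.

Lemma theta_id (X : crep ES) (Y : crep ET) nu (y : rep_img Y) :
  induced_map alpha beta M (X := X) (Y := Y) nu ->
  theta (nu1 := nu) (nu2 := nu) (r := r) (rep_id X) (val y) = val y.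
Proof.
move=> im; have [s [ys]] := img_coord y im => {2}->.
apply: eq_bigr => i _; apply: eq_bigr => j _; rewrite ys (hatE fmS).
by rewrite (_ : rep_map X (s i j) = val (to_img X (s i j))) // rh_extE.
Qed.

(** The inner value is a finite sum of conjugates nu2(r_i) phi2(s'_ij) nu2(r_j)^*, on which
    [theta_conj] computes the outer map. *)
Lemma theta_comp (X1 X2 X3 : crep ES) (Y1 Y2 Y3 : crep ET) nu1 nu2 nu3
    (g : rep_hom X2 X3) (f : rep_hom X1 X2) (y : rep_img Y1) :
  induced_map alpha beta M (X := X1) (Y := Y1) nu1 ->
  induced_map alpha beta M (X := X2) (Y := Y2) nu2 ->
  induced_map alpha beta M (X := X3) (Y := Y3) nu3 ->
  theta (nu1 := nu1) (nu2 := nu3) (r := r) (rep_comp g f) (val y) =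
  theta (nu1 := nu2) (nu2 := nu3) (r := r) g
    (theta (nu1 := nu1) (nu2 := nu2) (r := r) f (val y)).
Proof.
move=> im1 im2 im3; have [s [ys _]] := img_coord y im1.
have /choice[s' s'E] : forall q : 'I_p * 'I_p, exists s',
    rep_map X2 s' = val (f (to_img X1 (s q.1 q.2))).
  by move=> q; have [s' _ <-] : rep_img X2 (val (f (to_img X1 (s q.1 q.2))));
    [exact: set_mem (valP _)|exists s'].
have -> : theta (nu1 := nu1) (nu2 := nu2) (r := r) f (val y) =
    \sum_i \sum_j nu2 (r i) ** hat alpha X2 (alpha (s' (i, j))) ** adj (nu2 (r j)).
  apply: eq_bigr => i _; apply: eq_bigr => j _; rewrite ys (hatE fmS) s'E.
  by rewrite (_ : rep_map X1 (s i j) = val (to_img X1 (s i j))) // rh_extE.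
have xI i j : closure (rep_img Y2)
    (nu2 (r i) ** hat alpha X2 (alpha (s' (i, j))) ** adj (nu2 (r j))).
  by apply: subset_closure; apply: conj_in_img; [exact: im2|exact: Nr|exact: Nr].
rewrite (theta_sum im2) => [|i]; last first.
  by apply: (subspace_sum (closure_subspace (rep_img_subspace Y2))) => j _; exact: xI.
apply: eq_bigr => i _; rewrite (theta_sum im2) => [|j]; last exact: xI.
apply: eq_bigr => j _.
rewrite (theta_conj hM im2 im3 Nr rr g (@Nr i) (@Nr j) (@alpha_cS (s' (i, j)))).
congr (_ ** _ ** _); rewrite ys (hatE fmS) s'E.
by rewrite (_ : rep_map X1 (s i j) = val (to_img X1 (s i j))) // !rh_extE.
Qed.

End theta_morphism.

Section induced_functor_existence.
Context {R : realType} {S T : opsys R}.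
Context {ES : injective_envelope S} {ET : injective_envelope T}.
Context {H K : hilbertType R} {alpha : S -> 'B(H)} {beta : T -> 'B(K)}.
Context {M : set 'B(H, K)}.
Hypothesis hM : adapted ES ET alpha beta M.
Hypothesis inS : prod_set (prod_set (adj_set M) (range beta)) M `<=` range alpha.
Hypothesis inT : prod_set (prod_set M (range alpha)) (adj_set M) `<=` range beta.

Lemma induced_functor_exists :
  exists F : functor (Rep ES) (Rep ET), induced_functor alpha beta M F.
Proof.
have rangeS := closure_conj_range hM inS.
have rangeT x y s : closure M x -> closure M y -> range beta (x ** alpha s ** adj y).
  move=> /closure_adj_set Mx /closure_adj_set My.
  have := @closure_conj_range _ _ _ _ _ _ _ _ _ _ (adapted_adj hM) _ _ _ s Mx My.
  by rewrite adj_setK adjK; apply.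
have [p [r [Nr rr]]] := ad_row hM.
have FE (X : crep ES) : {Y : crep ET & {nu | induced_map alpha beta M (X := X) (Y := Y) nu}}.
  have /cid[Y /cid nuY] := induced_object_exists hM X Nr rr rangeS.
  by exists Y.
pose F0 X := projT1 (FE X); pose nu X := sval (projT2 (FE X)).
have im X : induced_map alpha beta M (nu X) := svalP (projT2 (FE X)).
pose F1 (X1 X2 : crep ES) (f : rep_hom X1 X2) : rep_hom (F0 X1) (F0 X2) :=
  theta_hom hM rangeS rangeT Nr rr (im X1) (im X2) f.
have F1id X : F1 X X (rep_id X) = rep_id (F0 X).
  by apply: rep_hom_eq => y; exact: (theta_id hM rangeS Nr rr y (im X)).
have F1comp (X1 X2 X3 : crep ES) (g : rep_hom X2 X3) (f : rep_hom X1 X2) :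
    F1 _ _ (rep_comp g f) = rep_comp (F1 _ _ g) (F1 _ _ f).
  by apply: rep_hom_eq => y;
    exact: (theta_comp hM rangeS rangeT Nr rr g f y (im X1) (im X2) (im X3)).
exists (@Functor (Rep ES) (Rep ET) F0 F1 F1id F1comp).
exists (fun X (m : M) => nu X (val m)); split=> [X|X1 X2 f m n s].
  exact: (induced_object_of_map hM (im X)).
have Ss : closure (range alpha) (alpha s) by apply: subset_closure; exists s.
have Nm := @val_closure _ _ _ _ m; have Nn := @val_closure _ _ _ _ n.
have yI : rep_img (F0 X1) (nu X1 (val n) ** rep_map X1 s ** adj (nu X1 (val m))).
  rewrite -(hatE (ad_modelS hM)).
  exact: (conj_in_img hM rangeT s (im X1) Nn Nm).
apply: subset_closure; exists (SigSub (mem_set yI)) => //=; congr (_, _).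
rewrite -[rep_map X1 s](hatE (ad_modelS hM)).
rewrite (theta_conj hM (im X1) (im X2) Nr rr f Nn Nm Ss) (hatE (ad_modelS hM)).
by rewrite -rh_extE.
Qed.

End induced_functor_existence.

Lemma cc_equivalence_of_induced (R : realType) (S T : opsys R)
    (ES : injective_envelope S) (ET : injective_envelope T) (H K : hilbertType R)
    (alpha : S -> 'B(H)) (beta : T -> 'B(K)) (M : set 'B(H, K))
    (hM : adapted ES ET alpha beta M)
    (F : functor (Rep ES) (Rep ET)) (G : functor (Rep ET) (Rep ES)) :
  induced_functor alpha beta M F -> induced_functor beta alpha (adj_set M) G ->
  cc_equivalence F G.
Proof.
move=> iF iG; split.
- exact: (compose_naturally_equivalent hM iF iG).
- by apply: (compose_naturally_equivalent (adapted_adj hM) iG); rewrite adj_setK.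
- exact: (induced_completely_contractive hM iF).
- exact: (induced_completely_contractive (adapted_adj hM) iG).
Qed.

(** The functors are specified by their objects up to completion and by their values on conjugates;
    hence the first part quantifies over all F and G meeting the specification. Existence is stated
    under exact inclusions, by which r_i^* t r_j comes from S itself and F(Phi) takes its values in
    psi2(T). Both inclusions hold as soon as the two images are norm closed. *)
Theorem theorem4p1 (R : realType) (S T : opsys R)
    (hST : delta_equivalent S T)
    (ES : injective_envelope S) (ET : injective_envelope T)
    (H K : hilbertType R)
    (alpha : S -> bop H H) (beta : T -> bop K K) (M : set (bop H K))
    (hM : adapted ES ET alpha beta M) :
  (forall (F : functor (Rep ES) (Rep ET)) (G : functor (Rep ET) (Rep ES)),
      induced_functor alpha beta M F ->
      induced_functor beta alpha (adj_set M) G ->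
      cc_equivalence F G) /\
  (prod_set (prod_set (adj_set M) (range beta)) M `<=` range alpha ->
   prod_set (prod_set M (range alpha)) (adj_set M) `<=` range beta ->
   exists (F : functor (Rep ES) (Rep ET)) (G : functor (Rep ET) (Rep ES)),
     [/\ induced_functor alpha beta M F,
         induced_functor beta alpha (adj_set M) G &
         cc_equivalence F G]).
Proof.
split=> [F G iF iG|inS inT]; first exact: (cc_equivalence_of_induced hM iF iG).
have [F iF] := induced_functor_exists hM inS inT.
have [G iG] : exists G : functor (Rep ET) (Rep ES), induced_functor beta alpha (adj_set M) G.
  by apply: (induced_functor_exists (adapted_adj hM)); rewrite adj_setK.
exists F, G; split=> //; exact: (cc_equivalence_of_induced hM iF iG).
Qed.
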